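(* Let $\Gamma\subset\Omega$ be a regular region on the unit sphere, let $F\in C^{(0)}(\partial\Gamma)$ and $H\in C^{(1)}(\overline{\Gamma})$. Then there exists a unique solution $U\in C^{(2)}(\Gamma)\cap C^{(0)}(\overline{\Gamma})$ of the Dirichlet problem $$\Delta^*U(\xi)=H(\xi),\quad \xi\in\Gamma,\qquad\qquad U^-(\xi)=F(\xi),\quad \xi\in\partial\Gamma.$$
   Context: $\Omega=\{x\in\mathbb{R}^3:|x|=1\}$ is the unit sphere and $\Delta^*$ is the Beltrami operator (Laplace–Beltrami operator) on $\Omega$. A regular region $\Gamma\subset\Omega$ is a subdomain (open, connected, proper) of $\Omega$ whose boundary $\partial\Gamma$ is a sufficiently smooth simple closed curve (at least of class $C^2$). $\nu(\xi)$ denotes the unit normal vector at $\xi\in\partial\Gamma$ that is tangential to $\Omega$, perpendicular to $\partial\Gamma$, and points to the exterior of $\Gamma$. For $\xi\in\partial\Gamma$, $$U^-(\xi)=\lim_{\tau\to0+}U\left(\frac{\xi-\tau\nu(\xi)}{\sqrt{1+\tau^2}}\right).$$ All functions are real-valued; $C^{(k)}$ denotes $k$-times continuously differentiable functions. *)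

(* Defs.v *)
From HB Require Import structures.
From mathcomp Require Import all_boot all_order all_algebra.
From mathcomp Require Import all_classical all_reals all_analysis.

Set Implicit Arguments.
Unset Strict Implicit.
Unset Printing Implicit Defensive.

Import Order.TTheory GRing.Theory Num.Theory.
Import numFieldNormedType.Exports.

Local Open Scope classical_set_scope.
Local Open Scope ring_scope.

(* The library norm on 'rV[R]_3 is the sup norm: it induces the usual topology
   (so closure, continuity and derivatives are the library's), but the metric
   notions below need the Euclidean inner product and norm. *)
Definition dotv (R : realType) (u v : 'rV[R]_3) : R :=
  \sum_(i < 3) u 0 i * v 0 i.

Definition enorm (R : realType) (u : 'rV[R]_3) : R := Num.sqrt (dotv u u).

Definition sphere (R : realType) : set 'rV[R]_3 := [set x | enorm x = 1].
Arguments sphere : clear implicits.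

Definition sphere_proj (R : realType) (x : 'rV[R]_3) : 'rV[R]_3 :=
  (enorm x)^-1 *: x.

(* Surface gradient: Cartesian gradient of the extension of f that is constant
   along rays. From nabla = xi d/dr + (1/r) nabla^*, on the sphere this is
   exactly nabla^* f, as a vector of R^3 tangential to the sphere. Only the
   values of f on the sphere matter. *)
Definition surf_grad (R : realType) (f : 'rV[R]_3 -> R) (xi : 'rV[R]_3) :
    'rV[R]_3 :=
  \row_i 'D_(delta_mx 0 i) (f \o @sphere_proj R) xi.

Definition surf_div (R : realType) (v : 'rV[R]_3 -> 'rV[R]_3)
    (xi : 'rV[R]_3) : R :=
  \sum_(i < 3) surf_grad (fun eta => v eta 0 i) xi 0 i.

Definition beltrami (R : realType) (f : 'rV[R]_3 -> R) : 'rV[R]_3 -> R :=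
  surf_div (surf_grad f).

(* C^(k)(G) for G relatively open in the sphere. The partial derivatives of the
   ray-constant extension are homogeneous of degree -1, so it is enough to ask
   for existence and continuity on G itself. *)
Fixpoint sphere_C (R : realType) (k : nat) (G : set 'rV[R]_3)
    (f : 'rV[R]_3 -> R) : Prop :=
  if k is k'.+1 then
    {within G, continuous f} /\
    forall i : 'I_3,
      (forall xi, G xi ->
         derivable (f \o @sphere_proj R) xi (delta_mx 0 i)) /\
      sphere_C k' G (fun xi => surf_grad f xi 0 i)
  else {within G, continuous f}.

(* C^(1) up to the boundary: f and its first derivatives extend continuously
   from G to its closure. *)
Definition sphere_C1_closure (R : realType) (G : set 'rV[R]_3)
    (f : 'rV[R]_3 -> R) : Prop :=
  [/\ {within closure G, continuous f},
      sphere_C 1 G f &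
      exists2 g : 'rV[R]_3 -> 'rV[R]_3,
        {within closure G, continuous g} &
        forall xi, G xi -> g xi = surf_grad f xi].

(* Boundary relative to the sphere (in R^3 every subset of the sphere has
   empty interior). The closure needs no relativization: the sphere is
   closed. *)
Definition sphere_boundary (R : realType) (G : set 'rV[R]_3) :
    set 'rV[R]_3 :=
  closure G `&` closure (sphere R `\` G).

(* gamma is a regular 1-periodic parametrization of class C^2, injective on a
   period, of the closed curve C. *)
Definition C2_simple_closed_param (R : realType) (gamma : R -> 'rV[R]_3)
    (C : set 'rV[R]_3) : Prop :=
  [/\ (forall t, derivable gamma t 1),
      (forall t, derivable (derive1 gamma) t 1) &
      continuous (derive1 (derive1 gamma))] /\
  [/\ (forall t, derive1 gamma t != 0),
      (forall t, gamma (t + 1) = gamma t),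
      (forall s t, 0 <= s < 1 -> 0 <= t < 1 -> gamma s = gamma t -> s = t) &
      range gamma = C].

Definition regular_region (R : realType) (G : set 'rV[R]_3) : Prop :=
  [/\ (exists2 O : set 'rV[R]_3, open O & G = sphere R `&` O),
      G !=set0, G <> sphere R, connected G &
      exists gamma, C2_simple_closed_param gamma (sphere_boundary G)].

(* The last condition says that n points to the exterior (the complement of
   the closure) of G. *)
Definition is_outer_normal (R : realType) (G : set 'rV[R]_3)
    (xi n : 'rV[R]_3) : Prop :=
  [/\ enorm n = 1,
      dotv n xi = 0,
      (exists gamma t, [/\ C2_simple_closed_param gamma (sphere_boundary G),
         gamma t = xi & dotv n (derive1 gamma t) = 0]) &
      \forall t \near 0^'+,
        ~ closure G ((Num.sqrt (1 + t ^+ 2))^-1 *: (xi + t *: n))].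

(* The three algebraic conditions determine n up to sign and the last one fixes
   the sign, so the choice is among at most one vector. *)
Definition outer_normal (R : realType) (G : set 'rV[R]_3) (xi : 'rV[R]_3) :
    'rV[R]_3 :=
  xget 0 [set n | is_outer_normal G xi n].

(* U^-(xi) exists and equals l *)
Definition interior_limit (R : realType) (G : set 'rV[R]_3)
    (U : 'rV[R]_3 -> R) (xi : 'rV[R]_3) (l : R) : Prop :=
  U ((Num.sqrt (1 + t ^+ 2))^-1 *: (xi - t *: outer_normal G xi))
    @[t --> 0^'+] --> l.

(* Only the values of U on the closure of G matter. *)
Definition dirichlet_solution (R : realType) (G : set 'rV[R]_3)
    (F H U : 'rV[R]_3 -> R) : Prop :=
  [/\ sphere_C 2 G U,
      {within closure G, continuous U},
      (forall xi, G xi -> beltrami U xi = H xi) &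
      forall xi, sphere_boundary G xi -> interior_limit G U xi (F xi)].

(* Main.v *)
(* All functions are extended to R^3 as constants along rays, so that the Beltrami operator on
   the sphere becomes the ordinary Laplacian, and everything is done with the maximum principle.
   Existence is Perron's method: the supremum of the viscosity subsolutions that stay below F on
   the boundary. It is locally a uniform limit of classical solutions, since on small spherical
   caps the Dirichlet problem is solved explicitly for polynomial data in stereographic
   coordinates and Bernstein approximation passes to continuous data; a gradient estimate by
   reflection makes such limits of class C^2. Boundary values are attained because a C^2 curve
   has, at each of its points, an exterior touching cap, whose pole gives a barrier. That
   exactly one of the two caps touching the curve at a point is exterior is the Jordan
   curve theorem: the integral over the curve of an angle form is locally constant off the curve
   but jumps across it, so the connected set G cannot lie on both sides. *)
Require Import Defs.
From mathcomp Require Import all_boot all_order all_algebra.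
From mathcomp Require Import all_classical all_reals all_analysis.
From mathcomp Require Import ring lra.
Import Order.TTheory GRing.Theory Num.Theory.
Import numFieldNormedType.Exports.

Set Implicit Arguments.
Unset Strict Implicit.
Unset Printing Implicit Defensive.

Local Open Scope classical_set_scope.
Local Open Scope ring_scope.

(** * Derivation and continuity rules *)

Section Calculus.
Context {R : realType}.

(** No mean value property, representation formula or strong maximum principle is used. Comparisons
    on the sphere are made strict by a multiple of the explicit function [phi], whose Laplacian is
    positive away from its pole; on the whole closure of [G] such a pole is available because the
    exterior of [G] is nonempty. The cap problem is explicit because stereographic coordinates are
    conformal: the Laplacian of a ray-constant function is its planar Laplacian divided by
    [den ^+ 2]. If [beltrami U = H], the ray-constant extension of [U] has Laplacian
    [H (x / |x|) / |x| ^ 2]; differentiability of [H] makes this locally Lipschitz, which is what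
    the regularity theorem needs. Deciding on which side of the curve [G] lies serves twice: it
    yields the exterior caps for the barriers, and it shows that [outer_normal] is a genuine normal
    along which [G] is approached. Only then do the prescribed limits along the normal determine the
    continuous boundary values, and uniqueness reduces to comparison. *)

Lemma is_derive_line (V W : normedModType R) (f : V -> W) (x v : V) (t : R) df :
  is_derive (x + t *: v) v f df <-> is_derive t 1 (fun s => f (x + s *: v)) df.
Proof.
suff E : (fun h : R => h^-1 *: ((f \o shift (x + t *: v)) (h *: v)
    - f (x + t *: v))) =
   (fun h : R => h^-1 *: (((fun s => f (x + s *: v)) \o shift t) (h *: (1:R))
    - f (x + t *: v))).
  by split => -[D1 D2]; split; move: D1 D2; rewrite /derivable /derive E.
apply/funext => h /=; congr (_ *: (f _ - _)).
by rewrite [h *: 1]mulr1 scalerDl addrC -addrA [t *: v + _]addrC.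
Qed.

Lemma is_derive_line0 (V W : normedModType R) (f : V -> W) (x v : V) df :
  is_derive x v f df <-> is_derive (0 : R) 1 (fun s => f (x + s *: v)) df.
Proof. by rewrite -is_derive_line scale0r addr0. Qed.

Section Rules.
Context {V : normedModType R}.
Implicit Types (f g : V -> R) (x v : V).

Lemma dvC (c : R) x v : is_derive x v (fun=> c) 0.
Proof. exact: is_derive_cst. Qed.

Lemma dvD f g x v a b : is_derive x v f a -> is_derive x v g b ->
  is_derive x v (fun y => f y + g y) (a + b).
Proof. exact: is_deriveD. Qed.

Lemma dvN f x v a : is_derive x v f a -> is_derive x v (fun y => - f y) (- a).
Proof. exact: is_deriveN. Qed.

Lemma dvB f g x v a b : is_derive x v f a -> is_derive x v g b ->
  is_derive x v (fun y => f y - g y) (a - b).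
Proof. exact: is_deriveB. Qed.

Lemma dvM f g x v a b : is_derive x v f a -> is_derive x v g b ->
  is_derive x v (fun y => f y * g y) (f x * b + g x * a).
Proof. exact: is_deriveM. Qed.

Lemma dvX f n x v a : is_derive x v f a ->
  is_derive x v (fun y => f y ^+ n) (n%:R * f x ^+ n.-1 * a).
Proof. by move=> D; have := @is_deriveX _ _ f n x v a D; rewrite exprfctE. Qed.

Lemma dvV f x v a : f x != 0 -> is_derive x v f a ->
  is_derive x v (fun y => (f y)^-1) (- (a / f x ^+ 2)).
Proof.
move=> fx [D1 D2]; split; first exact: derivableV.
by rewrite deriveV// D2 /GRing.scale/= mulNr mulrC.
Qed.

Lemma dvcomp (k : R -> R) f x v a b : is_derive (f x) 1 k b -> is_derive x v f a ->
  is_derive x v (fun y => k (f y)) (b * a).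
Proof.
move=> D1 /is_derive_line0 D2; apply/is_derive_line0.
apply: (@is_derive1_comp _ k (fun s => f (x + s *: v))) => //.
by rewrite scale0r addr0.
Qed.

End Rules.

Lemma dvid (x : R) : is_derive x 1 (fun y => y) 1.
Proof. exact: is_derive_id. Qed.

(** If [h > 0], then [g'], which vanishes at the maximum, is positive just to the right of 0, and
    the mean value theorem makes [g] exceed [g 0] there. *)
Lemma second_deriv_max (g g' : R -> R) (h d : R) : 0 < d ->
  (forall t : R, `|t| < d -> is_derive t 1 g (g' t)) -> is_derive (0 : R) 1 g' h ->
  (forall t, `|t| < d -> g t <= g 0) -> h <= 0.
Proof.
move=> d0 dg dg' gmax.
have g'0 : g' 0 = 0.
  have D0 : is_derive (0:R) 1 g (g' 0) by apply: dg; rewrite normr0.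
  have dd : - d <= d by lra.
  case: D0 => _ <-; case: (@derive1_at_max R g (- d) d 0 dd _ _ _) => //.
  - move=> t; rewrite in_itv/= => td.
    by have [] : is_derive t 1 g (g' t) by apply: dg; rewrite ltr_norml.
  - by rewrite in_itv/= oppr_lt0 d0.
  - by move=> t; rewrite in_itv/= => td; apply: gmax; rewrite ltr_norml.
rewrite leNgt; apply/negP => h0.
have [+ Eh] := dg'; rewrite /derive in Eh => /cvg_ex[l /[dup] Hl /(cvg_lim (@Rhausdorff _))].
rewrite Eh => lh; rewrite -{}lh in Hl.
move/cvgrPdist_lt: Hl => /(_ h h0); rewrite near_withinE near_simpl => /nbhs_ballP[e /= e0 He].
have P t : 0 < t -> t < e -> 0 < g' t.
  move=> t0 te; have := He t; rewrite /= /ball /= sub0r normrN gtr0_norm//.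
  move=> /(_ te (lt0r_neq0 t0)); rewrite g'0 subr0 addr0 [t *: 1]mulr1 => H1.
  have : 0 < t^-1 *: g' t.
    have := ler_norm (h - t^-1 *: g' t); move: H1; lra.
  by rewrite /GRing.scale/= pmulr_rgt0// invr_gt0.
pose m := Num.min d e / 2.
have me : 0 < Num.min d e by rewrite lt_min d0.
have m0 : 0 < m by rewrite divr_gt0.
have mme : m < Num.min d e by rewrite /m; lra.
have md : m < d by apply: (lt_le_trans mme); rewrite ge_min lexx.
have mme' : m < e by apply: (lt_le_trans mme); rewrite ge_min lexx orbT.
have [||c] := @MVT R g g' 0 m m0.
- by move=> x; rewrite in_itv/= => /andP[x0 xm]; apply: dg; rewrite gtr0_norm//; lra.
- apply: derivable_within_continuous => x; rewrite in_itv/= => /andP[x0 xm].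
  by have [] : is_derive x 1 g (g' x) by apply: dg; rewrite ger0_norm//; lra.
rewrite in_itv/= => /andP[c0 cm] E.
have : 0 < g' c by apply: P => //; lra.
have : g m <= g 0 by apply: gmax; rewrite gtr0_norm.
move=> H1 H2; have : 0 < g' c * (m - 0) by rewrite subr0 mulr_gt0.
by rewrite -E; lra.
Qed.

Lemma is_derive_bound (f : R -> R) (f' : R -> R) (a b K : R) : a <= b ->
  (forall t : R, a <= t <= b -> is_derive t 1 f (f' t)) ->
  (forall t, a <= t <= b -> `|f' t| <= K) -> `|f b - f a| <= K * (b - a).
Proof.
move=> ab df fK.
have [||c] := @MVT_segment R f f' a b ab.
- by move=> x; rewrite in_itv/= => /andP[/ltW x1 /ltW x2]; apply: df; rewrite x1 x2.
- apply: derivable_within_continuous => x; rewrite in_itv/= => xab.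
  by have [] := df _ xab.
rewrite in_itv/= => cab ->; rewrite normrM (ger0_norm (_ : 0 <= b - a)) ?subr_ge0//.
by rewrite ler_wpM2r ?subr_ge0// fK.
Qed.

End Calculus.

(** A named head symbol on which [cstep] can match. *)
Definition ctn (T U : topologicalType) (f : T -> U) (x : T) := {for x, continuous f}.

Section Continuity.
Context {R : realType} {T : topologicalType}.
Implicit Types (f g : T -> R) (x : T).

Lemma ctnC (U : topologicalType) (c : U) x : ctn (fun=> c) x.
Proof. exact: cvg_cst. Qed.

Lemma ctnid x : ctn (fun y => y) x.
Proof. exact: cvg_id. Qed.

Lemma ctnD (V : normedModType R) (f g : T -> V) x :
  ctn f x -> ctn g x -> ctn (fun y => f y + g y) x.
Proof. exact: continuousD. Qed.

Lemma ctnN (V : normedModType R) (f : T -> V) x : ctn f x -> ctn (fun y => - f y) x.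
Proof. exact: continuousN. Qed.

Lemma ctnB (V : normedModType R) (f g : T -> V) x :
  ctn f x -> ctn g x -> ctn (fun y => f y - g y) x.
Proof. exact: continuousB. Qed.

Lemma ctnM f g x : ctn f x -> ctn g x -> ctn (fun y => f y * g y) x.
Proof. exact: continuousM. Qed.

Lemma ctnZ (V : normedModType R) f (g : T -> V) x :
  ctn f x -> ctn g x -> ctn (fun y => f y *: g y) x.
Proof. exact: continuousZ. Qed.

Lemma ctnV f x : f x != 0 -> ctn f x -> ctn (fun y => (f y)^-1) x.
Proof. by move=> f0 cf; exact: cvgV. Qed.

Lemma ctnX f n x : ctn f x -> ctn (fun y => f y ^+ n) x.
Proof.
move=> cf; elim: n => [|n IH]; first by under eq_fun do rewrite expr0; exact: ctnC.
by under eq_fun do rewrite exprS; exact: ctnM.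
Qed.

Lemma ctn_norm (V : normedModType R) (f : T -> V) x :
  ctn f x -> ctn (fun y => `|f y|) x.
Proof. by move=> cf; apply: cvg_norm. Qed.

Lemma ctn_comp (U W : topologicalType) (k : U -> W) (f : T -> U) x :
  ctn f x -> ctn k (f x) -> ctn (fun y => k (f y)) x.
Proof. exact: continuous_comp. Qed.

Lemma ctn_sum n (f : 'I_n -> T -> R) x :
  (forall i, ctn (f i) x) -> ctn (fun y => \sum_i f i y) x.
Proof.
elim: n f => [|n IH] f cf.
  by under eq_fun do rewrite big_ord0; exact: ctnC.
under eq_fun do rewrite big_ord_recl; apply: ctnD => //.
by apply: IH => i; exact: cf.
Qed.

End Continuity.

(** The rule is chosen by the outermost operation; partially applied operations are eta-expanded
    first. What stays open are nonvanishing denominators and functions without a rule or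
    hypothesis. *)
Ltac cstep :=
  match goal with
  | |- continuous_at ?x ?f => change (ctn f x)
  | |- prop_for ?x (inPhantom (continuous ?f)) => change (ctn f x)
  | |- ctn (GRing.mul ?c) ?x => change (ctn (fun y => c * y) x)
  | |- ctn (GRing.add ?c) ?x => change (ctn (fun y => c + y) x)
  | |- ctn id _ => notypeclasses refine (@ctnid _ _)
  | |- ctn (fun _ => ?c) _ => notypeclasses refine (@ctnC _ _ _ _)
  | |- ctn (fun y => y) _ => notypeclasses refine (@ctnid _ _)
  | |- ctn (fun y => GRing.add _ (GRing.opp _)) _ => notypeclasses refine (ctnB _ _)
  | |- ctn (fun y => GRing.add _ _) _ => notypeclasses refine (ctnD _ _)
  | |- ctn (fun y => GRing.opp _) _ => notypeclasses refine (ctnN _)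
  | |- ctn (fun y => GRing.mul _ _) _ => notypeclasses refine (ctnM _ _)
  | |- ctn (fun y => GRing.exp _ _) _ => notypeclasses refine (ctnX _)
  | |- ctn (fun y => GRing.scale _ _) _ => notypeclasses refine (ctnZ _ _)
  | |- ctn (fun y => Num.Def.normr _) _ => notypeclasses refine (ctn_norm _)
  | |- ctn (fun y => GRing.inv _) _ => notypeclasses refine (ctnV _ _)
  | |- ctn (fun y => fun_of_matrix y _ _) _ => apply: coord_continuous
  | |- ctn (fun y => \sum_i _) _ => apply: ctn_sum => ?
  | |- ctn _ _ => eassumption
  end.
Ltac ctac := repeat cstep.

(** The derivative is computed into an existential variable; after [is_derive_eq] its value is
    compared with the announced one by [ring] or [field]. *)
Ltac dstep :=
  match goal with
  | |- is_derive ?x ?v (GRing.mul ?c) ?d => change (is_derive x v (fun y => c * y) d)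
  | |- is_derive ?x ?v (GRing.add ?c) ?d => change (is_derive x v (fun y => c + y) d)
  | |- is_derive ?x ?v GRing.opp ?d => change (is_derive x v (fun y => - y) d)
  | |- is_derive _ _ id _ => notypeclasses refine (@dvid _ _)
  | |- is_derive _ _ (fun _ => ?c) _ => notypeclasses refine (@dvC _ _ _ _ _)
  | |- is_derive _ _ (fun y => y) _ => notypeclasses refine (@dvid _ _)
  | |- is_derive _ _ (fun y => GRing.add _ (GRing.opp _)) _ => notypeclasses refine (dvB _ _)
  | |- is_derive _ _ (fun y => GRing.add _ _) _ => notypeclasses refine (dvD _ _)
  | |- is_derive _ _ (fun y => GRing.opp _) _ => notypeclasses refine (dvN _)
  | |- is_derive _ _ (fun y => GRing.mul _ _) _ => notypeclasses refine (dvM _ _)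
  | |- is_derive _ _ (fun y => GRing.exp _ _) _ => notypeclasses refine (dvX _ _)
  | |- is_derive _ _ _ _ => eassumption
  end.
Ltac dtac := repeat dstep.

Notation ee i := (delta_mx 0 i).

(** * Laplacian and maximum principle *)

Section HasLap.
Context {R : realType}.
Local Notation V3 := 'rV[R]_3.

Lemma coord_norm (x : V3) i : `|x 0 i| <= `|x|.
Proof.
rewrite [leRHS]/Num.Def.normr/= mx_normrE.
exact: (le_bigmax _ (fun ij => `|x ij.1 ij.2|) (0, i)).
Qed.

Lemma norm_coord_le (x : V3) (r : R) :
  0 <= r -> (forall i, `|x 0 i| <= r) -> `|x| <= r.
Proof.
move=> r0 xr; rewrite [leLHS]/Num.Def.normr/= mx_normrE.
by rewrite bigmax_le// => -[i j] _ /=; rewrite ord1.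
Qed.

Lemma norm_coord_ex (x : V3) : exists i, `|x| = `|x 0 i|.
Proof.
have [->|x0] := eqVneq x 0; first by exists 0; rewrite mxE !normr0.
have /mx_norm_neq0[[i j] /= E] : mx_norm x != 0 by apply: contra_neq x0; exact: mx_norm_eq0.
by exists j; rewrite [LHS]E ord1.
Qed.

Lemma norm_ee i : `|ee i : V3| = 1.
Proof.
apply/eqP; rewrite eq_le; apply/andP; split.
  by apply: norm_coord_le => // j; rewrite mxE eqxx /=; case: (j == i); rewrite ?normr1 ?normr0.
by have := coord_norm (ee i) i; rewrite mxE !eqxx normr1.
Qed.

Lemma norm_Zee (t : R) i : `|t *: ee i : V3| = `|t|.
Proof. by rewrite normrZ norm_ee mulr1. Qed.

Lemma coordD (x : V3) t i j : (x + t *: ee i) 0 j = x 0 j + t * (j == i)%:R.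
Proof. by rewrite !mxE eqxx. Qed.

(* [L] is the sum of the pure second partial derivatives of [f] on [O]; nothing is asked about
   mixed derivatives or continuity, which is all that the maximum principle needs. *)
Definition has_lap (O : set V3) (f L : V3 -> R) :=
  exists g h : 'I_3 -> V3 -> R, forall x, O x ->
    (forall i, is_derive x (ee i) f (g i x) /\ is_derive x (ee i) (g i) (h i x))
    /\ L x = \sum_i h i x.

Lemma has_lap_sub (O O' : set V3) f L : O' `<=` O -> has_lap O f L -> has_lap O' f L.
Proof. by move=> sO [g [h H]]; exists g, h => x /sO /H. Qed.

Lemma has_lap_eqL (O : set V3) f L L' : (forall x, O x -> L x = L' x) ->
  has_lap O f L -> has_lap O f L'.
Proof. by move=> E [g [h H]]; exists g, h => x Ox; rewrite -E//; exact: H. Qed.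

Lemma has_lap_eq (O : set V3) f f' L : open O -> (forall x, O x -> f x = f' x) ->
  has_lap O f L -> has_lap O f' L.
Proof.
move=> oO E [g [h H]]; exists g, h => x Ox; have [H1 H2] := H _ Ox.
split=> // i; have [D1 D2] := H1 i; split => //.
apply: near_eq_is_derive D1; apply: filterS (open_nbhs_nbhs (conj oO Ox)) => y.
exact: E.
Qed.

Lemma has_lapD (O : set V3) f f' L L' : has_lap O f L -> has_lap O f' L' ->
  has_lap O (fun x => f x + f' x) (fun x => L x + L' x).
Proof.
move=> [g [h H]] [g' [h' H']].
exists (fun i x => g i x + g' i x), (fun i x => h i x + h' i x) => x Ox.
have [H1 ->] := H _ Ox; have [H1' ->] := H' _ Ox; rewrite big_split; split => //= i.
by have [D1 D2] := H1 i; have [D1' D2'] := H1' i; split; exact: is_deriveD.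
Qed.

Lemma has_lapZ (O : set V3) (c : R) f L : has_lap O f L ->
  has_lap O (fun x => c * f x) (fun x => c * L x).
Proof.
move=> [g [h H]]; exists (fun i x => c * g i x), (fun i x => c * h i x) => x Ox.
have [H1 ->] := H _ Ox; rewrite mulr_sumr; split => //= i.
by have [D1 D2] := H1 i; split; exact: is_deriveZ.
Qed.

Lemma has_lapB (O : set V3) f f' L L' : has_lap O f L -> has_lap O f' L' ->
  has_lap O (fun x => f x - f' x) (fun x => L x - L' x).
Proof.
move=> H1 /(has_lapZ (-1)) H2; have := has_lapD H1 H2.
by under eq_fun do rewrite mulN1r; under [X in has_lap _ _ X]eq_fun do rewrite mulN1r.
Qed.

Lemma has_lap_cst (O : set V3) (c : R) : has_lap O (fun=> c) (fun=> 0).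
Proof.
exists (fun _ _ => 0), (fun _ _ => 0) => x _; split=> [i|]; last by rewrite big1.
by split; exact: is_derive_cst.
Qed.

Lemma sum_eqn (i : 'I_3) (F : 'I_3 -> R) : \sum_j (j == i)%:R * F j = F i.
Proof.
rewrite (bigD1 i)//= eqxx mul1r big1 ?addr0// => j /negbTE ->; by rewrite mul0r.
Qed.

(** These polynomials are the comparison functions in [grad_est1] and [wsol_lap_le]; their Laplacian
    is a constant of free sign. *)
Lemma has_lap_quad (O : set V3) (A B : 'I_3 -> R) (x0 : V3) :
  has_lap O (fun y => \sum_j (A j * (y 0 j - x0 0 j) ^+ 2 + B j * (y 0 j - x0 0 j)))
    (fun=> 2 * \sum_j A j).
Proof.
exists (fun i y => 2 * A i * (y 0 i - x0 0 i) + B i), (fun i _ => 2 * A i) => y _.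
rewrite mulr_sumr; split => // i; split; apply/is_derive_line0.
- set u := fun j => y 0 j - x0 0 j.
  have -> : (fun s : R => \sum_j (A j * ((y + s *: ee i) 0 j - x0 0 j) ^+ 2
     + B j * ((y + s *: ee i) 0 j - x0 0 j))) =
     (fun s : R => (\sum_j (A j * u j ^+ 2 + B j * u j)) + (A i * s ^+ 2 +
        (2 * A i * u i + B i) * s)).
    apply/funext => s; rewrite -[X in _ = _ + X](sum_eqn i
       (fun j => A j * s ^+ 2 + (2 * A j * u j + B j) * s)) -big_split/=.
    apply: eq_bigr => j _; rewrite !coordD /u.
    by case: (j == i); rewrite /=; ring.
  eapply is_derive_eq; [by dtac | rewrite /u /= ?expr1; ring].
- under eq_fun do rewrite coordD eqxx mulr1.
  by eapply is_derive_eq; [by dtac | rewrite /=; ring].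
Qed.

Lemma line_nbhs (x : V3) (P : V3 -> Prop) i : (\forall y \near x, P y) ->
  exists2 d : R, 0 < d & forall t, `|t| < d -> P (x + t *: ee i).
Proof.
move=> /nbhs_ballP[d /= d0 H]; exists d => // t td; apply: H.
by rewrite -ball_normE /= opprD addrA subrr sub0r normrN norm_Zee.
Qed.

Lemma has_lap_max (O : set V3) f L c : open O -> O c -> has_lap O f L ->
  (\forall y \near c, f y <= f c) -> L c <= 0.
Proof.
move=> oO Oc [g [h H]] fc; have [H1 ->] := H _ Oc.
rewrite -oppr_ge0 -sumrN sumr_ge0// => i _; rewrite oppr_ge0.
have NO : \forall y \near c, O y by exact: open_nbhs_nbhs.
have [d1 d10 P1] := line_nbhs i fc; have [d2 d20 P2] := line_nbhs i NO.
apply: (@second_deriv_max _ (fun s => f (c + s *: ee i)) (fun s => g i (c + s *: ee i)) _ (Num.min d1 d2)).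
- by rewrite lt_min d10.
- move=> t; rewrite lt_min => /andP[_ td2]; apply/(is_derive_line f c (ee i) t).
  by have [+ _] := H _ (P2 _ td2) => /(_ i)[].
- by apply/(is_derive_line0 (g i) c (ee i)); have [] := H1 i.
- by move=> t; rewrite lt_min scale0r addr0 => /andP[/P1].
Qed.

(** A maximum attained in [O] would give [L <= 0] there, so it is attained where the bound [m] is
    assumed. The strict sign of [L] makes this elementary; each application first arranges it by
    adding a quadratic polynomial. *)
Lemma max_principle (K O : set V3) f L m : compact K -> O `<=` K -> open O ->
  {within K, continuous f} -> has_lap O f L -> (forall x, O x -> 0 < L x) ->
  (forall x, K x -> ~ O x -> f x <= m) -> forall x, K x -> f x <= m.
Proof.
move=> cK OK oO cf lf L0 fm x Kx.
have [c + cmax] := compact_EVT_max (ex_intro _ x Kx) cK cf.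
rewrite inE => Kc; apply: (@le_trans _ _ (f c)); first by apply: cmax; rewrite inE.
have [Oc|] := pselect (O c); last exact: fm.
have : L c <= 0.
  apply: (has_lap_max oO Oc lf); apply: filterS (open_nbhs_nbhs (conj oO Oc)) => y Oy.
  by apply: cmax; rewrite inE; exact: OK.
by rewrite leNgt L0.
Qed.

(** Reflection in the plane through [x] orthogonal to [ee i]; it preserves the boxes centred at
    [x]. *)
Definition refl (x : V3) i (y : V3) : V3 := y - (2 * (y 0 i - x 0 i)) *: ee i.

Lemma reflE (x : V3) i y j :
  refl x i y 0 j = if j == i then 2 * x 0 i - y 0 i else y 0 j.
Proof.
rewrite /refl -scaleNr coordD; case: eqVneq => [->|_] /=; last by rewrite mulr0 addr0.
by ring.
Qed.

Lemma refl_norm (x : V3) i y : `|refl x i y - x| = `|y - x|.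
Proof.
have E (y0 : V3) : `|refl x i y0 - x| <= `|y0 - x|.
  apply: norm_coord_le => // j; rewrite mxE [(- x) 0 j]mxE reflE; case: eqP => [->|_].
    have := coord_norm (y0 - x) i; rewrite !mxE.
    by rewrite [2 * _ - _ - _](_ : _ = - (y0 0 i - x 0 i)) ?normrN//; ring.
  by have := coord_norm (y0 - x) j; rewrite !mxE.
have K (y0 : V3) : refl x i (refl x i y0) = y0.
  by apply/rowP => j; rewrite !reflE eqxx; case: eqP => [->|//]; ring.
by apply/eqP; rewrite eq_le E -{1}(K y) E.
Qed.

Lemma refl_line (x : V3) i y (s : R) j :
  refl x i (y + s *: ee j) = refl x i y + (if j == i then - s else s) *: ee j.
Proof.
apply/rowP => k; rewrite coordD !reflE !coordD.
have [->|ki] := eqVneq k i; last by case: (eqVneq k j) => [<-|]; rewrite ?(negbTE ki) ?mulr1 ?mulr0.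
by case: (eqVneq i j) => /= _; ring.
Qed.

(** Only the derivative in direction [i] changes sign, and differentiating twice in that direction
    cancels the sign. *)
Lemma has_lap_refl (O : set V3) f L (x : V3) i : has_lap O f L ->
  has_lap [set y | O (refl x i y)] (f \o refl x i) (L \o refl x i).
Proof.
move=> [g [h H]].
exists (fun j y => (if j == i then -1 else 1) * g j (refl x i y)), (fun j y => h j (refl x i y)) => y Oy.
have [H1 H2] := H _ Oy; split => // j; have [/is_derive_line0 D1 /is_derive_line0 D2] := H1 j.
have Dc : is_derive (0 : R) 1 (fun s : R => (if j == i then -1 else 1) * s) (if j == i then -1 else 1).
  by eapply is_derive_eq; [by dtac | rewrite /=; ring].
have E0 (z : R) : (if j == i then - z else z) = (if j == i then -1 else 1) * z.
  by case: ifP => _; ring.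
split; apply/is_derive_line0.
- under eq_fun do rewrite /= refl_line E0.
  rewrite mulrC.
  apply: (@is_derive1_comp _ (fun s => f (refl x i y + s *: ee j)) (fun s => (if j == i then -1 else 1) * s)).
  by rewrite mulr0.
- under eq_fun do rewrite /= refl_line E0.
  suff : is_derive (0 : R) 1 (fun s => g j (refl x i y + ((if j == i then -1 else 1) * s) *: ee j))
      (h j (refl x i y) * (if j == i then -1 else 1)).
    move=> /(@is_deriveZ _ _ _ _ (if j == i then -1 else 1 : R)) D; apply: is_derive_eq D _.
    by rewrite /GRing.scale/=; case: ifP => _; ring.
  apply: (@is_derive1_comp _ (fun s => g j (refl x i y + s *: ee j)) (fun s => (if j == i then -1 else 1) * s)).
  by rewrite mulr0.
Qed.

Lemma refl_continuous (x : V3) i : continuous (refl x i).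
Proof. move=> y; rewrite /refl; ctac. Qed.

Lemma compact_box (x : V3) (d : R) : compact [set y : V3 | `|y - x| <= d].
Proof.
apply: bounded_closed_compact.
  exists (d + `|x|); split; first exact: num_real.
  move=> M dM y /= yx.
  by rewrite -(subrK x y) (le_trans (ler_normD _ _))//; lra.
rewrite (_ : mkset _ = (fun y => `|y - x|) @^-1` [set r | r <= d])//.
apply: closed_comp; last exact: closed_le.
by move=> y _; ctac.
Qed.

Lemma open_box (x : V3) (d : R) : open [set y : V3 | `|y - x| < d].
Proof.
rewrite (_ : mkset _ = (fun y => `|y - x|) @^-1` [set r | r < d])//.
apply: open_comp; last exact: open_lt.
by move=> y _; ctac.
Qed.

(* Comparison of the odd part of [v] under the reflection in [y_i = x_i] with a
   quadratic polynomial on the half box [0 <= y_i - x_i] *)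
Lemma grad_est1 (O : set V3) v f (x : V3) i (d M F t : R) : open O ->
  has_lap O v f -> (forall y, O y -> {for y, continuous v}) ->
  (forall y, `|y - x| <= d -> O y) -> 0 < t -> t < d ->
  (forall y, `|y - x| <= d -> `|v y| <= M) ->
  (forall y, `|y - x| <= d -> `|f y| < F) ->
  v (x + t *: ee i) - v (x - t *: ee i) <= 2 * t * (3 * M / d + d * F / 2).
Proof.
move=> oO lv cv BO t0 td vM fF.
have d0 : 0 < d by lra.
have M0 : 0 <= M by apply: le_trans (vM x _) => //; rewrite subrr normr0 ltW.
have F0 : 0 < F by apply: le_lt_trans (fF x _) => //; rewrite subrr normr0 ltW.
pose a := M / d ^+ 2.
have a0 : 0 <= a by rewrite divr_ge0// sqr_ge0.
have aM : a * d ^+ 2 = M by rewrite divfK// sqrf_eq0 gt_eqF.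
(* With [u = y_i - x_i], [psi] is [a |y - x|^2 + (3 a + F / 2) u (d - u)] for the Euclidean norm. It
   is nonnegative on the half box, at least [a d^2 = M] on the faces at distance [d], and its
   Laplacian is [- F], which dominates the odd part of [f]. On the face [u = 0] the odd part of [v]
   vanishes. *)
pose A j := a - (j == i)%:R * (3 * a + F / 2).
pose B j := (j == i)%:R * (3 * a * d + F * d / 2).
pose psi (y : V3) := \sum_j (A j * (y 0 j - x 0 j) ^+ 2 + B j * (y 0 j - x 0 j)).
have psiE y : psi y = a * (\sum_j (y 0 j - x 0 j) ^+ 2) +
    (3 * a * (d - (y 0 i - x 0 i)) + F / 2 * (d - (y 0 i - x 0 i))) * (y 0 i - x 0 i).
  rewrite /psi mulr_sumr -[X in _ = _ + X](sum_eqn i (fun j =>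
    (3 * a * (d - (y 0 j - x 0 j)) + F / 2 * (d - (y 0 j - x 0 j))) * (y 0 j - x 0 j))).
  rewrite -big_split/=; apply: eq_bigr => j _; rewrite /A /B.
  by case: (j == i); rewrite /=; ring.
pose P y := 2^-1 * (v y - v (refl x i y)) - psi y.
pose K := [set y : V3 | `|y - x| <= d /\ 0 <= y 0 i - x 0 i].
pose O1 := [set y : V3 | `|y - x| < d /\ 0 < y 0 i - x 0 i].
have lP : has_lap O1 P (fun y => 2^-1 * (f y - f (refl x i y)) - (- F)).
  apply: has_lapB.
    apply: has_lapZ; apply: has_lapB.
      by apply: has_lap_sub lv => y [/ltW/BO].
    apply: has_lap_sub (has_lap_refl x i lv) => y [/ltW yd _] /=.
    by apply: BO; rewrite refl_norm.
  apply: has_lap_eqL (has_lap_quad _ A B x) => y _.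
  rewrite /A big_split/= sumrN sum_eqn sumr_const card_ord -mulr_natr; lra.
have P0 y : K y -> ~ O1 y -> P y <= 0.
  move=> [yd yi] nO; rewrite /P psiE subr_le0.
  set u := y 0 i - x 0 i in yi *.
  have ud : u <= d by have := coord_norm (y - x) i; rewrite !mxE -/u => /(le_trans (ler_norm _)); lra.
  have S0 : 0 <= \sum_j (y 0 j - x 0 j) ^+ 2 by rewrite sumr_ge0// => j _; rewrite sqr_ge0.
  have T0 : 0 <= (3 * a * (d - u) + F / 2 * (d - u)) * u.
    by rewrite mulr_ge0// addr_ge0// mulr_ge0// ?subr_ge0// mulr_ge0//; lra.
  have [yd'|yd'] := ltP `|y - x| d.
    have u0 : u = 0.
      apply/eqP; rewrite eq_le yi andbT leNgt; apply/negP => u0; exact: nO.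
    have -> : refl x i y = y.
      by rewrite /refl -/u u0 mulr0 scale0r subr0.
    by rewrite subrr mulr0 addr_ge0// mulr_ge0.
  have yE : `|y - x| = d by apply/eqP; rewrite eq_le yd.
  apply: (@le_trans _ _ M).
    have := vM y yd; have := vM (refl x i y); rewrite refl_norm => /(_ yd).
    have := ler_norm (v y); have := ler_norm (- v (refl x i y)); rewrite normrN; lra.
  rewrite -[leLHS]addr0 lerD// -aM ler_wpM2l//.
  have [j] := norm_coord_ex (y - x); rewrite yE !mxE => ->.
  rewrite (bigD1 j)//= real_normK ?num_real// lerDl sumr_ge0// => k _; exact: sqr_ge0.
have cP : {within K, continuous P}.
  apply/continuous_in_subspaceT => y; rewrite inE => -[yd _].
  have c1 : ctn v y by apply: cv; exact: BO.
  have c2 : ctn (fun y => v (refl x i y)) y.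
    apply: ctn_comp; first exact: refl_continuous.
    by apply: cv; apply: BO; rewrite refl_norm.
  by rewrite /P /psi; ctac.
have oO1 : open O1.
  apply: openI; first exact: open_box.
  apply: (@open_comp _ _ (fun y : V3 => y 0 i - x 0 i) [set r | 0 < r]); last exact: open_gt.
  by move=> y _; ctac.
have cK : compact K.
  apply: compact_closedI; first exact: compact_box.
  apply: (@closed_comp _ _ (fun y : V3 => y 0 i - x 0 i) [set r | 0 <= r]); last exact: closed_ge.
  by move=> y _; ctac.
have O1K : O1 `<=` K by move=> y [/ltW ? /ltW ?].
have L0 y : O1 y -> 0 < 2^-1 * (f y - f (refl x i y)) - - F.
  move=> [/ltW yd _]; have := fF y yd; have := fF (refl x i y); rewrite refl_norm => /(_ yd).
  by rewrite !ltr_norml; lra.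
have := max_principle cK O1K oO1 cP lP L0 P0.
move=> /(_ (x + t *: ee i)) => /(_ _).
have E1 : (x + t *: ee i) 0 i - x 0 i = t by rewrite coordD eqxx mulr1; ring.
have E2 : refl x i (x + t *: ee i) = x - t *: ee i.
  by rewrite refl_line eqxx /refl subrr mulr0 scale0r subr0 scaleNr.
rewrite /K /= E1 addrC addKr norm_Zee gtr0_norm// => /(_ (conj (ltW td) (ltW t0))).
rewrite /P E2 psiE E1.
have -> : \sum_j ((x + t *: ee i) 0 j - x 0 j) ^+ 2 = t ^+ 2.
  rewrite -[RHS](sum_eqn i (fun=> t ^+ 2)); apply: eq_bigr => j _; rewrite coordD.
  by case: (j == i); rewrite /=; ring.
have -> : 3 * M / d = 3 * a * d by rewrite -aM; field; rewrite gt_eqF.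
(* The bound drops the nonpositive term [a t^2 - (3 a + F / 2) t^2] of [psi]. *)
nra.
Qed.

Lemma grad_est (O : set V3) v f (x : V3) i (d M F t : R) : open O ->
  has_lap O v f -> (forall y, O y -> {for y, continuous v}) ->
  (forall y, `|y - x| <= d -> O y) -> 0 < t -> t < d ->
  (forall y, `|y - x| <= d -> `|v y| <= M) ->
  (forall y, `|y - x| <= d -> `|f y| < F) ->
  `|v (x + t *: ee i) - v (x - t *: ee i)| <= 2 * t * (3 * M / d + d * F / 2).
Proof.
move=> oO lv cv BO t0 td vM fF; rewrite ler_norml; apply/andP; split; last first.
  exact: grad_est1 oO lv cv BO t0 td vM fF.
have := @grad_est1 O (fun y => -1 * v y) (fun y => -1 * f y) x i d M F t oO (has_lapZ _ lv).
move=> /(_ _ BO t0 td); set T := 2 * t * _.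
have -> : (- T <= v (x + t *: ee i) - v (x - t *: ee i)) =
  (-1 * v (x + t *: ee i) - -1 * v (x - t *: ee i) <= T).
  by rewrite !mulN1r; apply/idP/idP; lra.
apply.
- by move=> y Oy; have c1 : ctn v y := cv y Oy; ctac.
- by move=> y yd; rewrite mulN1r normrN; exact: vM.
- by move=> y yd; rewrite mulN1r normrN; exact: fF.
Qed.

End HasLap.

(** * Interior regularity of the Poisson equation *)

Section Regularity.
Context {R : realType}.
Local Notation V3 := 'rV[R]_3.
Implicit Types (O : set V3) (u v h f : V3 -> R) (x y z w : V3).

Lemma derive_bound (k : R -> R) (D B d : R) : 0 < d ->
  is_derive (0 : R) 1 k D -> (forall t, 0 < t -> t < d -> `|k t - k 0| <= B * t) ->
  `|D| <= B.
Proof.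
move=> d0 [+ E] kB; rewrite /derive in E => /cvg_ex[l /[dup] Hl /(cvg_lim (@Rhausdorff _))].
rewrite E => lD; rewrite -{}lD in Hl.
rewrite leNgt; apply/negP => BD; have e0 : 0 < `|D| - B by rewrite subr_gt0.
move/cvgrPdist_lt: Hl => /(_ _ e0); rewrite near_withinE near_simpl => /nbhs_ballP[e /= ee0 He].
pose t := Num.min d e / 2.
have me : 0 < Num.min d e by rewrite lt_min d0.
have t0 : 0 < t by rewrite divr_gt0.
have tm : t < Num.min d e by rewrite /t; lra.
have := He t; rewrite /ball /= sub0r normrN gtr0_norm// => /(_ _ (lt0r_neq0 t0)).
have td : t < d by apply: (lt_le_trans tm); rewrite ge_min lexx.
have te : t < e by apply: (lt_le_trans tm); rewrite ge_min lexx orbT.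
move=> /(_ te); rewrite addr0 [t *: 1]mulr1.
have := kB t t0 td; set q := k t - k 0 => qB.
have qt : `|t^-1 *: q| <= B.
  by rewrite normrM normfV (gtr0_norm t0) mulrC ler_pdivrMr.
have := lerB_dist D (t^-1 *: q); lra.
Qed.

Lemma ctnP (f : V3 -> R) x : ctn f x <-> forall e : R, 0 < e ->
  exists2 d : R, 0 < d & forall y, `|y - x| < d -> `|f y - f x| <= e.
Proof.
split=> [/cvgrPdist_le cf e e0|H].
  have /nbhs_ballP[d /= d0 Hd] := cf _ e0; exists d => // y yx.
  by rewrite distrC; apply: Hd; rewrite -ball_normE /= distrC.
apply/(@cvgrPdist_le _ _ _ (nbhs x)) => e e0; apply/nbhs_ballP.
have [d d0 Hd] := H _ e0; exists d => //= y; rewrite -ball_normE /= => xy.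
by rewrite distrC; apply: Hd; rewrite distrC.
Qed.

Lemma is_derive_shiftV f x w (e : V3) (D : R) : is_derive (x + w) e f D ->
  is_derive x e (fun z => f (z + w)) D.
Proof.
move=> /is_derive_line0 H; apply/is_derive_line0.
by under eq_fun do rewrite addrAC.
Qed.

Lemma has_lap_shift O f L w : has_lap O f L ->
  has_lap [set y | O (y + w)] (fun y => f (y + w)) (fun y => L (y + w)).
Proof.
move=> [g [k H]]; exists (fun i y => g i (y + w)), (fun i y => k i (y + w)) => y /H[H1 H2].
by split => // i; have [D1 D2] := H1 i; split; apply: is_derive_shiftV.
Qed.

(* A notion of solution of [lap u = h] that is closed under uniform limits; [wsol_regular] shows
   that it is the classical one when [h] is locally Lipschitz. *)
Definition wsol O u h := forall e : R, 0 < e -> exists v f,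
  [/\ has_lap O v f, forall y, O y -> ctn v y,
     forall y, O y -> `|u y - v y| <= e & forall y, O y -> `|h y - f y| <= e].

Lemma wsol_sub O O' u h : O' `<=` O -> wsol O u h -> wsol O' u h.
Proof.
move=> sO H e /H[v [f [H1 H2 H3 H4]]]; exists v, f; split.
- exact: has_lap_sub H1.
- by move=> y /sO/H2.
- by move=> y /sO/H3.
- by move=> y /sO/H4.
Qed.

Lemma has_lap_wsol O u h : has_lap O u h -> (forall y, O y -> ctn u y) -> wsol O u h.
Proof.
by move=> H cu e e0; exists u, h; split => // y _; rewrite subrr normr0 ltW.
Qed.

Lemma wsolB O u h u' h' : wsol O u h -> wsol O u' h' ->
  wsol O (fun y => u y - u' y) (fun y => h y - h' y).
Proof.
move=> H H' e e0; have e20 : 0 < e / 2 by rewrite divr_gt0.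
have [v [f [H1 H2 H3 H4]]] := H _ e20; have [v' [f' [H1' H2' H3' H4']]] := H' _ e20.
exists (fun y => v y - v' y), (fun y => f y - f' y); split.
- exact: has_lapB.
- by move=> y Oy; have c1 := H2 y Oy; have c2 := H2' y Oy; ctac.
- move=> y Oy; have := H3 y Oy; have := H3' y Oy; rewrite !ler_norml; lra.
- move=> y Oy; have := H4 y Oy; have := H4' y Oy; rewrite !ler_norml; lra.
Qed.

Lemma wsolZ O (c : R) u h : wsol O u h -> wsol O (fun y => c * u y) (fun y => c * h y).
Proof.
move=> H e e0; have c0 : 0 < `|c| + 1 by rewrite ltr_wpDl.
have [v [f [H1 H2 H3 H4]]] := H _ (divr_gt0 e0 c0).
have E (a : R) : `|a| <= e / (`|c| + 1) -> `|c * a| <= e.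
  rewrite ler_pdivlMr// => ae; rewrite normrM; apply: le_trans ae.
  by rewrite mulrC ler_wpM2l// lerDl.
exists (fun y => c * v y), (fun y => c * f y); split.
- exact: has_lapZ.
- by move=> y Oy; have c1 := H2 y Oy; ctac.
- by move=> y Oy; rewrite -mulrBr; apply: E; exact: H3.
- by move=> y Oy; rewrite -mulrBr; apply: E; exact: H4.
Qed.

Lemma wsol_shift O u h w : wsol O u h ->
  wsol [set y | O (y + w)] (fun y => u (y + w)) (fun y => h (y + w)).
Proof.
move=> H e /H[v [f [H1 H2 H3 H4]]].
exists (fun y => v (y + w)), (fun y => f (y + w)); split.
- exact: has_lap_shift.
- move=> y Oy; apply: ctn_comp; last exact: H2.
  by ctac.
- by move=> y Oy; exact: H3.
- by move=> y Oy; exact: H4.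
Qed.

Lemma wsol_est O u h x i (d M F t : R) : open O -> wsol O u h ->
  (forall y, `|y - x| <= d -> O y) -> 0 < t -> t < d ->
  (forall y, `|y - x| <= d -> `|u y| <= M) ->
  (forall y, `|y - x| <= d -> `|h y| <= F) ->
  `|u (x + t *: ee i) - u (x - t *: ee i)| <= 2 * t * (3 * M / d + d * F / 2).
Proof.
move=> oO H BO t0 td uM hF; have d0 : 0 < d by lra.
apply/ler_addgt0Pr => e e0.
(* Replacing [M] by [M + e1] and [F] by [F + 2 * e1] costs [2 t (3 / d + d) e1], and replacing [u]
   by [v] at two points costs [2 * e1]; together this is [c * e1 = e]. The doubled [e1] gives the
   strict bound required on [f]. *)
pose c := 2 * t * (3 / d + d) + 2.
have c0 : 0 < c by rewrite ltr_wpDl// !mulr_ge0 ?addr_ge0 ?divr_ge0// ltW.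
pose e1 := e / c; have e10 : 0 < e1 by rewrite divr_gt0.
have [v [f [H1 H2 H3 H4]]] := H _ e10.
have vM y : `|y - x| <= d -> `|v y| <= M + e1.
  by move=> yd; have := uM y yd; have := H3 y (BO y yd); rewrite !ler_norml; lra.
have fF y : `|y - x| <= d -> `|f y| < F + 2 * e1.
  by move=> yd; have := hF y yd; have := H4 y (BO y yd); rewrite !ler_norml ltr_norml; lra.
have O1 : O (x + t *: ee i) by apply: BO; rewrite addrC addKr norm_Zee gtr0_norm// ltW.
have O2 : O (x - t *: ee i) by apply: BO; rewrite addrC addKr normrN norm_Zee gtr0_norm// ltW.
have := grad_est i oO H1 H2 BO t0 td vM fF.
have := H3 _ O1; have := H3 _ O2.
have -> : 2 * t * (3 * (M + e1) / d + d * (F + 2 * e1) / 2) =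
   2 * t * (3 * M / d + d * F / 2) + e - 2 * e1.
  by rewrite -[e](divfK (lt0r_neq0 c0)) -/e1 /c; field; rewrite gt_eqF.
rewrite !ler_norml; lra.
Qed.

(** The symmetric estimate [wsol_est] is applied at the midpoint of the segment with boxes of radius
    [d / 2]; these stay within [2 * d] of [x]. *)
Lemma wsol_lip O u h x i (d M F s : R) y : open O -> wsol O u h ->
  0 < d -> (forall y, `|y - x| <= 2 * d -> O y) ->
  (forall y, `|y - x| <= 2 * d -> `|u y| <= M) ->
  (forall y, `|y - x| <= 2 * d -> `|h y| <= F) ->
  `|y - x| <= d -> `|s| < d -> `|u (y + s *: ee i) - u y| <= `|s| * (6 * M / d + d * F / 4).
Proof.
move=> oO H d0 BO uM hF yd sd.
have [->|s0] := eqVneq s 0; first by rewrite scale0r addr0 subrr normr0 mul0r.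
pose c : V3 := y + (s / 2) *: ee i.
have P z : `|z - c| <= d / 2 -> `|z - x| <= 2 * d.
  move=> zc; rewrite (_ : z - x = (z - c) + (s / 2) *: ee i + (y - x)); last first.
    by rewrite /c; apply/rowP => k; rewrite !mxE; ring.
  apply: le_trans (ler_normD _ _) _; have := ler_normD (z - c) ((s / 2) *: ee i).
  rewrite norm_Zee normrM normfV (gtr0_norm (_ : 0 < 2))//; lra.
have t0 : 0 < `|s| / 2 by rewrite divr_gt0// normr_gt0.
have := @wsol_est O u h c i (d / 2) M F (`|s| / 2) oO H _ t0 _ _ _.
have -> : `|u (c + (`|s| / 2) *: ee i) - u (c - (`|s| / 2) *: ee i)| = `|u (y + s *: ee i) - u y|.
  have E1 : c + (s / 2) *: ee i = y + s *: ee i by apply/rowP => k; rewrite !mxE; field.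
  have E2 : c - (s / 2) *: ee i = y by apply/rowP => k; rewrite !mxE; field.
  have [sp|sn] := ltP 0 s; first by rewrite (gtr0_norm sp) E1 E2.
  by rewrite (ler0_norm sn) mulNr !scaleNr opprK E2 E1 distrC.
have -> : 2 * (`|s| / 2) * (3 * M / (d / 2) + d / 2 * F / 2) = `|s| * (6 * M / d + d * F / 4).
  by field; rewrite gt_eqF.
apply => //; first by move=> z /P/BO.
- by lra.
- by move=> z /P/uM.
- by move=> z /P/hF.
Qed.

(** The symmetric difference [u (x + s e) - u (x - s e)] has derivative [2 * D] at [s = 0], and
    [wsol_est] bounds its growth. *)
Lemma wsol_dbound O u h x i (d M F D : R) : open O -> wsol O u h ->
  0 < d -> (forall y, `|y - x| <= d -> O y) ->
  (forall y, `|y - x| <= d -> `|u y| <= M) ->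
  (forall y, `|y - x| <= d -> `|h y| <= F) ->
  is_derive x (ee i) u D -> `|D| <= 3 * M / d + d * F / 2.
Proof.
move=> oO H d0 BO uM hF /is_derive_line0 du.
have D2 : is_derive (0 : R) 1 (fun s => u (x + s *: ee i) - u (x - s *: ee i)) (2 * D).
  have -> : 2 * D = D - D * (-1) by ring.
  apply: dvB => //; under eq_fun => s do rewrite -scaleNr.
  apply: (@is_derive1_comp _ (fun s => u (x + s *: ee i)) (fun s => - s)).
    by rewrite oppr0.
have := derive_bound d0 D2 (B := 2 * (3 * M / d + d * F / 2)).
rewrite normrM (gtr0_norm (_ : 0 < 2))// ler_pM2l//; apply => t t0 td.
rewrite scale0r subr0 addr0 subrr subr0.
by have := wsol_est i oO H BO t0 td uM hF; rewrite mulrAC.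
Qed.

(** The difference quotients of [f] stay within [e] of those of a differentiable [g], so they form a
    Cauchy filter. *)
Lemma derivable_approx (f : V3 -> R) x (v : V3) :
  (forall e : R, 0 < e -> exists2 g : V3 -> R, derivable g x v &
     exists2 d : R, 0 < d & forall t, 0 < `|t| -> `|t| < d ->
     `|(f (x + t *: v) - g (x + t *: v)) - (f x - g x)| <= e * `|t|) ->
  derivable f x v.
Proof.
move=> H; apply: cauchy_cvg; apply: cauchy_exP => e e0 /=.
have e20 : 0 < e / 2 by rewrite divr_gt0.
have [g /cvg_ex[l gl] [d d0 Hd]] := H _ e20.
exists l.
move/cvgrPdist_lt: gl => /(_ _ e20) gl.
have Nd : \forall t \near (0 : R)^', `|t| < d by exact: dnbhs0_lt.
change (\forall t \near (0 : R)^', ball l e (t^-1 *: (f (t *: v + x) - f x))).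
near=> t.
have t0 : t != 0 by near: t; exact: nbhs_dnbhs_neq.
have td : `|t| < d by near: t.
have gl' : `|l - t^-1 *: ((g \o shift x) (t *: v) - g x)| < e / 2 by near: t.
have tp : 0 < `|t| by rewrite normr_gt0.
rewrite -ball_normE /=.
have := gl' => /=; have := Hd t tp td.
rewrite ![t *: v + x]addrC.
set a := f _; set b := g _ => H1 H2.
have H3 : `|t^-1 *: (a - f x) - t^-1 *: (b - g x)| <= e / 2.
  rewrite -scalerBr normrZ normfV mulrC ler_pdivrMr//; apply: le_trans H1.
  by rewrite (_ : a - f x - (b - g x) = a - b - (f x - g x))//; ring.
have H4 : `|l - t^-1 *: (b - g x)| < e / 2 by exact: H2.
rewrite (_ : l - _ = (l - t^-1 *: (b - g x)) - (t^-1 *: (a - f x) - t^-1 *: (b - g x))); last first.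
  by ring.
by rewrite (le_lt_trans (ler_normB _ _))//; lra.
Unshelve. all: by end_near. Qed.

(** The error [u - v] of an approximation solves an equation with small data, so by [wsol_lip] its
    difference quotients are uniformly small. *)
Lemma wsol_derivable O u h x i : open O -> wsol O u h -> O x -> derivable u x (ee i).
Proof.
move=> oO H Ox; apply: derivable_approx => e e0.
have /nbhs_ballP[r /= r0 rO] : nbhs x O by exact: open_nbhs_nbhs.
pose d := r / 2; have d0 : 0 < d by rewrite divr_gt0.
have BO y : `|y - x| <= d -> O y.
  by move=> yd; apply: rO; rewrite -ball_normE /= distrC /d in yd *; lra.
(* This is the factor in [wsol_lip] for the radius [d / 2] when both data bounds equal 1. *)
pose c := 12 / d + d / 8; have c0 : 0 < c by rewrite addr_gt0// divr_gt0.
have [v [f [H1 H2 H3 H4]]] := H _ (divr_gt0 e0 c0).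
exists v.
  by have [g [k Hv]] := H1; have [/(_ i)[[]]] := Hv _ Ox.
exists (d / 2); first by rewrite divr_gt0.
move=> t _ td.
have H5 : wsol O (fun y => u y - v y) (fun y => h y - f y).
  by apply: wsolB => //; apply: has_lap_wsol.
have := @wsol_lip O _ _ x i (d / 2) (e / c) (e / c) t x oO H5 (divr_gt0 d0 (ltr0Sn _ _)).
rewrite [2 * (d / 2)]mulrC divfK// => /(_ BO) HH.
apply: le_trans (HH _ _ _ td) _.
- by move=> y /BO/H3.
- by move=> y /BO/H4.
- by rewrite subrr normr0 divr_ge0// ltW.
have cE : (e / c) * c = e by rewrite divfK// gt_eqF.
have E : 6 * (e / c) / (d / 2) + d / 2 * (e / c) / 4 = e.
  by rewrite -[RHS]cE; set q := e / c; rewrite /c; field; rewrite gt_eqF.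
by rewrite E mulrC.
Qed.

(** The condition is a Cauchy property of difference quotients uniform in the base point. With
    [w = 0] it gives differentiability; with equal steps [t = s] tending to 0 it compares the
    derivatives at two nearby points. *)
Lemma quot_cvg (f : V3 -> R) O x (v : V3) : open O -> O x ->
  (forall y, O y -> forall e : R, 0 < e -> exists2 d : R, 0 < d & forall w t s,
    `|w| < d -> 0 < `|t| -> `|t| < d -> 0 < `|s| -> `|s| < d ->
    `|(f (y + w + t *: v) - f (y + w)) / t - (f (y + s *: v) - f y) / s| <= e) ->
  derivable f x v /\ ctn ('D_v f) x.
Proof.
move=> oO Ox H.
have dr y : O y -> derivable f y v.
  move=> Oy; apply: cauchy_cvg; apply: cauchy_exP => e e0 /=.
  have [d d0 Hd] := H y Oy _ (divr_gt0 e0 (ltr0Sn R 1)).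
  exists ((f (y + (d / 2) *: v) - f y) / (d / 2)); 
  change (\forall t \near (0 : R)^', ball ((f (y + (d / 2) *: v) - f y) / (d / 2)) e (t^-1 *: (f (t *: v + y) - f y))).
  rewrite near_withinE.
  apply/nbhs_ballP; exists d => //= t; rewrite /ball /= sub0r normrN => td t0.
  rewrite -normrN opprB.
  have d20 : 0 < d / 2 by rewrite divr_gt0.
  have := Hd 0 t (d / 2); rewrite addr0 normr0 => /(_ d0).
  rewrite normr_gt0 t0 => /(_ isT td); rewrite (gtr0_norm d20) => /(_ d20 _).
  rewrite [t *: v + y]addrC /GRing.scale/= [_^-1 * _]mulrC => Hd'.
  by apply: (le_lt_trans (Hd' _)); lra.
split; first exact: dr.
apply/ctnP => e e0.
have [d1 d10 Hd] := H x Ox _ e0.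
have /nbhs_ballP[d2 /= d20 dO] : nbhs x O by exact: open_nbhs_nbhs.
exists (Num.min d1 d2); first by rewrite lt_min d10.
move=> y; rewrite lt_min => /andP[yx yx2]; set d := d1 in d10 Hd yx.
have Oy : O y by apply: dO; rewrite -ball_normE /= distrC.
have Dx := dr _ Ox; have Dy := dr _ Oy.
have : (fun t : R => t^-1 *: (f (t *: v + y) - f y) - t^-1 *: (f (t *: v + x) - f x)) @ 0^' -->
   'D_v f y - 'D_v f x.
  by apply: cvgB; [exact: Dy|exact: Dx].
move/cvg_norm => HH.
apply: (ler_cvg_to HH (cvg_cst e)).
rewrite near_withinE; apply/nbhs_ballP; exists d => //= t.
rewrite /ball /= sub0r normrN => td t0.
have := Hd (y - x) t t yx; rewrite normr_gt0 t0 => /(_ isT td isT td).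
by rewrite (addrC x) subrK ![t *: v + _]addrC /GRing.scale/= ![t^-1 * _]mulrC.
Qed.

(* Coordinatewise Lipschitz bounds on a box add up along a path with three legs. *)
Lemma lip_box f x (d C : R) : 0 <= C ->
  (forall y i s, `|y - x| <= d -> `|y + s *: ee i - x| <= d ->
     `|f (y + s *: ee i) - f y| <= C * `|s|) ->
  forall y z, `|y - x| <= d -> `|z - x| <= d -> `|f y - f z| <= 3 * C * `|y - z|.
Proof.
move=> C0 H y z yd zd.
have d0 : 0 <= d by apply: le_trans yd.
pose w1 : V3 := z + (y 0 0 - z 0 0) *: ee 0.
pose w2 : V3 := w1 + (y 0 1 - z 0 1) *: ee 1.
pose i2 : 'I_3 := ord_max.
have cc : forall k : 'I_3, [\/ k = 0, k = 1 | k = i2].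
  by move=> [[|[|[|//]]]] p; [apply: Or31|apply: Or32|apply: Or33]; apply/val_inj.
have yE : y = w2 + (y 0 i2 - z 0 i2) *: ee i2.
  by apply/rowP => k; rewrite !coordD; case: (cc k) => -> /=; ring.
have hy k := le_trans (coord_norm (y - x) k) yd.
have hz k := le_trans (coord_norm (z - x) k) zd.
have w1E k : w1 0 k = if k == 0 then y 0 k else z 0 k.
  by rewrite coordD; case: (cc k) => -> /=; ring.
have w2E k : w2 0 k = if k == i2 then z 0 k else y 0 k.
  by rewrite coordD w1E; case: (cc k) => -> /=; ring.
have w1d : `|w1 - x| <= d.
  apply: norm_coord_le => // k; rewrite mxE [(- x) 0 k]mxE w1E.
  by case: ifP => _; [have := hy k|have := hz k]; rewrite !mxE.
have w2d : `|w2 - x| <= d.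
  apply: norm_coord_le => // k; rewrite mxE [(- x) 0 k]mxE w2E.
  by case: ifP => _; [have := hz k|have := hy k]; rewrite !mxE.
have k1 := H z 0 (y 0 0 - z 0 0) zd w1d.
have k2 := H w1 1 (y 0 1 - z 0 1) w1d w2d.
have k3 := H w2 i2 (y 0 i2 - z 0 i2) w2d.
rewrite -yE in k3; have {}k3 := k3 yd.
have q k : C * `|y 0 k - z 0 k| <= C * `|y - z|.
  by rewrite ler_wpM2l//; have := coord_norm (y - z) k; rewrite !mxE.
have q1 := q 0; have q2 := q 1; have q3 := q i2.
rewrite -/w1 in k1; rewrite -/w2 in k2.
rewrite (_ : f y - f z = (f y - f w2) + (f w2 - f w1) + (f w1 - f z)); last by ring.
apply: le_trans (ler_normD _ _) _; have := ler_normD (f y - f w2) (f w2 - f w1); lra.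
Qed.

Lemma deriv_box f x (d c e : R) i y s :
  (forall y, `|y - x| <= d -> derivable f y (ee i)) ->
  (forall y, `|y - x| <= d -> `|'D_(ee i) f y - c| <= e) ->
  `|y - x| <= d -> `|y + s *: ee i - x| <= d ->
  `|f (y + s *: ee i) - f y - c * s| <= e * `|s|.
Proof.
move=> df dfe yd sd.
have hb (r : R) : 0 <= r <= 1 -> `|y + (r * s) *: ee i - x| <= d.
  move=> /andP[r0 r1].
  rewrite (_ : _ - x = r *: (y + s *: ee i - x) + (1 - r) *: (y - x)); last first.
    by apply/rowP => k; rewrite !mxE; ring.
  apply: le_trans (ler_normD _ _) _; rewrite !normrZ !ger0_norm ?subr_ge0//.
  by have := @ler_wpM2l R r r0 _ _ sd; have := @ler_wpM2l R (1 - r) _ _ _ yd; rewrite subr_ge0 => /(_ r1); lra.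
pose k (r : R) := f (y + (r * s) *: ee i) - c * s * r.
have kd (r : R) : 0 <= r <= 1 -> is_derive r 1 k (('D_(ee i) f (y + (r * s) *: ee i) - c) * s).
  move=> r01; rewrite mulrBl; apply: dvB; last first.
    by rewrite -[X in is_derive _ _ _ X](_ : c * s * 1 + r * 0 = _); [dtac|ring].
  apply: (@is_derive1_comp _ (fun s => f (y + s *: ee i)) (fun r => r * s)).
    by apply/(is_derive_line f y (ee i) (r * s)); apply: derivableP; apply: df; exact: hb.
  by rewrite -[X in is_derive _ _ _ X](_ : r * 0 + s * 1 = _); [dtac|ring].
have := @is_derive_bound _ k _ 0 1 (e * `|s|) ler01 kd.
rewrite /k mul1r mul0r scale0r addr0 !mulr1 mulr0 !subr0 mulr1.
rewrite (_ : f (y + s *: ee i) - c * s - f y = f (y + s *: ee i) - f y - c * s); last by ring.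
apply => r r01; rewrite normrM ler_wpM2r// dfe//; exact: hb.
Qed.

End Regularity.

Section RegularityTheorem.
Context {R : realType}.
Local Notation V3 := 'rV[R]_3.
Implicit Types (O : set V3) (u v h f : V3 -> R) (x y z w : V3).

(** All mixed second derivatives are included because [sphere_C 2] asks for them. *)
Definition C2on O u := forall x, O x -> ctn u x /\ forall i, [/\ derivable u x (ee i),
  ctn ('D_(ee i) u) x & forall j, derivable ('D_(ee i) u) x (ee j) /\
    ctn ('D_(ee j) ('D_(ee i) u)) x].

Definition lapl u x := \sum_i 'D_(ee i) ('D_(ee i) u) x.

Lemma C2on_has_lap O u : C2on O u -> has_lap O u (lapl u).
Proof.
move=> H; exists (fun i => 'D_(ee i) u), (fun i => 'D_(ee i) ('D_(ee i) u)) => x Ox.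
have [_ Hx] := H _ Ox; split => // i; have [D1 _ D2] := Hx i; have [D3 _] := D2 i.
by split; exact: derivableP.
Qed.

Definition loclip O h := forall x, O x -> exists2 d : R, 0 < d & exists2 L : R, 0 <= L &
  forall y z, `|y - x| <= d -> `|z - x| <= d -> `|h y - h z| <= L * `|y - z|.

Lemma near_box (P : set V3) x : (\forall y \near x, P y) ->
  exists2 d : R, 0 < d & forall y, `|y - x| <= d -> P y.
Proof.
move=> /nbhs_ballP[d /= d0 H]; exists (d / 2); first by rewrite divr_gt0.
by move=> y yx; apply: H; rewrite -ball_normE /= distrC; lra.
Qed.

Lemma open_box_sub O x : open O -> O x -> exists2 d : R, 0 < d & forall y, `|y - x| <= d -> O y.
Proof. by move=> oO Ox; apply: near_box; exact: open_nbhs_nbhs. Qed.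

Lemma wsol_ctn O u h x : open O -> wsol O u h -> O x -> ctn u x.
Proof.
move=> oO H Ox; apply/ctnP => e e0.
have e30 : 0 < e / 3 by rewrite divr_gt0.
have [v [f [_ cv uv _]]] := H _ e30.
have /ctnP/(_ _ e30)[d1 d10 H1] := cv _ Ox.
have [d2 d20 H2] := open_box_sub oO Ox.
exists (Num.min d1 d2); first by rewrite lt_min d10.
move=> y; rewrite lt_min => /andP[y1 y2].
have := uv _ Ox; have := uv _ (H2 _ (ltW y2)); have := H1 _ y1.
rewrite !ler_norml; lra.
Qed.

Lemma loclip_ctn O h x : loclip O h -> O x -> ctn h x.
Proof.
move=> H Ox; apply/ctnP => e e0; have [d d0 [L L0 hL]] := H _ Ox.
exists (Num.min d (e / (L + 1))); first by rewrite lt_min d0 divr_gt0// ltr_wpDl.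
move=> y; rewrite lt_min => /andP[/ltW yd ye].
have xd : `|x - x| <= d by rewrite subrr normr0 ltW.
apply: le_trans (hL _ _ yd xd) _.
rewrite ltr_pdivlMr ?ltr_wpDl// in ye.
by have := normr_ge0 (y - x); nra.
Qed.

(** Method of difference quotients: the increment [u (z + s e_j) - u z] solves the equation with the
    increment of [h] as right side. Both are of order [|s|], the first by [wsol_lip], the second
    because [h] is Lipschitz, so [wsol_dbound] makes the increment of [D_i u] of order [|s|]. The
    pair [LK] holds the Lipschitz constants of [h] and of the first derivatives. *)
Lemma wsol_dlip O u h x : open O -> wsol O u h -> loclip O h -> O x ->
  exists2 d : R, 0 < d & exists LK : R * R, [/\ 0 <= LK.1, 0 <= LK.2,
    forall y, `|y - x| <= d -> O y,
    forall y z, `|y - x| <= d -> `|z - x| <= d -> `|h y - h z| <= LK.1 * `|y - z| &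
    forall i y z, `|y - x| <= d -> `|z - x| <= d ->
     `|'D_(ee i) u y - 'D_(ee i) u z| <= LK.2 * `|y - z|].
Proof.
move=> oO H hl Ox; have [d1 d10 [L L0 hL]] := hl _ Ox.
have [d2 d20 H2] := open_box_sub oO Ox.
have /ctnP/(_ _ ltr01)[d3 d30 H3] := wsol_ctn oO H Ox.
(* Base points lie within [d] of [x], increments are studied on the box of radius [3 * d], and the
   steps [|s| <= 2 * d] then lead at most to [5 * d]; the bound [uK] on radius [4 * d] needs data on
   [8 * d]. *)
pose D := Num.min d1 (Num.min d2 (d3 / 2)); pose d := D / 8.
have D0 : 0 < D by rewrite !lt_min d10 d20 divr_gt0.
have d0 : 0 < d by rewrite divr_gt0.
have dD : 8 * d = D by rewrite /d; field.
have D1 y : `|y - x| <= 8 * d -> `|y - x| <= d1.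
  by rewrite dD le_min => /andP[].
have D2 y : `|y - x| <= 8 * d -> O y.
  by rewrite dD !le_min => /and3P[_ yd _]; exact: H2.
pose M := `|u x| + 1; pose F := `|h x| + L * (8 * d).
have uM y : `|y - x| <= 8 * d -> `|u y| <= M.
  rewrite dD !le_min => /and3P[_ _ yd]; have := H3 y _.
  have := lerB_dist (u y) (u x); rewrite /M; move: yd d30; lra.
have x1 : `|x - x| <= d1 by rewrite subrr normr0 ltW.
have hF y : `|y - x| <= 8 * d -> `|h y| <= F.
  move=> yd; have := hL _ _ (D1 _ yd) x1; have := lerB_dist (h y) (h x).
  by have := ler_wpM2l L0 yd; rewrite /F; lra.
have E8 : 2 * (4 * d) = 8 * d by ring.
pose K := 6 * M / (4 * d) + 4 * d * F / 4.
have M0 : 0 <= M by rewrite addr_ge0.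
have F0 : 0 <= F by rewrite addr_ge0// !mulr_ge0// ltW.
have K0 : 0 <= K.
  by rewrite addr_ge0// ?divr_ge0 ?mulr_ge0// ltW.
have uK y i s : `|y - x| <= 4 * d -> `|s| < 4 * d -> `|u (y + s *: ee i) - u y| <= `|s| * K.
  move=> yd sd; apply: wsol_lip oO H _ _ _ _ yd sd; rewrite ?E8//.
  by rewrite mulr_gt0.
pose K2 := 3 * K / d + d * L / 2.
have K20 : 0 <= K2 by rewrite addr_ge0// ?divr_ge0// ?mulr_ge0// ltW.
exists d => //; exists (L, 3 * K2); split => //=.
- by rewrite mulr_ge0.
- by move=> y yd; apply: D2; lra.
- by move=> y z yd zd; apply: hL; apply: D1; lra.
move=> i; apply: lip_box => // y j s yd sd.
have s2 : `|s| <= 2 * d.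
  rewrite -(norm_Zee s j) (_ : s *: ee j = (y + s *: ee j - x) - (y - x)); last first.
    by apply/rowP => k; rewrite !mxE; ring.
  by apply: le_trans (ler_normB _ _) _; lra.
pose O' := [set z : V3 | `|z - x| < 3 * d].
have O'E z : O' z -> `|z - x| < 3 * d by [].
have oO' : open O' by exact: open_box.
have H' : wsol O' (fun z => u (z + s *: ee j) - u z) (fun z => h (z + s *: ee j) - h z).
  apply: wsolB; last by apply: wsol_sub H => z /O'E zd; apply: D2; lra.
  apply: wsol_sub (wsol_shift (s *: ee j) H) => z /O'E zd; apply: D2.
  rewrite addrAC; apply: le_trans (ler_normD _ _) _; rewrite norm_Zee; lra.
have P z : `|z - y| <= d -> `|z - x| < 3 * d.
  move=> zd; rewrite (_ : z - x = (z - y) + (y - x)); last by rewrite addrA subrK.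
  by apply: le_lt_trans (ler_normD _ _) _; lra.
have Oy : O y by apply: D2; lra.
have Oys : O (y + s *: ee j) by apply: D2; lra.
have dd : is_derive y (ee i) (fun z => u (z + s *: ee j) - u z)
    ('D_(ee i) u (y + s *: ee j) - 'D_(ee i) u y).
  exact: dvB (is_derive_shiftV (derivableP (wsol_derivable oO H Oys)))
    (derivableP (wsol_derivable oO H Oy)).
have := @wsol_dbound _ _ _ _ y i d (`|s| * K) (L * `|s|) _ oO' H' d0 P _ _ dd.
rewrite (_ : 3 * (`|s| * K) / d + d * (L * `|s|) / 2 = K2 * `|s|); last first.
  by rewrite /K2; field; rewrite gt_eqF.
apply.
- by move=> z /P zd; apply: uK; move: s2 d0 zd; clear; lra.
- move=> z /P zd; have := hL (z + s *: ee j) z _ _.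
  rewrite [z + _ - z]addrC addKr norm_Zee; apply; apply: D1; last by lra.
  by rewrite addrAC; apply: le_trans (ler_normD _ _) _; rewrite norm_Zee; lra.
Qed.

(** The difference of two difference quotients of [u] in direction [j] is again a solution. Its
    values are small because the first derivatives are Lipschitz, but its right side is merely
    bounded by [2 * L], since quotients of a Lipschitz function need not converge. The gradient
    bound on a box of radius [d'] is still small: the right side enters it multiplied by [d']. *)
Lemma wsol_d2 O u h x i j : open O -> wsol O u h -> loclip O h -> O x ->
  derivable ('D_(ee i) u) x (ee j) /\ ctn ('D_(ee j) ('D_(ee i) u)) x.
Proof.
move=> oO H hl Ox; apply: (quot_cvg oO Ox) => {Ox}x Ox e e0.
have [d d0 [[L K] /= [L0 K0 dO hL uK]]] := wsol_dlip oO H hl Ox.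
(* First [d'] makes the contribution [d' * L] of the right side small; then [dl], the bound on all
   steps, is taken small relative to [d'], to compensate the factor [1 / d'] in front of the
   values. *)
pose d' := Num.min (d / 8) (e / (2 * (L + 1))).
have L10 : 0 < L + 1 by rewrite ltr_wpDl.
have K10 : 0 < K + 1 by rewrite ltr_wpDl.
have d'0 : 0 < d' by rewrite lt_min !divr_gt0// mulr_gt0.
have d'd : d' <= d / 8 by rewrite ge_min lexx.
have d'e : d' * L <= e / 2.
  have : d' <= e / (2 * (L + 1)) by rewrite ge_min lexx orbT.
  by rewrite ler_pdivlMr ?mulr_gt0//; nra.
pose dl := Num.min (d' / 2) (e * d' / (18 * (K + 1))).
have dl0 : 0 < dl by rewrite lt_min !divr_gt0// ?mulr_gt0.
have dld : dl <= d' / 2 by rewrite ge_min lexx.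
have dle : 3 * (3 * (K * dl)) / d' <= e / 2.
  have : dl <= e * d' / (18 * (K + 1)) by rewrite ge_min lexx orbT.
  by rewrite ler_pdivlMr ?mulr_gt0// ler_pdivrMr//; nra.
exists dl => // w t s wd t0 td s0 sd.
have t0' : t != 0 by rewrite -normr_gt0.
have s0' : s != 0 by rewrite -normr_gt0.
pose O' := [set z : V3 | `|z - x| < 2 * d'].
have O'E z : O' z -> `|z - x| < 2 * d' by [].
have oO' : open O' by exact: open_box.
have P1 z a : `|z - x| < 2 * d' -> `|a| < dl -> `|z + a *: ee j - x| <= d.
  move=> zd ad; rewrite addrAC; apply: le_trans (ler_normD _ _) _; rewrite norm_Zee; lra.
have P2 z a : `|z - x| < 2 * d' -> `|a| < dl -> `|z + w + a *: ee j - x| <= d.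
  move=> zd ad; rewrite (_ : _ - x = (z - x) + (w + a *: ee j)); last by rewrite addrACA addrA addrAC -!addrA.
  apply: le_trans (ler_normD _ _) _; have := ler_normD w (a *: ee j); rewrite norm_Zee; lra.
have P3 z : `|z - x| < 2 * d' -> `|z + w - x| <= d.
  by move=> zd; have := P2 z 0 zd; rewrite scale0r addr0 normr0; exact.
pose q u a z := a^-1 * (u (z + a *: ee j) - u z).
have H' : wsol O' (fun z => q u t (z + w) - q u s z) (fun z => q h t (z + w) - q h s z).
  apply: wsolB.
    apply: wsolZ; apply: wsolB.
      apply: wsol_sub (wsol_shift w (wsol_shift (t *: ee j) H)) => z /O'E zd.
      by apply: dO; exact: P2.
    by apply: wsol_sub (wsol_shift w H) => z /O'E zd; apply: dO; exact: P3.
  apply: wsolZ; apply: wsolB; last by apply: wsol_sub H => z /O'E zd; apply: dO; lra.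
  by apply: wsol_sub (wsol_shift (s *: ee j) H) => z /O'E zd; apply: dO; exact: P1.
have hq z a : `|z - x| <= d -> `|z + a *: ee j - x| <= d -> a != 0 -> `|q h a z| <= L.
  move=> z1 z2 a0; rewrite normrM normfV mulrC ler_pdivrMr ?normr_gt0//.
  by have := hL _ _ z2 z1; rewrite [z + _ - z]addrC addKr norm_Zee.
have uq z a : `|z - x| <= d / 2 -> `|a| <= d / 2 -> a != 0 -> `|q u a z - 'D_(ee j) u z| <= K * `|a|.
  move=> z1 z2 a0.
  have Q y : `|y - z| <= `|a| -> `|y - x| <= d.
    move=> yz; rewrite (_ : y - x = (y - z) + (z - x)); last by rewrite addrA subrK.
    by apply: le_trans (ler_normD _ _) _; lra.
  have := @deriv_box _ u z `|a| ('D_(ee j) u z) (K * `|a|) j z a.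
  rewrite subrr normr0 [z + _ - z]addrC addKr norm_Zee => /(_ _ _ _ (lexx _)) HH.
  rewrite /q (_ : _ - 'D_(ee j) u z = a^-1 * (u (z + a *: ee j) - u z - 'D_(ee j) u z * a)); last by field.
  rewrite normrM normfV mulrC ler_pdivrMr ?normr_gt0//; apply: HH => //.
  - by move=> y /Q/dO Oy; exact: wsol_derivable oO H Oy.
  - move=> y ya; apply: le_trans (uK j y z _ _) _; [exact: Q|lra|].
    by rewrite ler_wpM2l.
have dd : is_derive x (ee i) (fun z => q u t (z + w) - q u s z)
  (('D_(ee i) u (x + w + t *: ee j) - 'D_(ee i) u (x + w)) / t -
   ('D_(ee i) u (x + s *: ee j) - 'D_(ee i) u x) / s).
  have qd z a : O z -> O (z + a *: ee j) -> is_derive z (ee i) (q u a)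
      (('D_(ee i) u (z + a *: ee j) - 'D_(ee i) u z) / a).
    move=> O1 O2; rewrite mulrC; apply: (@is_deriveZ _ _ _ _ a^-1).
    exact: dvB (is_derive_shiftV (derivableP (wsol_derivable oO H O2)))
      (derivableP (wsol_derivable oO H O1)).
  have xd : `|x - x| < 2 * d' by rewrite subrr normr0 mulr_gt0.
  exact: dvB (is_derive_shiftV (qd _ _ (dO _ (P3 _ xd)) (dO _ (P2 _ _ xd td))))
    (qd _ _ Ox (dO _ (P1 _ _ xd sd))).
have B z : `|z - x| <= d' -> `|z - x| < 2 * d' by lra.
have := @wsol_dbound _ _ _ _ x i d' (3 * (K * dl)) (2 * L) _ oO' H' d'0 B _ _ dd.
set T := `|_|; have -> : d' * (2 * L) / 2 = d' * L by field.
move=> HH; suff : T <= 3 * (3 * (K * dl)) / d' + d' * L by move=> /le_trans; apply; lra.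
apply: HH.
- move=> z /B zd.
  rewrite (_ : _ - _ = (q u t (z + w) - 'D_(ee j) u (z + w)) + ('D_(ee j) u (z + w) - 'D_(ee j) u z) - (q u s z - 'D_(ee j) u z)); last by ring.
  apply: le_trans (ler_normB _ _) _.
  have := ler_normD (q u t (z + w) - 'D_(ee j) u (z + w)) ('D_(ee j) u (z + w) - 'D_(ee j) u z).
  have := uq (z + w) t _ _ t0'; have := uq z s _ _ s0'.
  have := uK j (z + w) z (P3 _ zd); rewrite [z + w - z]addrC addKr.
  have zw : `|z + w - x| <= d / 2.
    by rewrite addrAC; apply: le_trans (ler_normD _ _) _; lra.
  have := ler_wpM2l K0 (ltW wd); have := ler_wpM2l K0 (ltW td); have := ler_wpM2l K0 (ltW sd).
  move=> Ks Kt Kw /(_ _) H1 /(_ _ _) H2 /(_ zw _) H3.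
  have {}H1 := H1 _; have {}H2 := H2 _ _; have {}H3 := H3 _.
  have z1 : `|z - x| <= d by move: zd d'd d0; clear; lra.
  have z2 : `|z - x| <= d / 2 by move: zd d'd d0; clear; lra.
  have s2 : `|s| <= d / 2 by move: sd dld d'd d0; clear; lra.
  have t2 : `|t| <= d / 2 by move: td dld d'd d0; clear; lra.
  by move: (H1 z1) (H2 z2 s2) (H3 t2) Ks Kt Kw; clear; lra.
- move=> z /B zd; apply: le_trans (ler_normB _ _) _.
  have zd' : `|z - x| <= d by lra.
  by rewrite mulr_natl mulr2n lerD// hq//; [exact: P3|exact: P2|exact: P1].
Qed.

(* A smooth uniform limit of solutions is a viscosity solution, hence a solution. *)
Lemma wsol_lap_le O u h L x : open O -> O x -> wsol O u h -> has_lap O u L ->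
  (forall y, O y -> ctn u y) -> ctn L x -> ctn h x -> L x <= h x.
Proof.
move=> oO Ox H uL cu cL ch; rewrite leNgt; apply/negP => hLx.
pose k := (L x - h x) / 3; have k0 : 0 < k by rewrite divr_gt0// subr_gt0.
have k20 : 0 < k / 2 by rewrite divr_gt0.
have /ctnP/(_ _ k20)[d1 d10 H1] := cL.
have /ctnP/(_ _ k20)[d2 d20 H2] := ch.
have [d3 d30 H3] := open_box_sub oO Ox.
pose d := Num.min (d1 / 2) (Num.min (d2 / 2) d3).
have d0 : 0 < d by rewrite !lt_min d30 !divr_gt0.
have dO y : `|y - x| <= d -> O y.
  by rewrite !le_min => /and3P[_ _]; exact: H3.
have dL y : `|y - x| <= d -> h y + k <= L y.
  rewrite !le_min => /and3P[y1 y2 _].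
  have := H1 y _; have := H2 y _; have k3 : L x - h x = 3 * k by rewrite /k; field.
  move=> /(_ _) A1 /(_ _) A2; have {}A1 := A1 _; have {}A2 := A2 _.
  have y1' : `|y - x| < d1 by lra.
  have y2' : `|y - x| < d2 by lra.
  by move: (A1 y2') (A2 y1'); rewrite !ler_norml; lra.
(* The quadratic [a |y - x|^2] has Laplacian [6 a = k / 4], less than the slack [k - e >= k / 2]
   between [L] and [f]. At distance [d] it is at least [a d^2], so comparison gives
   [w x <= e - a d^2], while [w x >= - e]; the choice [e <= a d^2 / 4] makes these incompatible. *)
pose a := k / 24; have a0 : 0 < a by rewrite divr_gt0.
pose e := Num.min (k / 2) (a * d ^+ 2 / 4).
have e0 : 0 < e by rewrite lt_min k20 divr_gt0// mulr_gt0// exprn_gt0.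
have ek : e <= k / 2 by rewrite ge_min lexx.
have ead : e <= a * d ^+ 2 / 4 by rewrite ge_min lexx orbT.
have [v [f [vf cv uv hf]]] := H _ e0.
pose K := [set y : V3 | `|y - x| <= d]; pose O1 := [set y : V3 | `|y - x| < d].
have O1O : O1 `<=` O by move=> y /ltW/dO.
pose w y := (u y - v y) - \sum_j (a * (y 0 j - x 0 j) ^+ 2 + 0 * (y 0 j - x 0 j)).
have wL : has_lap O1 w (fun y => (L y - f y) - 2 * \sum_(j < 3) a).
  apply: has_lapB; last exact: (has_lap_quad _ (fun=> a) (fun=> 0) x).
  by apply: has_lapB; [apply: has_lap_sub uL|apply: has_lap_sub vf].
have S y : w y = (u y - v y) - a * \sum_j (y 0 j - x 0 j) ^+ 2.
  by rewrite /w mulr_sumr; congr (_ - _); apply: eq_bigr => j _; rewrite mul0r addr0.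
have : w x <= e - a * d ^+ 2.
  apply: (@max_principle _ K O1 w _ _ (@compact_box _ x d) _ (@open_box _ x d) _ wL) => //.
  - by move=> y /ltW.
  - apply/continuous_in_subspaceT => y; rewrite inE => /dO Oy.
    by have c1 := cu y Oy; have c2 := cv y Oy; rewrite /w; ctac.
  - move=> y /ltW yd; rewrite sumr_const card_ord -mulr_natr.
    by have := dL y yd; have := hf y (dO _ yd); rewrite ler_norml /a; move: ek; lra.
  - move=> y yd ny; rewrite S; have := uv y (dO _ yd); rewrite ler_norml => /andP[_ uve].
    rewrite lerB// ler_wpM2l ?(ltW a0)//.
    have yE : `|y - x| = d.
      by apply/eqP; rewrite eq_le yd/= leNgt; apply/negP => /ny.
    have [j] := norm_coord_ex (y - x); rewrite yE !mxE => ->.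
    rewrite (bigD1 j)//= real_normK ?num_real// lerDl sumr_ge0// => i _; exact: sqr_ge0.
  - by rewrite /K /= subrr normr0 ltW.
rewrite S; under eq_bigr do rewrite subrr expr0n.
rewrite sumr_const mul0rn mulr0 subr0.
by have := uv x Ox; rewrite ler_norml; move: ead e0; clear; lra.
Qed.

Theorem wsol_regular O u h : open O -> wsol O u h -> loclip O h ->
  C2on O u /\ forall x, O x -> lapl u x = h x.
Proof.
move=> oO H hl.
have C2 : C2on O u.
  move=> x Ox; split; first exact: wsol_ctn oO H Ox.
  move=> i; split; first exact: wsol_derivable oO H Ox.
    have [d d0 [[L K] /= [L0 K0 _ _ uK]]] := wsol_dlip oO H hl Ox.
    apply: (@loclip_ctn [set x]) => // _ ->; exists d => //; exists K => // y z yd zd.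
    exact: uK.
  by move=> j; exact: wsol_d2 H hl Ox.
split=> // x Ox; have uL := C2on_has_lap C2.
have cu y : O y -> ctn u y by move=> /C2[].
have cL : ctn (lapl u) x.
  by apply: ctn_sum => i; have [_ /(_ i)[_ _ /(_ i)[]]] := C2 _ Ox.
have ch := loclip_ctn hl Ox.
apply/eqP; rewrite eq_le (wsol_lap_le oO Ox H uL cu cL ch)/=.
suff : -1 * lapl u x <= -1 * h x by rewrite !mulN1r lerN2.
apply: (@wsol_lap_le O _ _ (fun y => -1 * lapl u y) x oO Ox (wsolZ (-1) H) (has_lapZ (-1) uL)).
- by move=> y /cu c1; ctac.
- by ctac.
- by ctac.
Qed.

End RegularityTheorem.

Ltac dstep2 :=
  match goal with
  | |- is_derive _ _ (fun y => GRing.inv _) _ => notypeclasses refine (dvV _ _)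
  | |- _ => dstep
  end.

(** * Euclidean geometry and explicit functions of degree zero *)

Section Euclid.
Context {R : realType}.
Local Notation V3 := 'rV[R]_3.
Implicit Types (x y a b c : V3).

Lemma dotvE x y : dotv x y = x 0 0 * y 0 0 + x 0 1 * y 0 1 + x 0 ord_max * y 0 ord_max.
Proof.
rewrite /dotv !big_ord_recl big_ord0 addr0 addrA.
by congr (_ * _ + _ * _ + _ * _); congr (_ _ _); apply/val_inj.
Qed.

Lemma sum3 (f : 'I_3 -> R) : \sum_i f i = f 0 + f 1 + f ord_max.
Proof.
rewrite !big_ord_recl big_ord0 addr0 addrA.
by congr (f _ + f _ + f _); apply/val_inj.
Qed.

Lemma dotvC x y : dotv x y = dotv y x.
Proof. by rewrite !dotvE; ring. Qed.
Lemma dotvDl x y z : dotv (x + y) z = dotv x z + dotv y z.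
Proof. by rewrite !dotvE !mxE; ring. Qed.
Lemma dotvDr x y z : dotv z (x + y) = dotv z x + dotv z y.
Proof. by rewrite !dotvE !mxE; ring. Qed.
Lemma dotvNl x y : dotv (- x) y = - dotv x y.
Proof. by rewrite !dotvE !mxE; ring. Qed.
Lemma dotvNr x y : dotv x (- y) = - dotv x y.
Proof. by rewrite !dotvE !mxE; ring. Qed.
Lemma dotvBl x y z : dotv (x - y) z = dotv x z - dotv y z.
Proof. by rewrite dotvDl dotvNl. Qed.
Lemma dotvBr x y z : dotv z (x - y) = dotv z x - dotv z y.
Proof. by rewrite dotvDr dotvNr. Qed.
Lemma dotvZl k x y : dotv (k *: x) y = k * dotv x y.
Proof. by rewrite !dotvE !mxE; ring. Qed.
Lemma dotvZr k x y : dotv x (k *: y) = k * dotv x y.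
Proof. by rewrite !dotvE !mxE; ring. Qed.
Lemma dotv_ge0 x : 0 <= dotv x x.
Proof. by rewrite dotvE !addr_ge0// -expr2 sqr_ge0. Qed.
Lemma dotv_ee x i : dotv x (ee i) = x 0 i.
Proof.
rewrite /dotv -[RHS](sum_eqn i (fun j => x 0 j)); apply: eq_bigr => j _.
by rewrite mxE eqxx mulrC.
Qed.
Lemma enorm_ge0 x : 0 <= enorm x. Proof. exact: sqrtr_ge0. Qed.
Lemma enorm_sq x : enorm x ^+ 2 = dotv x x. Proof. by rewrite sqr_sqrtr// dotv_ge0. Qed.

Lemma dotv_eq0 x : dotv x x = 0 -> x = 0.
Proof.
move=> x0; apply/rowP => i; rewrite mxE; apply/eqP; rewrite -sqrf_eq0 eq_le sqr_ge0 andbT -x0.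
by rewrite /dotv (bigD1 i)//= -expr2 lerDl sumr_ge0// => j _; rewrite -expr2 sqr_ge0.
Qed.

Lemma enorm_eq0 x : enorm x = 0 -> x = 0.
Proof. by move=> x0; apply: dotv_eq0; rewrite -enorm_sq x0 expr0n. Qed.

Lemma enorm_gt0 x : (0 < enorm x) = (x != 0).
Proof.
rewrite lt_neqAle enorm_ge0 andbT eq_sym; congr (~~ _); apply/eqP/eqP => [/enorm_eq0//|->].
by rewrite /enorm dotvE !mxE !mulr0 !addr0 sqrtr0.
Qed.

Lemma enormZ k x : enorm (k *: x) = `|k| * enorm x.
Proof. by rewrite /enorm dotvZl dotvZr mulrA -expr2 sqrtrM ?sqr_ge0// sqrtr_sqr. Qed.

Lemma enormN x : enorm (- x) = enorm x.
Proof. by rewrite -scaleN1r enormZ normrN1 mul1r. Qed.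

Lemma dotv_le x y : dotv x y <= enorm x * enorm y.
Proof.
apply: (le_trans (ler_norm _)); rewrite -ler_sqr ?nnegrE ?mulr_ge0 ?enorm_ge0//.
rewrite real_normK ?num_real// exprMn !enorm_sq !dotvE.
set a1 := x 0 0; set a2 := x 0 1; set a3 := x 0 _; set b1 := y 0 0; set b2 := y 0 1; set b3 := y 0 _.
rewrite -subr_ge0 [X in 0 <= X](_ : _ = (a1 * b2 - a2 * b1) ^+ 2 + (a1 * b3 - a3 * b1) ^+ 2 +
  (a2 * b3 - a3 * b2) ^+ 2); last by ring.
by rewrite !addr_ge0// sqr_ge0.
Qed.

Lemma dotv_ge x y : - (enorm x * enorm y) <= dotv x y.
Proof. by have := dotv_le (- x) y; rewrite dotvNl enormN lerNl. Qed.

Lemma enormD x y : enorm (x + y) <= enorm x + enorm y.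
Proof.
rewrite -ler_sqr ?nnegrE ?addr_ge0 ?enorm_ge0// sqrrD !enorm_sq dotvDl !dotvDr (dotvC y x).
by have := dotv_le x y; lra.
Qed.

Lemma enorm_dist x y : enorm (x - y) ^+ 2 = dotv x x + dotv y y - 2 * dotv x y.
Proof. by rewrite enorm_sq dotvBl !dotvBr (dotvC y x); ring. Qed.

Lemma coord_enorm x i : `|x 0 i| <= enorm x.
Proof.
rewrite -ler_sqr ?nnegrE ?enorm_ge0// real_normK ?num_real// enorm_sq.
by rewrite /dotv (bigD1 i)//= -expr2 lerDl sumr_ge0// => j _; rewrite -expr2 sqr_ge0.
Qed.

Lemma norm_le_enorm x : `|x| <= enorm x.
Proof. by apply: norm_coord_le; [exact: enorm_ge0|exact: coord_enorm]. Qed.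

Lemma enorm_le_norm x : enorm x <= 3 * `|x|.
Proof.
rewrite -ler_sqr ?nnegrE ?enorm_ge0 ?mulr_ge0// enorm_sq dotvE -!expr2.
have P i : x 0 i ^+ 2 <= `|x| ^+ 2.
  by rewrite -[X in X <= _](real_normK (num_real _)) ler_sqr ?nnegrE// coord_norm.
have := P 0; have := P 1; have := P ord_max; have := sqr_ge0 `|x|; rewrite exprMn; lra.
Qed.

Lemma ctn_dotv {T : topologicalType} (f g : T -> V3) t :
  ctn f t -> ctn g t -> ctn (fun s => dotv (f s) (g s)) t.
Proof.
move=> cf cg; rewrite /dotv; apply: ctn_sum => i; apply: ctnM.
  by apply: (@ctn_comp _ _ _ (fun y : V3 => y 0 i) _ _ cf); exact: coord_continuous.
by apply: (@ctn_comp _ _ _ (fun y : V3 => y 0 i) _ _ cg); exact: coord_continuous.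
Qed.

Lemma ctn_enorm {T : topologicalType} (f : T -> V3) t : ctn f t -> ctn (fun s => enorm (f s)) t.
Proof.
move=> cf; apply: (@ctn_comp _ _ _ (@Num.sqrt R) (fun s => dotv (f s) (f s))).
  exact: ctn_dotv.
exact: sqrt_continuous.
Qed.

Lemma dv_dotv x i c : is_derive x (ee i) (fun y => dotv y c) (c 0 i).
Proof.
apply/is_derive_line0; under eq_fun do rewrite dotvDl dotvZl [dotv (ee i) c]dotvC dotv_ee.
by eapply is_derive_eq; [dtac|rewrite /=; ring].
Qed.

Lemma dv_coord x i j : is_derive x (ee i) (fun y : V3 => y 0 j) (j == i)%:R.
Proof.
apply/is_derive_line0; under eq_fun do rewrite coordD.
by eapply is_derive_eq; [dtac|rewrite /=; ring].
Qed.

Lemma dv_enorm x i : enorm x != 0 -> is_derive x (ee i) (@enorm R) (x 0 i / enorm x).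
Proof.
move=> x0; have xp : 0 < enorm x by rewrite lt_def x0 enorm_ge0.
have dp : 0 < dotv x x by rewrite -enorm_sq exprn_gt0.
have D : is_derive x (ee i) (fun y => dotv y y) (2 * x 0 i).
  apply/is_derive_line0.
  have -> : (fun s : R => dotv (x + s *: ee i) (x + s *: ee i)) =
    (fun s => dotv x x + s * (2 * x 0 i) + s ^+ 2).
    apply/funext => s; rewrite dotvDl !dotvDr !dotvZl !dotvZr [dotv (ee i) x]dotvC !dotv_ee mxE !eqxx.
    by rewrite /=; ring.
  by eapply is_derive_eq; [dtac|rewrite /=; ring].
have := @dvcomp R _ (@Num.sqrt R) (fun y => dotv y y) x (ee i) _ _ (is_derive1_sqrt dp) D.
rewrite -/(enorm x) => H; apply: is_derive_eq H _.
by field; rewrite x0.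
Qed.

(* Second order data of quadratic shape in the coordinates sum up with dot products. *)
Lemma sum_shape x a b (A B C E F : R) :
  \sum_i (A + B * x 0 i ^+ 2 + C * (x 0 i * a 0 i) + E * a 0 i ^+ 2 + F * (a 0 i * b 0 i)) =
  3 * A + B * dotv x x + C * dotv x a + E * dotv a a + F * dotv a b.
Proof. by rewrite sum3 !dotvE; ring. Qed.

End Euclid.

Section Explicit.
Context {R : realType}.
Local Notation V3 := 'rV[R]_3.
Implicit Types (x y b c : V3).
Context (a : V3).
Context (a1 : dotv a a = 1).

(** Homogeneous of degree one and, as [a] is a unit vector, zero exactly on the closed ray of [- a];
    so [dom] is the complement of that ray. *)
Definition den x := enorm x + dotv x a.
Definition dom : set V3 := [set x | 0 < den x].

Lemma ctn_den x : ctn den x.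
Proof. by apply: ctnD; [apply: ctn_enorm|apply: ctn_dotv]; ctac. Qed.

Lemma open_dom : open dom.
Proof. by apply: (@open_comp _ _ den [set r | 0 < r]) => [x _|]; [exact: ctn_den|exact: open_gt]. Qed.

Lemma dom_enorm x : dom x -> 0 < enorm x.
Proof.
rewrite /dom /den /= => H; rewrite lt_neqAle enorm_ge0 andbT eq_sym.
by apply: contraTneq H => /enorm_eq0 ->; rewrite dotvE /enorm dotvE !mxE !mul0r !addr0 sqrtr0 ltxx.
Qed.

Lemma dv_den x i : dom x -> is_derive x (ee i) den (x 0 i / enorm x + a 0 i).
Proof.
by move=> /dom_enorm x0; apply: dvD; [apply: dv_enorm; rewrite gt_eqF|exact: dv_dotv].
Qed.

(* Constant along rays, with positive Laplacian; on the sphere it is [1 / (1 + x.a)]. *)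
Definition phi x := enorm x / den x.

(** In stereographic coordinates [z] from [- a], [phi] is [(1 + |z|^2) / 2], with planar Laplacian
    2; the denominator is the conformal factor. The second derivatives are written in the form
    summed by [sum_shape]. *)
Lemma has_lap_phi : has_lap dom phi (fun x => 2 / den x ^+ 2).
Proof.
pose p i (x : V3) := x 0 i / enorm x.
exists (fun i x => p i x / den x - enorm x * (p i x + a 0 i) / den x ^+ 2).
exists (fun i x => let r := enorm x in let D := den x in
  (1 / (r * D) - 1 / D ^+ 2) + (- 1 / (r ^+ 3 * D) - 1 / (r ^+ 2 * D ^+ 2) + 2 / (r * D ^+ 3)) * x 0 i ^+ 2
  + (- 2 / (r * D ^+ 2) + 4 / D ^+ 3) * (x 0 i * a 0 i) + (2 * r / D ^+ 3) * a 0 i ^+ 2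
  + 0 * (a 0 i * a 0 i)).
move=> x Dx; have r0 := dom_enorm Dx; have D0 : 0 < den x by [].
have rn : enorm x != 0 by rewrite gt_eqF.
have Dn : den x != 0 by rewrite gt_eqF.
have dr i := dv_enorm i rn; have dD i := dv_den i Dx.
have dp i : is_derive x (ee i) (p i) (1 / enorm x - x 0 i ^+ 2 / enorm x ^+ 3).
  have dc := dv_coord x i i; have dri := dr i; rewrite eqxx in dc.
  by rewrite /p; eapply is_derive_eq; [repeat dstep2|rewrite /=; field; rewrite rn].
split=> [i|]; last first.
  rewrite /= sum_shape a1 -(enorm_sq x).
  have -> : dotv x a = den x - enorm x by rewrite /den; ring.
  by field; rewrite rn Dn.
have dri := dr i; have dDi := dD i; have dpi := dp i.
split.
  rewrite /phi; eapply is_derive_eq; [by repeat dstep2|].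
  by rewrite /p; field; rewrite rn Dn.
eapply is_derive_eq; [(repeat dstep2); by rewrite ?expf_neq0|].
by rewrite /p /=; field; rewrite rn Dn.
Qed.

(** For [b] orthogonal to [a]: the stereographic coordinate from the pole [- a] in direction [b],
    constant along rays; [zg] and [zh] are its first and pure second partial derivatives. *)
Definition zc b x := dotv x b / den x.
Definition zg b i x := b 0 i / den x - dotv x b * (x 0 i / enorm x + a 0 i) / den x ^+ 2.
Definition zh b i x := let r := enorm x in let D := den x in let N := dotv x b in
  (- N / (r * D ^+ 2)) + (N / (r ^+ 3 * D ^+ 2) + 2 * N / (r ^+ 2 * D ^+ 3)) * x 0 i ^+ 2
  + (4 * N / (r * D ^+ 3)) * (x 0 i * a 0 i) + (2 * N / D ^+ 3) * a 0 i ^+ 2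
  + (- 2 / D ^+ 2) * (a 0 i * b 0 i) - 2 / (r * D ^+ 2) * (x 0 i * b 0 i).

Lemma dv_zc b x i : dom x -> is_derive x (ee i) (zc b) (zg b i x).
Proof.
move=> Dx; have D0 : 0 < den x by []; have Dn : den x != 0 by rewrite gt_eqF.
have dDi := dv_den i Dx; have db := dv_dotv x i b.
rewrite /zc; eapply is_derive_eq; [by repeat dstep2|].
by rewrite /zg; field; rewrite Dn gt_eqF ?dom_enorm.
Qed.

Lemma dv_zg b x i : dom x -> is_derive x (ee i) (zg b i) (zh b i x).
Proof.
move=> Dx; have D0 : 0 < den x by []; have Dn : den x != 0 by rewrite gt_eqF.
have rn : enorm x != 0 by rewrite gt_eqF// dom_enorm.
have dDi := dv_den i Dx; have db := dv_dotv x i b; have dr := dv_enorm i rn.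
have dc := dv_coord x i i; rewrite eqxx in dc.
rewrite /zg; eapply is_derive_eq; [(repeat dstep2); by rewrite ?expf_neq0|].
by rewrite /zh /=; field; rewrite Dn rn.
Qed.

Lemma zh_sum b x : dom x -> dotv a b = 0 -> \sum_i zh b i x = 0.
Proof.
move=> Dx ab; have D0 : 0 < den x by []; have Dn : den x != 0 by rewrite gt_eqF.
have rn : enorm x != 0 by rewrite gt_eqF// dom_enorm.
rewrite /zh big_split/= sum_shape sumrN -mulr_sumr -/(dotv x b) ab a1 -(enorm_sq x).
have -> : dotv x a = den x - enorm x by rewrite /den; ring.
by field; rewrite rn Dn.
Qed.

(** This is conformality: for orthonormal directions the coordinate gradients are orthogonal with
    the common length [1 / den]. Since the coordinates are also harmonic by [zh_sum], the Laplacian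
    of a function of them is its planar Laplacian over [den ^+ 2]. *)
Lemma zg_sum b c x : dom x -> dotv a b = 0 -> dotv a c = 0 ->
  \sum_i zg b i x * zg c i x = dotv b c / den x ^+ 2.
Proof.
move=> Dx ab ac; have D0 : 0 < den x by []; have Dn : den x != 0 by rewrite gt_eqF.
have rn : enorm x != 0 by rewrite gt_eqF// dom_enorm.
pose r := enorm x; pose D := den x; pose N := dotv x b; pose M := dotv x c.
have -> : \sum_i zg b i x * zg c i x = dotv (D^-1 *: b - (N / D ^+ 2) *: (r^-1 *: x + a))
    (D^-1 *: c - (M / D ^+ 2) *: (r^-1 *: x + a)).
  by apply: eq_bigr => i _; rewrite /zg !mxE -/r -/D -/N -/M; field; rewrite Dn rn.
rewrite !(dotvBl, dotvBr, dotvDl, dotvDr, dotvZl, dotvZr).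
rewrite (dotvC b x) (dotvC b a) (dotvC a x) -/N -/M ab ac a1 -(enorm_sq x).
have -> : dotv x a = den x - enorm x by rewrite /den; ring.
by rewrite -/r -/D; field; rewrite rn Dn.
Qed.

End Explicit.

(** * Polynomial approximation on a square *)

Section Bernstein.
Context {R : realType}.
Implicit Types (f p q : R -> R -> R) (x y s t : R).

Inductive poly2 : (R -> R -> R) -> Prop :=
| poly2C c : poly2 (fun _ _ => c)
| poly2X : poly2 (fun x _ => x)
| poly2Y : poly2 (fun _ y => y)
| poly2D p q : poly2 p -> poly2 q -> poly2 (fun x y => p x y + q x y)
| poly2M p q : poly2 p -> poly2 q -> poly2 (fun x y => p x y * q x y).

Lemma poly2_exp p n : poly2 p -> poly2 (fun x y => p x y ^+ n).
Proof.
move=> pp; elim: n => [|n IH]; first by under eq_fun => x do under eq_fun => y do rewrite expr0; exact: poly2C.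
by under eq_fun => x do under eq_fun => y do rewrite exprS; exact: poly2M.
Qed.

Lemma poly2_sum n (p : 'I_n -> R -> R -> R) : (forall i, poly2 (p i)) ->
  poly2 (fun x y => \sum_i p i x y).
Proof.
elim: n p => [|n IH] p pp.
  by under eq_fun => x do under eq_fun => y do rewrite big_ord0; exact: poly2C.
under eq_fun => x do under eq_fun => y do rewrite big_ord_recl.
by apply: poly2D => //; apply: IH.
Qed.

Definition bern n k x : R := 'C(n, k)%:R * x ^+ k * (1 - x) ^+ (n - k).

Lemma bern_ge0 n k x : 0 <= x <= 1 -> 0 <= bern n k x.
Proof. by move=> /andP[x0 x1]; rewrite !mulr_ge0// exprn_ge0// subr_ge0. Qed.

Lemma bern_sum n x : \sum_(k < n.+1) bern n k x = 1.
Proof.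
have := exprDn (1 - x) x n; rewrite subrK expr1n => ->.
by apply: eq_bigr => k _; rewrite /bern -mulr_natl; ring.
Qed.

(** The identity [k C(n+1, k) = (n+1) C(n, k-1)] under a weight [g]; the weights 1 and [k] give the
    first two binomial moments. *)
Lemma bern_shift n x (g : nat -> R) :
  \sum_(k < n.+2) k%:R * bern n.+1 k x * g k = n.+1%:R * x * \sum_(k < n.+1) bern n k x * g k.+1.
Proof.
rewrite big_ord_recl /= !mul0r add0r mulr_sumr; apply: eq_bigr => k _.
rewrite /bern /bump /= add1n subSS exprS.
have := mul_bin_diag n.+1 k => /(congr1 (fun m => m%:R : R)); rewrite !natrM => E.
rewrite (_ : k.+1%:R * ('C(n.+1, k.+1)%:R * (x * x ^+ k) * (1 - x) ^+ (n - k)) * g k.+1 =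
  (k.+1%:R * 'C(n.+1, k.+1)%:R) * (x * x ^+ k * (1 - x) ^+ (n - k) * g k.+1)); last by ring.
by rewrite -E /=; ring.
Qed.

(** The variance of the binomial distribution with [n + 1] trials, expanded into its moments of
    orders 0, 1 and 2. *)
Lemma bern_var n x : \sum_(k < n.+2) (k%:R - n.+1%:R * x) ^+ 2 * bern n.+1 k x =
  n.+1%:R * x * (1 - x).
Proof.
have M1 : \sum_(k < n.+2) k%:R * bern n.+1 k x * 1 = n.+1%:R * x.
  by rewrite (bern_shift n x (fun=> 1)); under eq_bigr do rewrite mulr1; rewrite bern_sum mulr1.
have M2 : \sum_(k < n.+2) k%:R * bern n.+1 k x * k%:R = n.+1%:R * x * (n%:R * x + 1).
  rewrite (bern_shift n x (fun k => k%:R)); congr (_ * _).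
  under eq_bigr do rewrite -natr1 mulrDr mulr1; rewrite big_split/= bern_sum; congr (_ + _).
  case: n {M1} => [|n]; first by rewrite big_ord1 mulr0 mul0r.
  have := bern_shift n x (fun=> 1); under [in X in _ = X]eq_bigr do rewrite mulr1.
  by rewrite bern_sum mulr1 => <-; apply: eq_bigr => k _; ring.
have M0 := bern_sum n.+1 x.
transitivity (\sum_(k < n.+2) k%:R * bern n.+1 k x * k%:R +
  (- 2 * (n.+1%:R * x)) * (\sum_(k < n.+2) k%:R * bern n.+1 k x * 1) +
  (n.+1%:R * x) ^+ 2 * \sum_(k < n.+2) bern n.+1 k x).
  by rewrite !mulr_sumr -!big_split/=; apply: eq_bigr => k _; ring.
by rewrite M0 M1 M2 -natr1; ring.
Qed.

Lemma bern_var_le n x : 0 <= x <= 1 ->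
  \sum_(k < n.+2) (x - k%:R / n.+1%:R) ^+ 2 * bern n.+1 k x <= n.+1%:R^-1.
Proof.
move=> /andP[x0 x1]; have n0 : 0 < n.+1%:R :> R by rewrite ltr0n.
have -> : \sum_(k < n.+2) (x - k%:R / n.+1%:R) ^+ 2 * bern n.+1 k x =
   n.+1%:R ^- 2 * \sum_(k < n.+2) (k%:R - n.+1%:R * x) ^+ 2 * bern n.+1 k x.
  by rewrite mulr_sumr; apply: eq_bigr => k _; field; rewrite gt_eqF.
rewrite bern_var (_ : _ * _ = n.+1%:R^-1 * (x * (1 - x))); last by field; rewrite gt_eqF.
by rewrite ger_pMr ?invr_gt0//; nra.
Qed.

Definition unitI : set R := [set x | 0 <= x <= 1].

(** Tensor products of Bernstein polynomials, with Chebyshev's argument: the oscillation of [f] is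
    at most [e / 2] plus a multiple of squared distances, and the Bernstein average of these is a
    variance of order [1 / n]. *)
Theorem weierstrass2 f (M : R) :
  (forall x y, unitI x -> unitI y -> `|f x y| <= M) ->
  (forall e : R, 0 < e -> exists2 d : R, 0 < d & forall x y x' y',
     unitI x -> unitI y -> unitI x' -> unitI y' -> `|x - x'| < d -> `|y - y'| < d ->
     `|f x y - f x' y'| <= e) ->
  forall e : R, 0 < e -> exists2 p, poly2 p &
    forall x y, unitI x -> unitI y -> `|f x y - p x y| <= e.
Proof.
move=> fM cf e e0; have e20 : 0 < e / 2 by rewrite divr_gt0.
have [d d0 Hd] := cf _ e20.
have I0 : unitI 0 by rewrite /unitI /= lexx ler01.
have M0 : 0 <= M by apply: le_trans (fM 0 0 I0 I0).
(* For points at least [d] apart in one coordinate, [A] times the squared distance already exceeds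
   the trivial bound [2 * M]. *)
pose A := 2 * M / d ^+ 2; have A0 : 0 <= A by apply: divr_ge0; [apply: mulr_ge0|exact: sqr_ge0].
pose n := Num.bound (4 * A / e).
have nA : A * n.+1%:R^-1 <= e / 4.
  rewrite ler_pdivrMr ?ltr0n//.
  have : 4 * A / e < n.+1%:R.
    have q0 : 0 <= 4 * A / e by apply: divr_ge0; [apply: mulr_ge0|exact: ltW].
    by apply: lt_trans (archi_boundP q0) _; rewrite ltr_nat.
  by rewrite ltr_pdivrMr//; lra.
exists (fun x y => \sum_(j < n.+2) \sum_(k < n.+2)
   f (j%:R / n.+1%:R) (k%:R / n.+1%:R) * (bern n.+1 j x * bern n.+1 k y)).
  apply: poly2_sum => j; apply: poly2_sum => k; apply: poly2M; first exact: poly2C.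
  have B (m : nat) r : poly2 r -> poly2 (fun x y => bern n.+1 m (r x y)).
    move=> pr; rewrite /bern; apply: poly2M; first by apply: poly2M; [exact: poly2C|exact: poly2_exp].
    apply: poly2_exp; under eq_fun => x do under eq_fun => y do rewrite -[r x y]mul1r -mulNr.
    by apply: poly2D; [exact: poly2C|apply: poly2M => //; exact: poly2C].
  by apply: poly2M; [apply: (B _ (fun x _ => x)); exact: poly2X|apply: (B _ (fun _ y => y)); exact: poly2Y].
move=> x y Ix Iy.
have Ik (k : 'I_n.+2) : unitI (k%:R / n.+1%:R).
  rewrite /unitI /= divr_ge0//= ler_pdivrMr ?ltr0n// mul1r ler_nat -ltnS; exact: ltn_ord.
have pw (j k : 'I_n.+2) : `|f x y - f (j%:R / n.+1%:R) (k%:R / n.+1%:R)| <=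
    e / 2 + A * (x - j%:R / n.+1%:R) ^+ 2 + A * (y - k%:R / n.+1%:R) ^+ 2.
  set s := _ / _; set t := _ / _.
  have Is : unitI s := Ik j; have It : unitI t := Ik k.
  have B1 : 0 <= A * (x - s) ^+ 2 by rewrite mulr_ge0// sqr_ge0.
  have B2 : 0 <= A * (y - t) ^+ 2 by rewrite mulr_ge0// sqr_ge0.
  have far (u : R) : d <= `|u| -> 2 * M <= A * u ^+ 2.
    move=> du; rewrite -[u ^+ 2](real_normK (num_real u)) /A -mulrA.
    rewrite ler_peMr ?mulr_ge0// mulrC ler_pdivlMr ?exprn_gt0// mul1r.
    by rewrite ler_sqr ?nnegrE// ltW.
  have tri : `|f x y - f s t| <= 2 * M.
    by apply: le_trans (ler_normB _ _) _; have := fM x y Ix Iy; have := fM s t Is It; lra.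
  have [xs|/far] := ltP `|x - s| d; last by lra.
  have [yt|/far] := ltP `|y - t| d; last by lra.
  by have := Hd x y s t Ix Iy Is It xs yt; lra.
have -> : f x y = \sum_(j < n.+2) \sum_(k < n.+2) f x y * (bern n.+1 j x * bern n.+1 k y).
  under eq_bigr => j _ do rewrite -mulr_sumr -mulr_sumr bern_sum mulr1.
  by rewrite -mulr_sumr bern_sum mulr1.
rewrite -sumrB; under eq_bigr => j _ do rewrite -sumrB.
apply: (@le_trans _ _ (\sum_(j < n.+2) \sum_(k < n.+2)
    (e / 2 + A * (x - j%:R / n.+1%:R) ^+ 2 + A * (y - k%:R / n.+1%:R) ^+ 2) *
    (bern n.+1 j x * bern n.+1 k y))).
  apply: le_trans (ler_norm_sum _ _ _) _; apply: ler_sum => j _.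
  apply: le_trans (ler_norm_sum _ _ _) _; apply: ler_sum => k _.
  have b0 : 0 <= bern n.+1 j x * bern n.+1 k y by rewrite mulr_ge0// bern_ge0.
  by rewrite -mulrBl normrM (ger0_norm b0) ler_wpM2r.
have inner j : \sum_(k < n.+2) (e / 2 + A * (x - j%:R / n.+1%:R) ^+ 2 + A * (y - k%:R / n.+1%:R) ^+ 2) *
    (bern n.+1 j x * bern n.+1 k y) =
    bern n.+1 j x * (e / 2 + A * (\sum_(k < n.+2) (y - k%:R / n.+1%:R) ^+ 2 * bern n.+1 k y)) +
    A * ((x - j%:R / n.+1%:R) ^+ 2 * bern n.+1 j x).
  transitivity ((bern n.+1 j x * (e / 2) + A * ((x - j%:R / n.+1%:R) ^+ 2 * bern n.+1 j x)) *
     (\sum_(k < n.+2) bern n.+1 k y) +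
     bern n.+1 j x * A * (\sum_(k < n.+2) (y - k%:R / n.+1%:R) ^+ 2 * bern n.+1 k y)).
    by rewrite !mulr_sumr -big_split/=; apply: eq_bigr => k _; ring.
  by rewrite bern_sum; ring.
under eq_bigr => j _ do rewrite inner.
rewrite big_split/= -mulr_suml -mulr_sumr bern_sum mul1r.
apply: le_trans (lerD (lerD (lexx (e / 2)) (ler_wpM2l A0 (bern_var_le n Iy)))
  (ler_wpM2l A0 (bern_var_le n Ix))) _.
by move: nA; move: (A / _) => q; clear; lra.
Qed.

End Bernstein.

(** * Expansion of plane polynomials in powers of [rho] times harmonic polynomials *)

Section HarmonicPolynomials.
Context {R : realType}.
Implicit Types (p q f : R -> R -> R) (x y : R).

(* [Cs n false] and [Cs n true] are the real and imaginary parts of [(x + i y) ^ n] *)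
Fixpoint Cs (n : nat) (b : bool) (x y : R) : R :=
  if n is m.+1 then
    if b then x * Cs m true x y + y * Cs m false x y
    else x * Cs m false x y - y * Cs m true x y
  else (~~ b)%:R.

Definition rho x y : R := x ^+ 2 + y ^+ 2.
Definition hp k n b x y : R := rho x y ^+ k * Cs n b x y.

(** The functions [rho^k Re z^n] and [rho^k Im z^n] span all polynomials ([poly2_tspan]), and the
    Poisson problem in a disc is explicit on each of them. *)
Inductive tspan : (R -> R -> R) -> Prop :=
| tspan0 : tspan (fun _ _ => 0)
| tspanA c k n b f : tspan f -> tspan (fun x y => c * hp k n b x y + f x y).

Lemma tspan_hp c k n b : tspan (fun x y => c * hp k n b x y).
Proof.
have := tspanA c k n b tspan0.
by under eq_fun => x do under eq_fun => y do rewrite addr0.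
Qed.

Lemma tspanD p q : tspan p -> tspan q -> tspan (fun x y => p x y + q x y).
Proof.
move=> tp tq; elim: {p} tp => [|c k n b f _ IH].
  by under eq_fun => x do under eq_fun => y do rewrite add0r.
by under eq_fun => x do under eq_fun => y do rewrite -addrA; exact: tspanA.
Qed.

Lemma tspanZ c p : tspan p -> tspan (fun x y => c * p x y).
Proof.
elim=> [|d k n b f _ IH].
  by under eq_fun => x do under eq_fun => y do rewrite mulr0; exact: tspan0.
by under eq_fun => x do under eq_fun => y do rewrite mulrDr mulrA; exact: tspanA.
Qed.

Lemma tspan_ext p q : (forall x y, p x y = q x y) -> tspan p -> tspan q.
Proof. by move=> E; rewrite (_ : p = q)//; apply/funext => x; apply/funext => y. Qed.

(** Since [x = (z + conj z) / 2] and [z * conj z = rho], multiplication by [x] turns [z^(n+1)] into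
    half the sum of [z^(n+2)] and [rho z^n]. The case of [y = (z - conj z) / (2 i)] below exchanges
    real and imaginary parts. *)
Lemma tspanX p : tspan p -> tspan (fun x y => x * p x y).
Proof.
elim=> [|c k n b f _ IH].
  by apply: tspan_ext tspan0 => x y; rewrite mulr0.
suff H : tspan (fun x y => x * hp k n b x y).
  by apply: tspan_ext (tspanD (tspanZ c H) IH) => x y; ring.
case: n b => [|n] [].
- by apply: tspan_ext tspan0 => x y; rewrite /hp /=; ring.
- by apply: tspan_ext (tspan_hp 1 k 1 false) => x y; rewrite /hp /=; ring.
- apply: tspan_ext (tspanD (tspan_hp 2^-1 k n.+2 true) (tspan_hp 2^-1 k.+1 n true)) => x y.
  by rewrite /hp /= exprS /rho; field.
- apply: tspan_ext (tspanD (tspan_hp 2^-1 k n.+2 false) (tspan_hp 2^-1 k.+1 n false)) => x y.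
  by rewrite /hp /= exprS /rho; field.
Qed.

Lemma tspanY p : tspan p -> tspan (fun x y => y * p x y).
Proof.
elim=> [|c k n b f _ IH].
  by apply: tspan_ext tspan0 => x y; rewrite mulr0.
suff H : tspan (fun x y => y * hp k n b x y).
  by apply: tspan_ext (tspanD (tspanZ c H) IH) => x y; ring.
case: n b => [|n] [].
- by apply: tspan_ext tspan0 => x y; rewrite /hp /=; ring.
- by apply: tspan_ext (tspan_hp 1 k 1 true) => x y; rewrite /hp /=; ring.
- apply: tspan_ext (tspanD (tspan_hp (- 2^-1) k n.+2 false) (tspan_hp 2^-1 k.+1 n false)) => x y.
  by rewrite /hp /= exprS /rho; field.
- apply: tspan_ext (tspanD (tspan_hp 2^-1 k n.+2 true) (tspan_hp (- 2^-1) k.+1 n true)) => x y.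
  by rewrite /hp /= exprS /rho; field.
Qed.

Lemma tspanM p q : poly2 p -> tspan q -> tspan (fun x y => p x y * q x y).
Proof.
move=> pp; elim: pp q => {p} [c||| p1 p2 _ IH1 _ IH2|p1 p2 _ IH1 _ IH2] q tq.
- exact: tspanZ.
- exact: tspanX.
- exact: tspanY.
- by apply: tspan_ext (tspanD (IH1 _ tq) (IH2 _ tq)) => x y; ring.
- by apply: tspan_ext (IH1 _ (IH2 _ tq)) => x y; ring.
Qed.

Lemma poly2_tspan p : poly2 p -> tspan p.
Proof.
by move=> /tspanM /(_ (tspan_hp 1 0 0 false)); apply: tspan_ext => x y; rewrite /hp /=; ring.
Qed.

End HarmonicPolynomials.

(** * Planar Laplacians pulled back by stereographic coordinates *)

Section PlanarCalculus.
Context {R : realType}.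
Local Notation V3 := 'rV[R]_3.
Implicit Types (p q : R -> R -> R).
Context (a b1 b2 : V3) (a1 : dotv a a = 1) (b11 : dotv b1 b1 = 1) (b22 : dotv b2 b2 = 1)
  (ab1 : dotv a b1 = 0) (ab2 : dotv a b2 = 0) (b12 : dotv b1 b2 = 0) (c1 c2 : R).

Definition zx (x : V3) : R := zc a b1 x - c1.
Definition zy (x : V3) : R := zc a b2 x - c2.
Definition pz p (x : V3) : R := p (zx x) (zy x).

(** [p1] and [p2] stand for the planar partial derivatives of [p], but only the chain rule after
    composition with the coordinates is recorded, so no differentiation in two variables is
    needed. *)
Definition PD p p1 p2 := forall (x : V3) i, dom a x -> is_derive x (ee i) (pz p)
  (pz p1 x * zg a b1 i x + pz p2 x * zg a b2 i x).

Lemma PD_C c : PD (fun _ _ => c) (fun _ _ => 0) (fun _ _ => 0).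
Proof. by move=> x i Dx; rewrite /pz !mul0r addr0; exact: dvC. Qed.

Lemma PD_X : PD (fun x _ => x) (fun _ _ => 1) (fun _ _ => 0).
Proof.
move=> x i Dx; rewrite /pz mul1r mul0r addr0 -[X in is_derive _ _ _ X]subr0.
exact: dvB (dv_zc b1 i Dx) (dvC c1 x (ee i)).
Qed.

Lemma PD_Y : PD (fun _ y => y) (fun _ _ => 0) (fun _ _ => 1).
Proof.
move=> x i Dx; rewrite /pz mul1r mul0r add0r -[X in is_derive _ _ _ X]subr0.
exact: dvB (dv_zc b2 i Dx) (dvC c2 x (ee i)).
Qed.

Lemma PD_D p p1 p2 q q1 q2 : PD p p1 p2 -> PD q q1 q2 ->
  PD (fun x y => p x y + q x y) (fun x y => p1 x y + q1 x y) (fun x y => p2 x y + q2 x y).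
Proof.
move=> H1 H2 x i Dx; apply: is_derive_eq (dvD (H1 x i Dx) (H2 x i Dx)) _.
by rewrite /pz; ring.
Qed.

Lemma PD_M p p1 p2 q q1 q2 : PD p p1 p2 -> PD q q1 q2 ->
  PD (fun x y => p x y * q x y) (fun x y => p x y * q1 x y + q x y * p1 x y)
     (fun x y => p x y * q2 x y + q x y * p2 x y).
Proof.
move=> H1 H2 x i Dx; apply: is_derive_eq (dvM (H1 x i Dx) (H2 x i Dx)) _.
by rewrite /pz; ring.
Qed.

Lemma PD_ext p p1 p2 q q1 q2 : (forall x y, p x y = q x y) -> (forall x y, p1 x y = q1 x y) ->
  (forall x y, p2 x y = q2 x y) -> PD p p1 p2 -> PD q q1 q2.
Proof.
move=> E E1 E2; have -> : p = q by apply/funext => x; apply/funext => y.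
have -> : p1 = q1 by apply/funext => x; apply/funext => y.
by have -> : p2 = q2 by apply/funext => x; apply/funext => y.
Qed.

Lemma PD_Z c p p1 p2 : PD p p1 p2 ->
  PD (fun x y => c * p x y) (fun x y => c * p1 x y) (fun x y => c * p2 x y).
Proof. by move=> H; apply: PD_ext (PD_M (PD_C c) H) => x y //; ring. Qed.

(** The complex rules [d/dx z^n = n z^(n-1)] and [d/dy z^n = i n z^(n-1)], split into real and
    imaginary parts. At [n = 0] the index [n.-1] is harmless because of the factor [n]. *)
Lemma PD_Cs n b : PD (Cs n b) (fun x y => n%:R * Cs n.-1 b x y)
  (fun x y => if b then n%:R * Cs n.-1 false x y else - (n%:R * Cs n.-1 true x y)).
Proof.
elim: n b => [|n IH] b.
  by apply: PD_ext (PD_C (~~ b)%:R) => x y /=; rewrite ?mul0r//; case: b; rewrite ?oppr0.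
have E (c : bool) : (forall x y, n%:R * Cs n c x y =
    if c then n%:R * (x * Cs n.-1 true x y + y * Cs n.-1 false x y)
    else n%:R * (x * Cs n.-1 false x y - y * Cs n.-1 true x y) :> R).
  by case: n {IH} => [|n] x y; rewrite ?mul0r; case: c => //; rewrite mul0r.
case: b.
- apply: PD_ext (PD_D (PD_M PD_X (IH true)) (PD_M PD_Y (IH false))) => x y //=.
    by rewrite -natr1 mulrDl E; ring.
  by rewrite -natr1 mulrDl E; ring.
- apply: PD_ext (PD_D (PD_M PD_X (IH false)) (PD_Z (-1) (PD_M PD_Y (IH true)))) => x y //=.
  + by ring.
  + by rewrite -natr1 mulrDl E; ring.
  + by rewrite -natr1 mulrDl E; ring.
Qed.

(** [L] is the planar Laplacian of [p]. The mixed derivatives are recorded because the chain rule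
    produces them; they drop out only after summation, by orthogonality of the coordinate
    gradients. *)
Definition PL p L := exists p1 p2 p11 p12 p21 p22, [/\ PD p p1 p2, PD p1 p11 p12, PD p2 p21 p22 &
  forall x y, L x y = p11 x y + p22 x y].

Lemma PL_D p q L M : PL p L -> PL q M ->
  PL (fun x y => p x y + q x y) (fun x y => L x y + M x y).
Proof.
move=> [p1 [p2 [p11 [p12 [p21 [p22 [H1 H2 H3 H4]]]]]]] [q1 [q2 [q11 [q12 [q21 [q22 [K1 K2 K3 K4]]]]]]].
do 6!eexists; split; [exact: PD_D H1 K1|exact: PD_D H2 K2|exact: PD_D H3 K3|].
by move=> x y /=; rewrite H4 K4; ring.
Qed.

Lemma PL_Z c p L : PL p L -> PL (fun x y => c * p x y) (fun x y => c * L x y).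
Proof.
move=> [p1 [p2 [p11 [p12 [p21 [p22 [H1 H2 H3 H4]]]]]]].
do 6!eexists; split; [exact: PD_Z H1|exact: PD_Z H2|exact: PD_Z H3|].
by move=> x y /=; rewrite H4; ring.
Qed.

Lemma PL_C c : PL (fun _ _ => c) (fun _ _ => 0).
Proof. by do 6!eexists; split; [exact: PD_C|exact: PD_C|exact: PD_C|] => x y /=; rewrite addr0. Qed.

Lemma PL_ext p q L M : (forall x y, p x y = q x y) -> (forall x y, L x y = M x y) -> PL p L -> PL q M.
Proof.
move=> E E1; have -> : p = q by apply/funext => x; apply/funext => y.
by have -> : L = M by apply/funext => x; apply/funext => y.
Qed.

(** Induction on [k] through [lap (rho p) = 4 p + 4 (x p_x + y p_y) + rho lap p]. The middle term
    forces Euler's relation for the degree [2 k + n] into the induction hypothesis. *)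
Lemma PL_hp k n b : PL (hp k n b) (fun x y => 4 * k%:R * (k + n)%:R * hp k.-1 n b x y).
Proof.
suff [p1 [p2 [p11 [p12 [p21 [p22 [H1 H2 H3 H4 _]]]]]]] : exists p1 p2 p11 p12 p21 p22,
   [/\ PD (hp k n b) p1 p2, PD p1 p11 p12, PD p2 p21 p22,
   forall x y, 4 * k%:R * (k + n)%:R * hp k.-1 n b x y = p11 x y + p22 x y &
   forall x y, x * p1 x y + y * p2 x y = (2 * k%:R + n%:R) * hp k n b x y].
  by do 6!eexists; split; [exact: H1|exact: H2|exact: H3|].
elim: k => [|k [p1 [p2 [p11 [p12 [p21 [p22 [H1 H2 H3 H4 H5]]]]]]]].
  have D1 := PD_Cs n b.
  have D2 : PD (fun x y => n%:R * Cs n.-1 b x y) (fun x y => n%:R * (n.-1%:R * Cs n.-2 b x y))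
     (fun x y => n%:R * (if b then n.-1%:R * Cs n.-2 false x y else - (n.-1%:R * Cs n.-2 true x y))).
    exact: PD_Z (PD_Cs n.-1 b).
  have D3 : PD (fun x y => if b then n%:R * Cs n.-1 false x y else - (n%:R * Cs n.-1 true x y))
     (fun x y => if b then n%:R * (n.-1%:R * Cs n.-2 false x y) else - n%:R * (n.-1%:R * Cs n.-2 true x y))
     (fun x y => if b then n%:R * - (n.-1%:R * Cs n.-2 true x y) else - n%:R * (n.-1%:R * Cs n.-2 false x y)).
    case: {D1 D2} b; first exact: PD_Z (PD_Cs n.-1 false).
    by apply: PD_ext (PD_Z (- n%:R) (PD_Cs n.-1 true)) => x y //; rewrite mulNr.
  exists (fun x y => n%:R * Cs n.-1 b x y), (fun x y => if b then n%:R * Cs n.-1 false x y else - (n%:R * Cs n.-1 true x y)).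
  do 4!eexists; split; [|exact: D2|exact: D3| |].
  - by apply: PD_ext D1 => x y //; rewrite /hp expr0 mul1r.
  - by move=> x y /=; rewrite mulr0 !mul0r; case: b {D1 D2 D3} => /=; ring.
  - move=> x y; rewrite /hp expr0 mul1r; case: n {D1 D2 D3} => [|n]; first by rewrite !mul0r; case: b => /=; ring.
    by case: b => /=; ring.
have Dr : PD rho (fun x _ => 2 * x) (fun _ y => 2 * y).
  by apply: PD_ext (PD_D (PD_M PD_X PD_X) (PD_M PD_Y PD_Y)) => x y; rewrite /rho; ring.
exists (fun x y => 2 * x * hp k n b x y + rho x y * p1 x y).
exists (fun x y => 2 * y * hp k n b x y + rho x y * p2 x y).
do 4!eexists; split.
- by apply: PD_ext (PD_M Dr H1) => x y; rewrite /hp ?exprS; ring.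
- exact: PD_D (PD_M (PD_Z 2 PD_X) H1) (PD_M Dr H2).
- exact: PD_D (PD_M (PD_Z 2 PD_Y) H1) (PD_M Dr H3).
- move=> x y /=.
  have E : 4 * k.+1%:R * (k.+1 + n)%:R * hp k n b x y = 4 * hp k n b x y +
     4 * (x * p1 x y + y * p2 x y) + rho x y * (4 * k%:R * (k + n)%:R * hp k.-1 n b x y).
    rewrite H5 -natr1 !natrD; case: k {H1 H2 H3 H4 H5} => [|k]; first by rewrite /=; ring.
    by rewrite /hp /= exprS -!natr1; ring.
  by rewrite E H4; ring.
- move=> x y; rewrite mulrDr.
  transitivity (2 * rho x y * hp k n b x y + rho x y * (x * p1 x y + y * p2 x y)).
    by rewrite /rho; ring.
  by rewrite H5 /hp exprS -natr1; ring.
Qed.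

Lemma has_lap_pz p L : PL p L -> has_lap (dom a) (pz p) (fun x => pz L x / den a x ^+ 2).
Proof.
move=> [p1 [p2 [p11 [p12 [p21 [p22 [H1 H2 H3 H4]]]]]]].
exists (fun i x => pz p1 x * zg a b1 i x + pz p2 x * zg a b2 i x).
exists (fun i x => pz p1 x * zh a b1 i x + zg a b1 i x * (pz p11 x * zg a b1 i x + pz p12 x * zg a b2 i x) +
   (pz p2 x * zh a b2 i x + zg a b2 i x * (pz p21 x * zg a b1 i x + pz p22 x * zg a b2 i x))) => x Dx.
split=> [i|].
  split; first exact: H1.
  exact: dvD (dvM (H2 x i Dx) (dv_zg b1 i Dx)) (dvM (H3 x i Dx) (dv_zg b2 i Dx)).
transitivity (pz p1 x * (\sum_i zh a b1 i x) + pz p2 x * (\sum_i zh a b2 i x) +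
  pz p11 x * (\sum_i zg a b1 i x * zg a b1 i x) + (pz p12 x + pz p21 x) * (\sum_i zg a b1 i x * zg a b2 i x) +
  pz p22 x * (\sum_i zg a b2 i x * zg a b2 i x)).
  rewrite !zh_sum// !zg_sum// b11 b22 b12 /pz H4.
  by rewrite mul0r !mulr0 !addr0 add0r mul1r mulrDl.
by rewrite !mulr_sumr -!big_split/=; apply: eq_bigr => i _; ring.
Qed.

End PlanarCalculus.

(** * Subsolutions on the sphere *)

Section WithinContinuity.
Context {R : realType}.
Local Notation V3 := 'rV[R]_3.

Lemma withinP (K : set V3) (f : V3 -> R) : {within K, continuous f} <->
  forall x, K x -> forall e : R, 0 < e -> exists2 d : R, 0 < d &
    forall y, K y -> `|y - x| < d -> `|f y - f x| <= e.
Proof.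
rewrite subspace_continuousP; split=> H x Kx.
  move=> e e0; have /cvgrPdist_le/(_ _ e0) := H x Kx; rewrite near_withinE.
  move=> /nbhs_ballP[d /= d0 Hd]; exists d => // y Ky yx.
  by rewrite distrC; apply: Hd => //; rewrite -ball_normE /= distrC.
apply/cvgrPdist_le => e e0; have [d d0 Hd] := H x Kx e e0.
rewrite near_withinE; apply/nbhs_ballP; exists d => //= y.
by rewrite -ball_normE /= distrC => yx Ky; rewrite distrC; exact: Hd.
Qed.

Lemma within_sub (K K' : set V3) (f : V3 -> R) : K' `<=` K ->
  {within K, continuous f} -> {within K', continuous f}.
Proof.
move=> sK /withinP H; apply/withinP => x /sK Kx e e0.
by have [d d0 Hd] := H x Kx e e0; exists d => // y /sK; exact: Hd.
Qed.

Lemma within_ctn (K : set V3) (f : V3 -> R) : (forall x, K x -> ctn f x) ->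
  {within K, continuous f}.
Proof. by move=> cf; apply/continuous_in_subspaceT => x; rewrite inE => /cf. Qed.

Lemma withinD (K : set V3) (f g : V3 -> R) : {within K, continuous f} ->
  {within K, continuous g} -> {within K, continuous (fun x => f x + g x)}.
Proof.
move=> cf cg x; have c1 : ctn (f : subspace K -> R) x := cf x.
by have c2 : ctn (g : subspace K -> R) x := cg x; exact: (ctnD c1 c2).
Qed.

Lemma withinM (K : set V3) (f g : V3 -> R) : {within K, continuous f} ->
  {within K, continuous g} -> {within K, continuous (fun x => f x * g x)}.
Proof.
move=> cf cg x; have c1 : ctn (f : subspace K -> R) x := cf x.
by have c2 : ctn (g : subspace K -> R) x := cg x; exact: (ctnM c1 c2).
Qed.

Lemma withinB (K : set V3) (f g : V3 -> R) : {within K, continuous f} ->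
  {within K, continuous g} -> {within K, continuous (fun x => f x - g x)}.
Proof.
move=> cf cg x; have c1 : ctn (f : subspace K -> R) x := cf x.
by have c2 : ctn (g : subspace K -> R) x := cg x; exact: (ctnB c1 c2).
Qed.

Lemma heine_cantor (T : pseudoMetricType R) (K : set T) (f : T -> R) : compact K ->
  {within K, continuous f} -> forall e : R, 0 < e -> exists2 d : R, 0 < d &
    forall x y, K x -> K y -> ball x d y -> `|f x - f y| <= e.
Proof.
move=> /compact_near_coveringP cK cf e e0.
have e20 : 0 < e / 2 by rewrite divr_gt0.
have := cK R (0^'+) (fun d x => forall y, K x -> K y -> ball x d y -> `|f x - f y| <= e) _.
move=> /(_ _) H.
have : \forall d \near 0^'+, K `<=` (fun x => forall y, K x -> K y -> ball x d y -> `|f x - f y| <= e).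
  apply: H => x Kx.
  have := cf x; rewrite /continuous_at/=.
  move/subspace_continuousP : cf => /(_ x Kx)/cvgrPdist_le/(_ _ e20).
  rewrite near_withinE => /nbhs_ballP[r /= r0 Hr] _.
  have r20 : 0 < r / 2 by rewrite divr_gt0.
  exists (ball x (r / 2), [set d : R | d < r / 2]); first split => /=.
  - exact: nbhsx_ballx.
  - exact: nbhs_right_lt.
  - move=> [z d] [/= xz dr] y Kz Ky zy.
    have xz' : ball x r z by apply: le_ball xz; lra.
    have xy : ball x r y.
      by rewrite (splitr r); apply: ball_triangle xz _; apply: le_ball zy; exact: ltW.
    have := Hr _ xz' Kz; have := Hr _ xy Ky.
    rewrite (_ : f z - f y = (f x - f y) - (f x - f z)); last by ring.
    by move=> h1 h2; apply: le_trans (ler_normB _ _) _; lra.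
move=> /filterI /(_ (nbhs_right_gt 0)) /filter_ex[d [/= dK d0]].
by exists d => // x y Kx Ky; exact: dK.
Qed.

End WithinContinuity.

Section Sphere.
Context {R : realType}.
Local Notation V3 := 'rV[R]_3.
Implicit Types (x y : V3) (u v H L f : V3 -> R) (K I O G : set V3).

Lemma sphere_enorm x : sphere R x -> enorm x = 1. Proof. by []. Qed.

Lemma proj_sphere x : x != 0 -> sphere R (sphere_proj x).
Proof.
rewrite -enorm_gt0 => x0; rewrite /sphere /= /sphere_proj enormZ gtr0_norm ?invr_gt0//.
by rewrite mulVf// gt_eqF.
Qed.

Lemma proj_id x : sphere R x -> sphere_proj x = x.
Proof. by move=> Sx; rewrite /sphere_proj sphere_enorm// invr1 scale1r. Qed.

Lemma projZ (k : R) x : 0 < k -> sphere_proj (k *: x) = sphere_proj x.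
Proof.
move=> k0; rewrite /sphere_proj enormZ gtr0_norm// invfM scalerA.
by rewrite -mulrA mulrCA mulVf ?gt_eqF// mulr1.
Qed.

Lemma proj_proj x : sphere_proj (sphere_proj x) = sphere_proj x.
Proof.
have [->|x0] := eqVneq x 0; first by rewrite /sphere_proj !scaler0.
by rewrite proj_id//; exact: proj_sphere.
Qed.

Lemma sphere_neq0 x : sphere R x -> x != 0.
Proof. by move=> Sx; rewrite -enorm_gt0 sphere_enorm. Qed.

Lemma ctn_scale_vec {T : topologicalType} (k : T -> R) (f : T -> V3) t :
  ctn k t -> ctn f t -> ctn (fun s => k s *: f s) t.
Proof. exact: ctnZ. Qed.

Lemma ctn_proj x : x != 0 -> ctn (@sphere_proj R) x.
Proof.
move=> x0; apply: ctn_scale_vec; last by ctac.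
apply: ctnV; first by rewrite gt_eqF// enorm_gt0.
by apply: ctn_enorm; ctac.
Qed.

Lemma near_proj x (P : set V3) : x != 0 -> (\forall y \near sphere_proj x, P y) ->
  \forall y \near x, P (sphere_proj y).
Proof. by move=> x0 nP; exact: (ctn_proj x0). Qed.

(* Subsolutions of [beltrami v >= H] on [G] in the viscosity sense, tested on the
   extension of [v] that is constant along rays *)
Definition subsol G H v := forall x0, G x0 -> forall O phi L, open O -> O x0 ->
  has_lap O phi L ->
  (forall x, O x -> v (sphere_proj x) - phi x <= v (sphere_proj x0) - phi x0) ->
  H x0 <= L x0.

(** At a point where the test function touches from above, the difference has a local maximum, so
    its Laplacian is nonpositive. *)
Lemma lap_subsol G O H u L : open O -> G `<=` O ->
  has_lap O (u \o @sphere_proj R) L -> (forall x, G x -> H x <= L x) -> subsol G H u.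
Proof.
move=> oO GO uL HL x0 Gx0 O' phi L' oO' Ox0 pL umax; apply: (le_trans (HL _ Gx0)).
rewrite -subr_le0; have oI : open (O `&` O') by exact: openI.
have L1 : has_lap (O `&` O') (fun x => (u \o @sphere_proj R) x - phi x) (fun x => L x - L' x).
  by apply: has_lapB; [apply: has_lap_sub uL => y []|apply: has_lap_sub pL => y []].
apply: (has_lap_max oI (conj (GO _ Gx0) Ox0) L1).
by apply: filterS (open_nbhs_nbhs (conj oI (conj (GO _ Gx0) Ox0))) => y [_ Oy]; exact: umax.
Qed.

(** At an interior maximum of [v - phi], the function [phi] is itself an admissible test function
    for [v], so [H <= L] there, against [L < H]. Constancy of [phi] along rays turns a maximum on
    the sphere into one in space. *)
Lemma sph_comparison K I O v H phi L (m : R) : compact K -> I `<=` K -> K `<=` sphere R ->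
  (forall c, I c -> \forall x \near c, K (sphere_proj x)) ->
  subsol I H v -> open O -> I `<=` O -> (forall x, O x -> phi (sphere_proj x) = phi x) ->
  has_lap O phi L -> (forall x, I x -> L x < H x) ->
  {within K, continuous v} -> {within K, continuous phi} ->
  (forall x, K x -> ~ I x -> v x <= phi x + m) -> forall x, K x -> v x <= phi x + m.
Proof.
move=> cK IK KS In sv oO IO hphi pL LH cv cphi bd x Kx.
have [c + cmax] := compact_EVT_max (ex_intro _ x Kx) cK (withinB cv cphi).
rewrite inE => Kc; have := cmax x; rewrite inE => /(_ Kx) xc.
suff : v c <= phi c + m by lra.
have [Ic|] := pselect (I c); last exact: bd.
exfalso; have /nbhs_ballP[d /= d0 Hd] := In c Ic.
have := sv c Ic (O `&` ball c d) phi L.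
have oB : open (ball c d) by exact: ball_open.
move=> /(_ (openI oO oB) (conj (IO _ Ic) (ballxx _ d0))).
move=> /(_ (has_lap_sub (@subIsetl _ _ _) pL)) h.
suff : H c <= L c by rewrite leNgt LH.
apply: h => y [Oy cy]; rewrite -(hphi y Oy) (proj_id (KS _ Kc)).
by apply: cmax; rewrite inE; exact: Hd.
Qed.

Lemma subsol_sub G G' H v : G' `<=` G -> subsol G H v -> subsol G' H v.
Proof. by move=> sG sv x0 /sG; exact: sv. Qed.

Lemma subsol_max G H u v : subsol G H u -> subsol G H v ->
  subsol G H (fun x => Num.max (u x) (v x)).
Proof.
move=> su sv x0 Gx0 O phi L oO Ox0 pL mx.
have [uv|uv] := leP (u (sphere_proj x0)) (v (sphere_proj x0)).
  apply: (sv x0 Gx0 O phi L) => // x Ox; apply: le_trans (le_trans (mx x Ox) _).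
    by rewrite lerB// le_max lexx orbT.
  by rewrite max_r.
apply: (su x0 Gx0 O phi L) => // x Ox; apply: le_trans (le_trans (mx x Ox) _).
  by rewrite lerB// le_max lexx.
by rewrite max_l// ltW.
Qed.

End Sphere.

(** * The Dirichlet problem on a spherical cap *)

Section Archimedean.
Context {R : realType}.

Lemma arch_small (C e : R) : 0 <= C -> 0 < e -> exists n, C * n.+1%:R^-1 <= e.
Proof.
move=> C0 e0; exists (Num.bound (C / e)); rewrite ler_pdivrMr ?ltr0n//.
have : C / e < (Num.bound (C / e)).+1%:R.
  by apply: lt_trans (archi_boundP _) _; [apply: divr_ge0 => //; exact: ltW|rewrite ltr_nat].
by rewrite ltr_pdivrMr// mulrC => /ltW.
Qed.

Lemma le_small (a b C : R) : 0 <= C -> (forall n, a <= b + C * n.+1%:R^-1) -> a <= b.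
Proof.
move=> C0 H; apply/ler_addgt0Pr => e e0; have [n ne] := arch_small C0 e0.
by apply: le_trans (H n) _; rewrite lerD2l.
Qed.

(** The limit is the supremum of the lower bounds [a n - C / (n + 1)]; each [a m + C / (m + 1)]
    bounds them all from above, which gives the explicit rate. *)
Lemma real_cauchy (a : nat -> R) (C : R) :
  (forall m n, a m <= a n + C * (m.+1%:R^-1 + n.+1%:R^-1)) ->
  exists l, forall n, `|l - a n| <= C * n.+1%:R^-1.
Proof.
move=> H; pose E := [set a n - C * n.+1%:R^-1 | n in [set: nat]].
have Eub n : ubound E (a n + C * n.+1%:R^-1).
  by move=> _ [m _ <-]; rewrite lerBlDr -addrA -mulrDr [_ + m.+1%:R^-1]addrC.
have E0 : E !=set0 by exists (a 0 - C * 1%:R^-1), 0%N.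
exists (sup E) => n; rewrite ler_norml; apply/andP; split.
  rewrite lerBrDr addrC.
  by apply: ub_le_sup; [exists (a 0 + C * 1%:R^-1); exact: Eub|exists n].
by rewrite lerBlDr addrC; exact: ge_sup.
Qed.

End Archimedean.

Section Lens.
Context {R : realType}.
Local Notation V3 := 'rV[R]_3.
Context (a b1 b2 : V3) (a1 : dotv a a = 1) (b11 : dotv b1 b1 = 1) (b22 : dotv b2 b2 = 1)
  (ab1 : dotv a b1 = 0) (ab2 : dotv a b2 = 0) (b12 : dotv b1 b2 = 0)
  (basis : forall x : V3, x = dotv x a *: a + dotv x b1 *: b1 + dotv x b2 *: b2).
Context (c1 c2 rr : R) (rr0 : 0 < rr).
Let q := rr ^+ 2.
Local Notation aden := (den a).
Local Notation adom := (dom a).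
Local Notation azx := (zx a b1 c1).
Local Notation azy := (zy a b2 c2).
Local Notation apz := (pz a b1 b2 c1 c2).

Definition zr (x : V3) : R := rho (azx x) (azy x).
Definition lensK := [set x : V3 | [/\ sphere R x, adom x & zr x <= q]].
(** The open cone over the cap, cut off at [1 / 2 < |x|] so that the factor [1 / |x|^2] of the
    equation in space stays bounded. *)
Definition lensO := [set x : V3 | [/\ adom x, zr x < q & 1 / 2 < enorm x]].
Definition lensI := [set x : V3 | lensK x /\ zr x < q].

(* Inverse of the stereographic projection from [- a] *)
Definition sig (s t : R) : V3 :=
  (1 + s ^+ 2 + t ^+ 2)^-1 *: ((2 * s) *: b1 + (2 * t) *: b2 + (1 - s ^+ 2 - t ^+ 2) *: a).

Lemma parseval (x : V3) : dotv x x = dotv x a ^+ 2 + dotv x b1 ^+ 2 + dotv x b2 ^+ 2.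
Proof.
by rewrite {1}[x]basis !dotvDl !dotvZl (dotvC a x) (dotvC b1 x) (dotvC b2 x) !expr2.
Qed.

Lemma zc_sphere (x : V3) : sphere R x -> adom x ->
  zc a b1 x ^+ 2 + zc a b2 x ^+ 2 = 2 / aden x - 1.
Proof.
move=> Sx Dx; have D0 : aden x != 0 by rewrite gt_eqF.
have := parseval x; rewrite -enorm_sq sphere_enorm// expr1n /zc => P.
have E : dotv x b1 ^+ 2 + dotv x b2 ^+ 2 = 1 - (aden x - 1) ^+ 2.
  by rewrite {1}P /den sphere_enorm//; ring.
rewrite !expr_div_n -mulrDl E; field; exact: D0.
Qed.

Lemma sig_zc (x : V3) : sphere R x -> adom x -> sig (zc a b1 x) (zc a b2 x) = x.
Proof.
move=> Sx Dx; have D0 : aden x != 0 by rewrite gt_eqF.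
have E := zc_sphere Sx Dx; rewrite /sig.
have -> : 1 + zc a b1 x ^+ 2 + zc a b2 x ^+ 2 = 2 / aden x by rewrite -addrA E; ring.
have -> : 1 - zc a b1 x ^+ 2 - zc a b2 x ^+ 2 = 2 - 2 / aden x by rewrite -addrA -opprD E; ring.
have dE : dotv x a = aden x - 1 by rewrite /den sphere_enorm//; ring.
transitivity (dotv x a *: a + dotv x b1 *: b1 + dotv x b2 *: b2); last by rewrite -basis.
by apply/rowP => k; rewrite !mxE dE /zc; field; exact: D0.
Qed.

Lemma ctn_sig {T : topologicalType} (s t : T -> R) (p : T) :
  ctn s p -> ctn t p -> ctn (fun u => sig (s u) (t u)) p.
Proof.
move=> f1 f2; rewrite /sig; ctac; rewrite gt_eqF//.
by have := sqr_ge0 (s p); have := sqr_ge0 (t p); lra.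
Qed.

Lemma poly2_comp p r s : poly2 p -> poly2 r -> poly2 s ->
  poly2 (fun x y : R => p (r x y) (s x y)).
Proof.
move=> pp pr ps; elim: pp => {p} [c||| p1 p2 _ IH1 _ IH2|p1 p2 _ IH1 _ IH2] //.
- exact: poly2C.
- exact: poly2D.
- exact: poly2M.
Qed.

(** The function is read on the whole square circumscribed to the disc of the cap, because Bernstein
    approximation lives on a square; hence the hypothesis that [sig] maps this square into [G0]. *)
Lemma lens_approx (G0 : set V3) (g : V3 -> R) : {within G0, continuous g} ->
  (forall s t, `|s - c1| <= rr -> `|t - c2| <= rr -> G0 (sig s t)) ->
  forall e : R, 0 < e -> exists2 p, poly2 p & forall x, lensK x -> `|g x - apz p x| <= e.
Proof.
move=> /withinP cg sG e e0.
pose al (c s : R) := c + rr * (2 * s - 1).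
pose S (p : R * R) := sig (al c1 p.1) (al c2 p.2).
have cS : continuous S.
  move=> p; change (ctn (fun p : R * R => sig (al c1 p.1) (al c2 p.2)) p).
  apply: ctn_sig; rewrite /al.
    by have f1 : ctn (fun p : R * R => p.1) p; [exact: cvg_fst|ctac].
  by have f2 : ctn (fun p : R * R => p.2) p; [exact: cvg_snd|ctac].
pose Q : set (R * R) := [set p | unitI p.1 /\ unitI p.2].
have cI : compact (@unitI R).
  rewrite (_ : unitI = `[0, 1]%classic); first exact: segment_compact.
  by apply/seteqP; split => x; rewrite /= in_itv.
have cQ : compact Q.
  rewrite (_ : Q = unitI `*` unitI); first exact: compact_setX.
  by apply/seteqP; split => -[x y].
have SQ p : Q p -> G0 (S p).
  have U (s : R) : unitI s -> `|2 * s - 1| <= 1 by move=> /andP[s0 s1]; rewrite ler_norml; lra.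
  move=> [/U h1 /U h2]; apply: sG; rewrite /al addrC addKr normrM (gtr0_norm rr0) ger_pMr//.
pose F p := g (S p).
have cF : {within Q, continuous F}.
  apply/subspace_continuousP => p Qp; apply/cvgrPdist_le => e1 e10.
  have [d d0 Hd] := cg _ (SQ _ Qp) e1 e10.
  have := cS p => /cvgrPdist_lt /(_ _ d0) nd; rewrite near_withinE.
  apply: filterS nd => p' Sp' Qp'; rewrite distrC; apply: Hd; first exact: SQ.
  by rewrite distrC.
have [M FM] : exists M, forall p, Q p -> `|F p| <= M.
  have Q0 : Q !=set0 by exists (0, 0); split; rewrite /= /unitI /= lexx ler01.
  have [u _ umax] := compact_EVT_max Q0 cQ cF.
  have [l _ lmin] := compact_EVT_min Q0 cQ cF.
  exists (`|F u| + `|F l|) => p Qp.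
  have := umax p; have := lmin p; rewrite !inE => /(_ Qp) h1 /(_ Qp) h2.
  rewrite ler_norml; have := ler_norm (F u); have := ler_norm (- F l); rewrite normrN.
  by have := normr_ge0 (F u); have := normr_ge0 (F l); lra.
have [] := @weierstrass2 R (fun s t => F (s, t)) M _ _ e e0.
- by move=> x y Ix Iy; exact: FM.
- move=> e1 e10; have [d d0 Hd] := heine_cantor cQ cF e10.
  by exists d => // x y x' y' Ix Iy Ix' Iy' xx yy; exact: (Hd (x, y) (x', y')).
move=> p pp Hp.
exists (fun x y => p (2^-1 * (rr^-1 * x) + 2^-1) (2^-1 * (rr^-1 * y) + 2^-1)).
  by apply: poly2_comp => //; apply: poly2D; try exact: poly2C; apply: poly2M; try exact: poly2C;
     apply: poly2M; try exact: poly2C; [exact: poly2X|exact: poly2Y].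
move=> x [Sx Dx zq]; rewrite /pz.
have zb (u v : R) : u ^+ 2 + v ^+ 2 <= q -> unitI (2^-1 * (rr^-1 * u) + 2^-1).
  move=> uv; have ur : `|u| <= rr.
    rewrite -ler_sqr ?nnegrE ?(ltW rr0)// real_normK ?num_real//.
    by apply: le_trans uv; rewrite lerDl sqr_ge0.
  have {ur} : `|rr^-1 * u| <= 1.
    by rewrite normrM normfV (gtr0_norm rr0) mulrC ler_pdivrMr// mul1r.
  by rewrite ler_norml /unitI /= => /andP[h1 h2]; apply/andP; split; lra.
have I1 := zb _ _ zq; have I2 := zb (azy x) (azx x); rewrite addrC in I2; have {}I2 := I2 zq.
have := Hp _ _ I1 I2; rewrite /F /S.
have al1 c u : al c (2^-1 * (rr^-1 * u) + 2^-1) = c + u.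
  by rewrite /al; field; rewrite gt_eqF.
by rewrite /= !al1 /zx /zy !(addrC _ (_ - _)) !subrK sig_zc.
Qed.

Lemma ctn_zc b x : adom x -> ctn (zc a b) x.
Proof.
move=> Dx; apply: ctnM; first by apply: ctn_dotv; ctac.
by apply: ctnV; [rewrite gt_eqF|exact: ctn_den].
Qed.

Lemma ctn_zx x : adom x -> ctn azx x.
Proof. by move=> Dx; have h := @ctn_zc b1 x Dx; rewrite /zx; ctac. Qed.

Lemma ctn_zy x : adom x -> ctn azy x.
Proof. by move=> Dx; have h := @ctn_zc b2 x Dx; rewrite /zy; ctac. Qed.

Lemma ctn_zr x : adom x -> ctn zr x.
Proof.
by move=> Dx; have h1 := ctn_zx Dx; have h2 := ctn_zy Dx; rewrite /zr /rho; ctac.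
Qed.

Lemma ctn_Cs n b x : adom x -> ctn (apz (Cs n b)) x.
Proof.
move=> Dx; have h1 := ctn_zx Dx; have h2 := ctn_zy Dx; rewrite /pz.
elim: n b => [|n IH] b; first exact: ctnC.
by have k1 := IH true; have k2 := IH false; case: b => /=; ctac.
Qed.

Lemma ctn_hp k n b x : adom x -> ctn (apz (hp k n b)) x.
Proof.
move=> Dx; have h1 : ctn (fun y => rho (azx y) (azy y)) x := ctn_zr Dx.
by have h2 := @ctn_Cs n b x Dx; rewrite /pz /hp in h2 *; ctac.
Qed.

(* On the disc, [rho^k C_n] is the Laplacian of [(rho^(k+1) - q^(k+1)) C_n / (4 (k+1) (k+1+n))],
   and on its boundary circle it agrees with the harmonic [q^k C_n]. *)
Lemma solve_tspan (f g : R -> R -> R) : tspan f -> tspan g -> exists u, [/\ PL a b1 b2 c1 c2 u f,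
  forall x y, rho x y = q -> u x y = g x y & forall x, adom x -> ctn (apz u) x].
Proof.
move=> tf tg.
have [u1 [h1 h2 h3]] : exists u, [/\ PL a b1 b2 c1 c2 u f,
    forall x y, rho x y = q -> u x y = 0 & forall x, adom x -> ctn (apz u) x].
  elim: tf => [|c k n b f' _ [u [h1 h2 h3]]].
    by exists (fun _ _ => 0); split => // [|x _]; [exact: PL_C|exact: ctnC].
  pose m : R := 4 * k.+1%:R * (k.+1 + n)%:R.
  have m0 : m != 0 by rewrite !mulf_neq0// pnatr_eq0// addSn.
  exists (fun x y => c / m * (hp k.+1 n b x y + - q ^+ k.+1 * hp 0 n b x y) + u x y); split.
  - apply: PL_ext (PL_D (PL_Z (c / m) (PL_D (PL_hp _ _ _ _ _ k.+1 n b) (PL_Z (- q ^+ k.+1) (PL_hp _ _ _ _ _ 0 n b)))) h1) => x y //.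
    by rewrite -/m /= !mulr0 !mul0r mulr0 addr0 mulrA divfK.
  - by move=> x y E; rewrite h2// /hp E expr0; ring.
  - move=> x Dx; have k1 := h3 x Dx; have k2 := @ctn_hp k.+1 n b x Dx; have k3 := @ctn_hp 0 n b x Dx.
    by rewrite /pz in k1 k2 k3 *; ctac.
have [u2 [k1 k2 k3]] : exists u, [/\ PL a b1 b2 c1 c2 u (fun _ _ => 0),
    forall x y, rho x y = q -> u x y = g x y & forall x, adom x -> ctn (apz u) x].
  elim: tg => [|c k n b f' _ [u [k1 k2 k3]]].
    by exists (fun _ _ => 0); split => // [|x _]; [exact: PL_C|exact: ctnC].
  exists (fun x y => c * q ^+ k * hp 0 n b x y + u x y); split.
  - apply: PL_ext (PL_D (PL_Z (c * q ^+ k) (PL_hp _ _ _ _ _ 0 n b)) k1) => x y //.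
    by rewrite mulr0 !mul0r mulr0 addr0.
  - by move=> x y E; rewrite k2// /hp E expr0; ring.
  - move=> x Dx; have l1 := k3 x Dx; have l3 := @ctn_hp 0 n b x Dx.
    by rewrite /pz in l1 l3 *; ctac.
exists (fun x y => u1 x y + u2 x y); split.
- by apply: PL_ext (PL_D h1 k1) => x y //; rewrite addr0.
- by move=> x y E; rewrite h2// k2// add0r.
- move=> x Dx; have l1 := h3 x Dx; have l2 := k3 x Dx.
  by rewrite /pz in l1 l2 *; ctac.
Qed.

Lemma denZ (k : R) (x : V3) : 0 < k -> aden (k *: x) = k * aden x.
Proof. by move=> k0; rewrite /den enormZ dotvZl gtr0_norm// mulrDr. Qed.

Lemma zcZ b (k : R) (x : V3) : 0 < k -> zc a b (k *: x) = zc a b x.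
Proof. by move=> k0; rewrite /zc denZ// dotvZl -mulf_div divff ?mul1r// gt_eqF. Qed.

Lemma dom_proj (x : V3) : adom x -> adom (sphere_proj x) /\ sphere R (sphere_proj x).
Proof.
move=> Dx; have x0 := dom_enorm Dx; split.
  by rewrite /dom /= /sphere_proj denZ ?invr_gt0// mulr_gt0 ?invr_gt0.
by apply: proj_sphere; rewrite -enorm_gt0.
Qed.

Lemma pz_proj p (x : V3) : adom x -> apz p (sphere_proj x) = apz p x.
Proof.
move=> /dom_enorm x0; rewrite /pz /zx /zy /sphere_proj.
by rewrite !zcZ ?invr_gt0.
Qed.

Lemma zr_proj (x : V3) : adom x -> zr (sphere_proj x) = zr x.
Proof. exact: (@pz_proj (@rho R)). Qed.

Lemma den_proj (x : V3) : adom x -> aden (sphere_proj x) = aden x / enorm x.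
Proof. by move=> /dom_enorm x0; rewrite /sphere_proj denZ ?invr_gt0// mulrC. Qed.

Lemma lensO_proj (x : V3) : lensO x -> lensI (sphere_proj x).
Proof.
move=> [Dx zq _]; have [D1 S1] := dom_proj Dx.
by split; first split => //; rewrite zr_proj// ltW.
Qed.

Lemma lensI_O (x : V3) : lensI x -> lensO x.
Proof. by move=> [[Sx Dx _] zq]; split => //; rewrite sphere_enorm//; lra. Qed.

Lemma open_lensO : open lensO.
Proof.
rewrite openE => x [Dx zq x1].
have := open_nbhs_nbhs (conj (@open_dom R a) Dx) => nD.
have nq : \forall y \near x, zr y < q.
  apply: (@ctn_zr x Dx [set r | r < q]).
  by apply: open_nbhs_nbhs; split => //; exact: open_lt.
have n1 : \forall y \near x, 1 / 2 < enorm y.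
  have c1' : ctn (@enorm R) x by apply: ctn_enorm; ctac.
  apply: (c1' [set r | 1 / 2 < r]).
  by apply: open_nbhs_nbhs; split => //; exact: open_gt.
by rewrite /interior; near=> y; split; near: y.
Unshelve. all: by end_near. Qed.

(** A lower bound for [den] on the cap: on the sphere [2 / den = 1 + |z|^2], and
    [|z|^2 <= 2 |z - c|^2 + 2 |c|^2]. *)
Let dl : R := 2 / (1 + 2 * q + 2 * (c1 ^+ 2 + c2 ^+ 2)).

Lemma q_gt0 : 0 < q. Proof. by rewrite exprn_gt0. Qed.

Lemma dl_gt0 : 0 < dl.
Proof.
by rewrite divr_gt0//; have := q_gt0; have := sqr_ge0 c1; have := sqr_ge0 c2; lra.
Qed.

Lemma den_lb (x : V3) : lensK x -> dl <= aden x.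
Proof.
move=> [Sx Dx zq]; have D0 : 0 < aden x by [].
have E := zc_sphere Sx Dx; rewrite ler_pdivrMr; last first.
  by have := q_gt0; have := sqr_ge0 c1; have := sqr_ge0 c2; lra.
rewrite mulrC -ler_pdivrMr// (_ : 2 / aden x = 1 + (zc a b1 x ^+ 2 + zc a b2 x ^+ 2)); last by rewrite E; ring.
move: zq; rewrite /zr /rho /zx /zy; set s := zc a b1 x; set t := zc a b2 x => zq.
have := sqr_ge0 (s - 2 * c1); have := sqr_ge0 (t - 2 * c2); nra.
Qed.

Lemma den_ub (x : V3) : sphere R x -> aden x <= 2.
Proof.
move=> Sx; rewrite /den sphere_enorm//; have := dotv_le x a.
by rewrite sphere_enorm// /enorm a1 sqrtr1; lra.
Qed.

(** The cap is rewritten by everywhere continuous functions: clearing the denominator in [zr <= q]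
    is legitimate because [den] is at least [dl] there. *)
Lemma compact_lensK : compact lensK.
Proof.
pose A := [set x : V3 | enorm x = 1]; pose B := [set x : V3 | dl <= aden x].
pose P (x : V3) := (dotv x b1 - c1 * aden x) ^+ 2 + (dotv x b2 - c2 * aden x) ^+ 2 - q * aden x ^+ 2.
have zrP x : 0 < aden x -> (zr x <= q) = (P x <= 0).
  move=> D0; rewrite -subr_le0 /zr /rho /zx /zy /zc.
  rewrite (_ : _ - q = P x / aden x ^+ 2); last by rewrite /P; field; rewrite gt_eqF.
  by rewrite pmulr_lle0// invr_gt0 exprn_gt0.
have -> : lensK = A `&` B `&` [set x | P x <= 0].
  apply/seteqP; split => x.
    move=> Kx; have d1 := den_lb Kx; have [Sx Dx zq] := Kx; move: zq; rewrite zrP.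
      by move=> zq; exact: (conj (conj Sx d1) zq).
    by exact: Dx.
  move=> [[Sx dx] Px]; have D0 : 0 < aden x := lt_le_trans dl_gt0 dx.
  by split => //; rewrite zrP.
have cen x : ctn (@enorm R) x by apply: ctn_enorm; ctac.
apply: bounded_closed_compact.
  exists 1; split; first exact: num_real.
  by move=> M M1 y [[Sy _] _]; apply: le_trans (norm_le_enorm y) _; rewrite Sy; exact: ltW.
apply: closedI; first apply: closedI.
- apply: (@closed_comp _ _ (@enorm R) [set r | r = 1]) => [x _|]; [exact: cen|exact: closed_eq].
- apply: (@closed_comp _ _ aden [set r | dl <= r]) => [x _|]; [exact: ctn_den|exact: closed_ge].
- apply: (@closed_comp _ _ P [set r | r <= 0]) => [x _|]; last exact: closed_le.
  change (ctn P x); rewrite /P; have h1 := @ctn_den _ a x.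
  have h2 : ctn (fun y : V3 => dotv y b1) x by apply: ctn_dotv; ctac.
  have h3 : ctn (fun y : V3 => dotv y b2) x by apply: ctn_dotv; ctac.
  by ctac.
Qed.

(** [u] solves the cap problem exactly for polynomial data that are [e]-close to [v] on the rim and
    to [H] on the cap. *)
Definition good (v H : V3 -> R) (e : R) (u f : R -> R -> R) :=
  [/\ PL a b1 b2 c1 c2 u f, forall x, adom x -> ctn (apz u) x,
   forall x, lensK x -> zr x = q -> `|apz u x - v x| <= e &
   forall x, lensK x -> `|apz f x / aden x ^+ 2 - H x| <= e].

Lemma good_ex (G0 : set V3) (v H : V3 -> R) : {within G0, continuous v} -> {within G0, continuous H} ->
  (forall s t, `|s - c1| <= rr -> `|t - c2| <= rr -> G0 (sig s t)) ->
  forall e : R, 0 < e -> exists u f, good v H e u f.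
Proof.
move=> cv cH sG e e0; have d0 := dl_gt0.
(* The planar right side is [H * den ^+ 2] by conformality. Its approximation must be accurate to
   [e * dl ^+ 2], since it is divided by [den ^+ 2 >= dl ^+ 2] afterwards. *)
have cH' : {within G0, continuous (fun x => H x * aden x ^+ 2)}.
  apply: withinM => //; apply: within_ctn => x _; have h1 := @ctn_den _ a x; ctac.
have e'0 : 0 < e * dl ^+ 2 by rewrite mulr_gt0// exprn_gt0.
have [g /poly2_tspan tg gv] := lens_approx cv sG e0.
have [f /poly2_tspan tf fH] := lens_approx cH' sG e'0.
have [u [h1 h2 h3]] := solve_tspan tf tg.
exists u, f; split => //.
  by move=> x Kx zq; rewrite distrC /pz h2//; exact: gv.
move=> x Kx; have dx := den_lb Kx; have D0 : 0 < aden x := lt_le_trans d0 dx.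
rewrite (_ : _ - H x = - ((H x * aden x ^+ 2 - apz f x) / aden x ^+ 2)); last by field; rewrite gt_eqF.
rewrite normrN normrM normfV (gtr0_norm (exprn_gt0 2 D0)) ler_pdivrMr ?exprn_gt0//.
by apply: le_trans (fH x Kx) _; rewrite ler_wpM2l ?(ltW e0)// ler_sqr// nnegrE ltW.
Qed.

Lemma good_lap v H e u f : good v H e u f -> has_lap adom (apz u) (fun x => apz f x / aden x ^+ 2).
Proof. by move=> [h _ _ _]; exact: has_lap_pz. Qed.

(** The 1 accounts for the rim errors, and [4 / dl] is the largest value of the correction [4 * phi]
    used in [good_cmp]. *)
Let CC : R := 1 + 4 / dl.

Lemma good_cmp v H e e' u u' f f' : 0 < e -> 0 < e' -> good v H e u f -> good v H e' u' f' ->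
  forall x, lensK x -> apz u x <= apz u' x + CC * (e + e').
Proof.
move=> e0 e'0 g g'; have ee0 : 0 < e + e' by rewrite addr_gt0.
have [_ cu uv fH] := g; have [_ cu' uv' fH'] := g'.
have KD x : lensK x -> adom x by case.
(* As [den <= 2] on the sphere, [phi] has Laplacian at least [1 / 2] there, so [A * phi] outweighs
   the error [e + e'] of the right sides strictly. *)
pose A := 4 * (e + e'); have A0 : 0 < A by rewrite mulr_gt0.
pose ph x := apz u' x - A * phi a x.
have d0 := dl_gt0.
have ph0 x : lensK x -> 0 <= phi a x <= dl^-1.
  move=> Kx; have dx := den_lb Kx; have D0 : 0 < aden x := lt_le_trans d0 dx.
  rewrite /phi; case: Kx => Sx _ _; rewrite sphere_enorm// mul1r invr_ge0 (ltW D0)/=.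
  by rewrite lef_pV2.
have cph x : adom x -> ctn (phi a) x.
  move=> Dx; rewrite /phi; apply: ctnM; first by apply: ctn_enorm; ctac.
  by apply: ctnV; [rewrite gt_eqF|exact: ctn_den].
have main := @sph_comparison R lensK lensI adom (apz u) (fun x => apz f x / aden x ^+ 2) ph
   (fun x => apz f' x / aden x ^+ 2 - A * (2 / aden x ^+ 2)) (CC * (e + e')) compact_lensK.
move=> x Kx; have : apz u x <= ph x + CC * (e + e').
  apply: main => //.
  - by move=> y [].
  - by move=> y [].
  - move=> y Iy; apply: filterS (open_nbhs_nbhs (conj open_lensO (lensI_O Iy))) => z Oz.
    by have [] := lensO_proj Oz.
  - apply: (lap_subsol (@open_dom R a) (L := fun x => apz f x / aden x ^+ 2)) => //.
      by move=> y [[]].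
    by apply: has_lap_eq (@open_dom R a) _ (good_lap g) => y Dy /=; rewrite pz_proj.
  - exact: open_dom.
  - by move=> y [[]].
  - move=> y Dy; rewrite /ph pz_proj//; congr (_ - _ * _).
    have r0 := dom_enorm Dy; have D0 : 0 < aden y by [].
    rewrite /phi den_proj// /sphere_proj enormZ gtr0_norm ?invr_gt0//.
    by field; rewrite !gt_eqF.
  - by apply: has_lapB; [exact: good_lap g'|apply: has_lapZ; exact: has_lap_phi].
  - move=> y [Ky _]; have := fH y Ky; have := fH' y Ky.
    have dx := den_lb Ky; have D0 : 0 < aden y := lt_le_trans d0 dx.
    have : 2^-1 <= 2 / aden y ^+ 2.
      have [Sy _ _] := Ky; have := den_ub Sy => D2.
      by rewrite ler_pdivlMr ?exprn_gt0//; nra.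
    move=> h2; have := ler_wpM2l (ltW A0) h2; rewrite !ler_norml /A; move: ee0; lra.
  - by apply: within_ctn => y /KD/cu.
  - by apply: within_ctn => y /KD Dy; have h1 := cu' y Dy; have h2 := cph y Dy; rewrite /ph; ctac.
  - move=> y Ky nI; have zE : zr y = q.
      have [_ _ zq] := Ky; apply/eqP; rewrite eq_le zq leNgt; apply/negP => zq'; exact: nI.
    have := uv y Ky zE; have := uv' y Ky zE; rewrite /ph /CC.
    have /andP[_ h2] := ph0 y Ky; have := ler_wpM2l (ltW A0) h2.
    have -> : (1 + 4 / dl) * (e + e') = (e + e') + A / dl by rewrite /A; ring.
    by move: (A * phi a y) (A / dl) => s t; rewrite !ler_norml; lra.
rewrite /ph; have /andP[h2 _] := ph0 x Kx; have := mulr_ge0 (ltW A0) h2; lra.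
Qed.

Theorem lens_solver (G0 : set V3) (v H : V3 -> R) :
  {within G0, continuous v} -> {within G0, continuous H} ->
  (forall s t, `|s - c1| <= rr -> `|t - c2| <= rr -> G0 (sig s t)) ->
  loclip lensO (fun x => H (sphere_proj x) / enorm x ^+ 2) ->
  exists U : V3 -> R, [/\ {within lensK, continuous U},
    forall x, lensK x -> zr x = q -> U x = v x,
    C2on lensO (U \o @sphere_proj R) &
    forall x, lensO x -> lapl (U \o @sphere_proj R) x = H (sphere_proj x) / enorm x ^+ 2].
Proof.
move=> cv cH sG hl.
have /choice[w Hw] : forall n : nat, exists uf : (R -> R -> R) * (R -> R -> R),
    good v H n.+1%:R^-1 uf.1 uf.2.
  move=> n; have n0 : 0 < n.+1%:R^-1 :> R by rewrite invr_gt0 ltr0n.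
  by have [u [f g]] := good_ex cv cH sG n0; exists (u, f).
have CC0 : 0 <= CC by rewrite addr_ge0// divr_ge0// ltW// dl_gt0.
have /choice[U HU] : forall x, exists l, lensK x -> forall n, `|l - apz (w n).1 x| <= CC * n.+1%:R^-1.
  move=> x; have [Kx|nK] := pselect (lensK x); last by exists 0.
  have [l Hl] : exists l, forall n, `|l - apz (w n).1 x| <= CC * n.+1%:R^-1.
    apply: real_cauchy => m n.
    by apply: good_cmp (Hw m) (Hw n) _ Kx; rewrite invr_gt0 ltr0n.
  by exists l.
exists U.
have W : wsol lensO (U \o @sphere_proj R) (fun x => H (sphere_proj x) / enorm x ^+ 2).
  (* [CC] controls the values, and 4 bounds [1 / |x|^2] on [lensO]. *)
  move=> e e0; have C40 : 0 <= CC + 4 by rewrite addr_ge0.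
  have [n ne] := arch_small C40 e0.
  have ne1 : CC * n.+1%:R^-1 <= e.
    by apply: le_trans ne; rewrite ler_wpM2r ?invr_ge0// lerDl.
  have ne2 : 4 * n.+1%:R^-1 <= e.
    by apply: le_trans ne; rewrite ler_wpM2r ?invr_ge0// lerDr.
  have [g1 g2 g3 g4] := Hw n.
  exists (apz (w n).1), (fun x => apz (w n).2 x / aden x ^+ 2); split.
  - by apply: has_lap_sub (good_lap (Hw n)) => x [].
  - by move=> x [Dx _ _]; exact: g2.
  - move=> x Ox; have [Kx _] := lensO_proj Ox; have [Dx _ _] := Ox.
    by rewrite -(pz_proj _ Dx); apply: le_trans (HU _ Kx n) _.
  - move=> x Ox; have [Kx _] := lensO_proj Ox; have [Dx _ x1] := Ox.
    have r0 := dom_enorm Dx; have D0 : 0 < aden x by [].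
    have := g4 _ Kx; rewrite pz_proj// den_proj// => h4.
    rewrite (_ : _ - _ = - ((apz (w n).2 x / (aden x / enorm x) ^+ 2 - H (sphere_proj x)) / enorm x ^+ 2)); last first.
      by field; rewrite !gt_eqF.
    rewrite normrN normrM normfV (gtr0_norm (exprn_gt0 2 r0)) ler_pdivrMr ?exprn_gt0//.
    apply: le_trans h4 _.
    have : 1 / 4 <= enorm x ^+ 2 by nra.
    by move: ne2 e0; move: (n.+1%:R^-1) => t; nra.
have [C2 LU] := wsol_regular open_lensO W hl.
split => //.
- apply/withinP => x Kx e e0; have C20 : 0 <= 3 * CC by rewrite mulr_ge0.
  have [n ne] := arch_small C20 e0.
  have [_ g2 _ _] := Hw n; have Dx : adom x by case: Kx.
  have e30 : 0 < e / 3 by rewrite divr_gt0.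
  have /ctnP/(_ _ e30)[d d0 Hd] := g2 x Dx.
  exists d => // y Ky yx; have := HU x Kx n; have := HU y Ky n; have := Hd y yx.
  move: ne; rewrite -mulrA; move: (CC * _) => t; rewrite !ler_norml; lra.
- move=> x Kx zE; have [_ _ g3 _] := Hw 0%N.
  have B n : `|U x - v x| <= 0 + (CC + 1) * n.+1%:R^-1.
    have [_ _ {}g3 _] := Hw n; have := g3 x Kx zE; have := HU x Kx n.
    rewrite add0r [(CC + 1) * _]mulrDl mul1r => h1 h2.
    by rewrite -[U x - v x](subrKA (apz (w n).1 x)) (le_trans (ler_normD _ _))// lerD.
  have C10 : 0 <= CC + 1 by rewrite addr_ge0.
  by have := le_small C10 B; rewrite normr_le0 subr_eq0 => /eqP.
Qed.

End Lens.

(** * Frames and lifting on caps *)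

Section Frame.
Context {R : realType}.
Local Notation V3 := 'rV[R]_3.
Implicit Types (x a b c : V3).

Definition crossv a b : V3 := \row_(j < 3) nth 0 [:: a 0 1 * b 0 ord_max - a 0 ord_max * b 0 1;
  a 0 ord_max * b 0 0 - a 0 0 * b 0 ord_max; a 0 0 * b 0 1 - a 0 1 * b 0 0] j.

Lemma crossv0 a b : crossv a b 0 0 = a 0 1 * b 0 ord_max - a 0 ord_max * b 0 1.
Proof. by rewrite mxE. Qed.
Lemma crossv1 a b : crossv a b 0 1 = a 0 ord_max * b 0 0 - a 0 0 * b 0 ord_max.
Proof. by rewrite mxE. Qed.
Lemma crossv2 a b : crossv a b 0 ord_max = a 0 0 * b 0 1 - a 0 1 * b 0 0.
Proof. by rewrite mxE. Qed.
Definition crossE := (crossv0, crossv1, crossv2).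

Lemma dot_crossl a b : dotv a (crossv a b) = 0.
Proof. by rewrite dotvE !crossE; ring. Qed.
Lemma dot_crossr a b : dotv b (crossv a b) = 0.
Proof. by rewrite dotvE !crossE; ring. Qed.
Lemma lagrange a b : dotv (crossv a b) (crossv a b) = dotv a a * dotv b b - dotv a b ^+ 2.
Proof. by rewrite !dotvE !crossE; ring. Qed.

Lemma ord3_cases (k : 'I_3) : [\/ k = 0, k = 1 | k = ord_max].
Proof. by case: k => [[|[|[|//]]]] p; [apply: Or31|apply: Or32|apply: Or33]; apply/val_inj. Qed.

Lemma orthonormal_basis a b1 b2 x : dotv a a = 1 -> dotv b1 b1 = 1 -> dotv b2 b2 = 1 ->
  dotv a b1 = 0 -> dotv a b2 = 0 -> dotv b1 b2 = 0 ->
  x = dotv x a *: a + dotv x b1 *: b1 + dotv x b2 *: b2.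
Proof.
move=> a1 b11 b22 ab1 ab2 b12.
pose f (i : 'I_3) : V3 := if i == 0 then a else if i == 1 then b1 else b2.
pose M : 'M[R]_3 := \matrix_i f i.
have E : M *m M^T = 1%:M.
  apply/matrixP => i j; rewrite !mxE.
  transitivity (dotv (f i) (f j)); first by apply: eq_bigr => k _; rewrite !mxE.
  by case: (ord3_cases i) => ->; case: (ord3_cases j) => ->; rewrite /f //= dotvC.
have := mulmx1C E => /(congr1 (fun A => x *m A)); rewrite mulmx1 mulmxA => xE.
rewrite -{1}xE; apply/rowP => k; rewrite !mxE sum3 !mxE.
have P (i : 'I_3) : \sum_j x 0 j * M^T j i = dotv x (f i) by apply: eq_bigr => j _; rewrite !mxE.
by rewrite !P.
Qed.

Lemma frame_ex a : dotv a a = 1 -> exists b1 b2, [/\ dotv b1 b1 = 1, dotv b2 b2 = 1,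
  dotv a b1 = 0, dotv a b2 = 0 & dotv b1 b2 = 0].
Proof.
move=> a1.
(* Such an [ee i] is not parallel to [a]; its component orthogonal to [a] is normalised and
   completed by the cross product. *)
have [i ai] : exists i, a 0 i ^+ 2 < 1.
  have := a1; rewrite dotvE -!expr2 => E.
  have [a0|a0] := ltP (a 0 0 ^+ 2) 1; first by exists 0.
  exists 1; have := sqr_ge0 (a 0 1); have := sqr_ge0 (a 0 ord_max); lra.
pose b := ee i - a 0 i *: a.
have bb : dotv b b = 1 - a 0 i ^+ 2.
  rewrite /b dotvBl !dotvBr !dotvZl !dotvZr a1 (dotvC (ee i) a) !dotv_ee mxE !eqxx /=; ring.
have b0 : 0 < enorm b by rewrite sqrtr_gt0 bb subr_gt0.
pose b1 := (enorm b)^-1 *: b.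
have b11 : dotv b1 b1 = 1.
  by rewrite dotvZl dotvZr -enorm_sq; field; rewrite gt_eqF.
have ab1 : dotv a b1 = 0.
  by rewrite dotvZr /b dotvBr dotvZr a1 dotv_ee mulr1 subrr mulr0.
exists b1, (crossv a b1); split => //; [|exact: dot_crossl|exact: dot_crossr].
by rewrite lagrange a1 b11 ab1; ring.
Qed.

End Frame.

(** * Poisson modification of a subsolution on a cap *)

Section LensPerron.
Context {R : realType}.
Local Notation V3 := 'rV[R]_3.
Context (a b1 b2 : V3) (a1 : dotv a a = 1) (b11 : dotv b1 b1 = 1) (b22 : dotv b2 b2 = 1)
  (ab1 : dotv a b1 = 0) (ab2 : dotv a b2 = 0) (b12 : dotv b1 b2 = 0).
Context (rr : R) (rr0 : 0 < rr).
Local Notation K0 := (lensK a b1 b2 0 0 rr).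
Local Notation I0 := (lensI a b1 b2 0 0 rr).
Local Notation O0 := (lensO a b1 b2 0 0 rr).
Local Notation zr := (zr a b1 b2 0 0).
Let basis x := orthonormal_basis x a1 b11 b22 ab1 ab2 b12.

Lemma lensK_dom x : K0 x -> dom a x. Proof. by case. Qed.
Lemma lensI_K x : I0 x -> K0 x. Proof. by case. Qed.

Lemma lensK_I x : K0 x -> zr x = rr ^+ 2 \/ I0 x.
Proof.
move=> Kx; have [_ _] := Kx; rewrite le_eqVlt => /orP[/eqP|zq]; first by left.
by right.
Qed.

Lemma lens_near c : I0 c -> \forall x \near c, K0 (sphere_proj x).
Proof.
move=> Ic; apply: filterS (open_nbhs_nbhs (conj (@open_lensO _ a b1 b2 0 0 rr) (lensI_O Ic))) => z Oz.
by have [] := lensO_proj Oz.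
Qed.

(** The exact solution [u2] is made a strict competitor by subtracting [e * dl * phi]; since
    [phi <= 1 / dl] on the cap this costs at most [e], which then tends to 0. *)
Lemma lens_cmp (H u1 u2 L : V3 -> R) : {within K0, continuous u1} -> subsol I0 H u1 ->
  {within K0, continuous u2} -> has_lap O0 (u2 \o @sphere_proj R) L ->
  (forall x, I0 x -> L x = H x) -> (forall x, K0 x -> zr x = rr ^+ 2 -> u1 x <= u2 x) ->
  forall x, K0 x -> u1 x <= u2 x.
Proof.
move=> c1 s1 c2 L2 LH bd x Kx.
have [dl dl0 Hdl] : exists2 dl : R, 0 < dl & forall x, K0 x -> dl <= den a x.
  by eexists; [exact: (dl_gt0 0 0 rr0)|exact: (den_lb basis rr0)].
apply/ler_addgt0Pr => e e0; have ed0 : 0 < e * dl by rewrite mulr_gt0.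
pose ph y := u2 (sphere_proj y) - (e * dl) * phi a y.
have ph0 y : K0 y -> 0 <= phi a y <= dl^-1.
  move=> Ky; have dy := Hdl y Ky; have D0 : 0 < den a y := lt_le_trans dl0 dy.
  rewrite /phi; case: Ky => Sy _ _; rewrite sphere_enorm// mul1r invr_ge0 (ltW D0)/=.
  by rewrite lef_pV2.
have cph y : dom a y -> ctn (phi a) y.
  move=> Dy; rewrite /phi; apply: ctnM; first by apply: ctn_enorm; ctac.
  by apply: ctnV; [rewrite gt_eqF|exact: ctn_den].
have KS : K0 `<=` sphere R by move=> y [].
suff : u1 x <= ph x + e.
  rewrite /ph (proj_id (KS _ Kx)); have /andP[h _] := ph0 x Kx.
  by have := mulr_ge0 (ltW ed0) h; lra.
have := @sph_comparison R K0 I0 O0 u1 H ph (fun y => L y - (e * dl) * (2 / den a y ^+ 2)) e.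
apply => //.
- exact: (@compact_lensK R a b1 b2 basis 0 0 rr rr0).
- exact: lensI_K.
- exact: lens_near.
- exact: open_lensO.
- exact: lensI_O.
- move=> y [Dy _ _]; rewrite /ph proj_proj; congr (_ - _ * _).
  have r0 := dom_enorm Dy; have D0 : 0 < den a y by [].
  rewrite /phi den_proj// /sphere_proj enormZ gtr0_norm ?invr_gt0//.
  by field; rewrite !gt_eqF.
- apply: has_lapB => //; apply: has_lapZ; apply: has_lap_sub (has_lap_phi a1) => y [] //.
- move=> y Iy; rewrite LH// ltrBlDr ltrDl mulr_gt0// divr_gt0// exprn_gt0//.
  by have [[]] := Iy.
- apply/withinP => y Ky e1 e10; have e20 : 0 < e1 / 2 by rewrite divr_gt0.
  have /withinP/(_ y Ky _ e20)[d1 d10 H1] := c2.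
  have cp : ctn (fun z => (e * dl) * phi a z) y by have h := cph y (lensK_dom Ky); ctac.
  have /ctnP/(_ _ e20)[d2 d20 H2] := cp.
  exists (Num.min d1 d2); first by rewrite lt_min d10.
  move=> z Kz; rewrite lt_min => /andP[z1 z2]; rewrite /ph (proj_id (KS _ Kz)) (proj_id (KS _ Ky)).
  by have := H1 z Kz z1; have := H2 z z2; rewrite !ler_norml; lra.
- move=> y Ky nI; have [zE|//] := lensK_I Ky.
  rewrite /ph (proj_id (KS _ Ky)); have := bd y Ky zE; have /andP[_ h] := ph0 y Ky.
  have h2 : e * dl * phi a y <= e.
    by apply: le_trans (ler_wpM2l (ltW ed0) h) _; rewrite mulfK// gt_eqF.
  by move: h2; lra.
Qed.

Section Lift.
Context (G K : set V3) (GK : G `<=` K) (KS : K `<=` sphere R) (K0G : K0 `<=` G) (H : V3 -> R).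
Context (v U : V3 -> R) (cv : {within K, continuous v}) (sv : subsol G H v)
  (cU : {within K0, continuous U}) (Uv : forall x, K0 x -> zr x = rr ^+ 2 -> U x = v x)
  (L : V3 -> R) (UL : has_lap O0 (U \o @sphere_proj R) L) (LH : forall x, I0 x -> L x = H x).

(** Perron's Poisson modification: [U] solves the equation on the cap with the rim values of [v]. *)
Definition lift (x : V3) := if pselect (K0 x) then U x else v x.

Lemma lift_in x : K0 x -> lift x = U x.
Proof. by rewrite /lift; case: pselect. Qed.

Lemma lift_out x : ~ K0 x -> lift x = v x.
Proof. by rewrite /lift; case: pselect. Qed.

Lemma lift_notI x : ~ I0 x -> lift x = v x.
Proof.
move=> nI; have [Kx|/lift_out//] := pselect (K0 x); rewrite lift_in//.
by have [/(Uv Kx)|//] := lensK_I Kx.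
Qed.

Lemma le_lift x : v x <= lift x.
Proof.
have [Kx|/lift_out->//] := pselect (K0 x); rewrite lift_in//.
apply: (@lens_cmp H v U L) => //.
- by apply: within_sub cv => y /K0G/GK.
- by apply: subsol_sub sv => y /lensI_K/K0G.
- by move=> y Ky /(Uv Ky) ->.
Qed.

(** Inside the cap [lift] is an exact solution. At any other point it equals [v], and as [v <= lift]
    everywhere, a function touching [lift] from above there also touches [v]. *)
Lemma lift_subsol : subsol G H lift.
Proof.
have sU : subsol I0 H U.
  apply: (lap_subsol (@open_lensO _ a b1 b2 0 0 rr) _ UL); first exact: lensI_O.
  by move=> x /LH ->.
move=> x0 Gx0 O ph L' oO Ox0 pL mx; have Sx0 := KS (GK Gx0).
have [Ix0|nI] := pselect (I0 x0).
  have oI : open (O `&` O0) by apply: openI => //; exact: open_lensO.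
  apply: (sU x0 Ix0 (O `&` O0) ph L' oI (conj Ox0 (lensI_O Ix0))).
    by apply: has_lap_sub pL => y [].
  move=> x [Ox /lensO_proj[Kx _]]; have := mx x Ox.
  by rewrite lift_in// (proj_id Sx0) lift_in//; exact: lensI_K.
apply: (sv Gx0 oO Ox0 pL) => x Ox.
apply: (@le_trans _ _ (lift (sphere_proj x) - ph x)); first by rewrite lerB// le_lift.
by apply: le_trans (mx x Ox) _; rewrite (proj_id Sx0) lift_notI.
Qed.

Lemma lift_cont : {within K, continuous lift}.
Proof.
have cK0 : closed K0.
  by apply: compact_closed; [exact: norm_hausdorff|exact: (@compact_lensK R a b1 b2 basis 0 0 rr rr0)].
apply/withinP => x Kx e e0.
have /withinP/(_ x Kx e e0)[d1 d10 H1] := cv.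
have [K0x|nK] := pselect (K0 x); last first.
  have : \forall y \near x, ~ K0 y by apply: open_nbhs_nbhs; split => //; exact: closed_openC.
  move=> /nbhs_ballP[d2 /= d20 H2].
  exists (Num.min d1 d2); first by rewrite lt_min d10.
  move=> y Ky; rewrite lt_min => /andP[y1 y2]; rewrite !lift_out//; first exact: H1.
  by apply: H2; rewrite -ball_normE /= distrC.
have /withinP/(_ x K0x e e0)[d2 d20 H2] := cU.
have [zE|Ix] := lensK_I K0x.
  exists (Num.min d1 d2); first by rewrite lt_min d10.
  move=> y Ky; rewrite lt_min => /andP[y1 y2].
  have [K0y|nKy] := pselect (K0 y); first by rewrite !lift_in//; exact: H2.
  by rewrite (lift_out nKy) lift_in// Uv//; exact: H1.
have /nbhs_ballP[d3 /= d30 H3] := lens_near Ix.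
exists (Num.min d3 d2); first by rewrite lt_min d30.
move=> y Ky; rewrite lt_min => /andP[y1 y2].
have K0y : K0 y.
  have := H3 y; rewrite -ball_normE /= distrC => /(_ y1).
  by rewrite (proj_id (KS Ky)).
by rewrite !lift_in//; exact: H2.
Qed.

End Lift.
End LensPerron.

(** * Perron solution *)

Section Auxiliary.
Context {R : realType}.
Local Notation V3 := 'rV[R]_3.

Lemma compact_fun_bounded (K : set V3) (f : V3 -> R) : compact K -> {within K, continuous f} ->
  exists2 M, 0 <= M & forall x, K x -> `|f x| <= M.
Proof.
move=> cK cf; have [K0|nK] := pselect (K !=set0); last first.
  by exists 0 => // x Kx; case: nK; exists x.
have [u _ umax] := compact_EVT_max K0 cK cf; have [l _ lmin] := compact_EVT_min K0 cK cf.
exists (`|f u| + `|f l|); first by rewrite addr_ge0.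
move=> x Kx; have := umax x; have := lmin x; rewrite !inE => /(_ Kx) h1 /(_ Kx) h2.
rewrite ler_norml; have := ler_norm (f u); have := ler_norm (- f l); rewrite normrN.
by have := normr_ge0 (f u); have := normr_ge0 (f l); lra.
Qed.

Lemma closed_sphere : closed (sphere R).
Proof.
apply: (@closed_comp _ _ (@enorm R) [set r | r = 1]) => [x _|]; last exact: closed_eq.
by apply: ctn_enorm; ctac.
Qed.

Lemma bounded_sphere : bounded_set (sphere R).
Proof.
exists 1; split; first exact: num_real.
by move=> M M1 y Sy; apply: le_trans (norm_le_enorm y) _; rewrite sphere_enorm// ltW.
Qed.

Lemma dotv_sphere (x : V3) : sphere R x -> dotv x x = 1.
Proof. by move=> Sx; rewrite -enorm_sq sphere_enorm// expr1n. Qed.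

Lemma sphere_dot_lt1 (x c : V3) : sphere R x -> sphere R c -> x != c -> dotv x c < 1.
Proof.
move=> Sx Sc xc; have : 0 < enorm (x - c) ^+ 2 by rewrite exprn_gt0// enorm_gt0 subr_eq0.
by rewrite enorm_dist !dotv_sphere//; lra.
Qed.

Definition cone (G : set V3) := [set x : V3 | x != 0 /\ G (sphere_proj x)].

Lemma open_cone (G O : set V3) : open O -> G = sphere R `&` O -> open (cone G).
Proof.
move=> oO ->; rewrite openE => x [x0 [Sx Ox]].
have N1 : \forall y \near x, y != 0 :> V3.
  have : \forall y \near x, 0 < enorm y.
    have c1 : ctn (@enorm R) x by apply: ctn_enorm; ctac.
    apply: (c1 [set r | 0 < r]); apply: open_nbhs_nbhs; split; first exact: open_gt.
    by rewrite /= enorm_gt0.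
  by apply: filterS => y; rewrite enorm_gt0.
have N2 : \forall y \near x, O (sphere_proj y).
  by apply: near_proj => //; exact: open_nbhs_nbhs.
rewrite /interior; near=> y.
have y0 : y != 0 by near: y.
by split => //; split; [exact: proj_sphere|near: y].
Unshelve. all: by end_near. Qed.

End Auxiliary.

Section LocalLens.
Context {R : realType}.
Local Notation V3 := 'rV[R]_3.

Lemma sig_sphere (a b1 b2 : V3) (s t : R) : dotv a a = 1 -> dotv b1 b1 = 1 -> dotv b2 b2 = 1 ->
  dotv a b1 = 0 -> dotv a b2 = 0 -> dotv b1 b2 = 0 -> sphere R (sig a b1 b2 s t).
Proof.
move=> a1 b11 b22 ab1 ab2 b12; rewrite /sphere /= /enorm.
suff -> : dotv (sig a b1 b2 s t) (sig a b1 b2 s t) = 1 by rewrite sqrtr1.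
rewrite /sig !(dotvZl, dotvZr) !(dotvDl, dotvDr) !(dotvZl, dotvZr) (dotvC b2 b1) (dotvC b1 a) (dotvC b2 a).
rewrite a1 b11 b22 ab1 ab2 b12; field; rewrite gt_eqF//.
by have := sqr_ge0 s; have := sqr_ge0 t; lra.
Qed.

Lemma local_lens (G O : set V3) (a : V3) : open O -> G = sphere R `&` O -> G a ->
  exists b1 b2 rr, [/\ [/\ dotv b1 b1 = 1, dotv b2 b2 = 1, dotv a b1 = 0, dotv a b2 = 0 & dotv b1 b2 = 0],
   0 < rr, forall s t, `|s - 0| <= rr -> `|t - 0| <= rr -> G (sig a b1 b2 s t),
   lensK a b1 b2 0 0 rr `<=` G & lensI a b1 b2 0 0 rr a].
Proof.
move=> oO GE Ga; have [Sa Oa] : (sphere R `&` O) a by rewrite -GE.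
have a1 := dotv_sphere Sa.
have [b1 [b2 [b11 b22 ab1 ab2 b12]]] := frame_ex a1.
have s0 : sig a b1 b2 0 0 = a.
  by rewrite /sig expr0n /= !addr0 !subr0 invr1 !scale1r mulr0 !scale0r !add0r.
have cs : ctn (fun p : R * R => sig a b1 b2 p.1 p.2) (0, 0).
  by apply: ctn_sig; [exact: cvg_fst|exact: cvg_snd].
have := cs O; rewrite /= s0 => /(_ (open_nbhs_nbhs (conj oO Oa)))/nbhs_ballP[d /= d0 Hd].
pose rr := d / 2; have rr0 : 0 < rr by rewrite divr_gt0.
have sG s t : `|s| <= rr -> `|t| <= rr -> G (sig a b1 b2 s t).
  move=> sr tr; rewrite GE; split; first exact: sig_sphere.
  have := Hd (s, t); apply; split; rewrite /ball /= sub0r normrN /rr in sr tr *; lra.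
exists b1, b2, rr; split => //.
- by move=> s t; rewrite !subr0; exact: sG.
- move=> x [Sx Dx zq].
  have basis y := orthonormal_basis y a1 b11 b22 ab1 ab2 b12.
  rewrite -(sig_zc basis Sx Dx).
  have zb (u w : R) : u ^+ 2 + w ^+ 2 <= rr ^+ 2 -> `|u| <= rr.
    move=> uw; rewrite -ler_sqr ?nnegrE ?(ltW rr0)// real_normK ?num_real//.
    by apply: le_trans uw; rewrite lerDl sqr_ge0.
  move: zq; rewrite /zr /rho /zx /zy !subr0 => zq.
  by apply: sG; [apply: zb zq|apply: (zb _ (zc a b1 x)); rewrite addrC].
have zca b : dotv a b = 0 -> zc a b a = 0 by move=> E; rewrite /zc E mul0r.
have z0 : zr a b1 b2 0 0 a = 0 by rewrite /zr /rho /zx /zy !zca// subr0 expr0n addr0.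
split; last by rewrite z0 exprn_gt0.
split => //; last by rewrite z0 ltW// exprn_gt0.
by rewrite /dom /den /= sphere_enorm// a1; lra.
Qed.

End LocalLens.

Section Perron.
Context {R : realType}.
Local Notation V3 := 'rV[R]_3.
Context (G O : set V3) (oO : open O) (GE : G = sphere R `&` O).
Let K := closure G.
Let bd := K `\` G.
Context (F H : V3 -> R) (cF : {within bd, continuous F}) (cH : {within K, continuous H}).
(** The Laplacian in space of the ray-constant extension of a solution: [H] extended with degree
    -2. *)
Let h (x : V3) := H (sphere_proj x) / enorm x ^+ 2.
Context (lH : loclip (cone G) h).
Context (barr : forall y, bd y -> exists c, [/\ sphere R c, ~ K c &
  forall x, K x -> x != y -> dotv x c < dotv y c]).
Context (bd0 : exists y, bd y).

Lemma G_sphere x : G x -> sphere R x. Proof. by rewrite GE => -[]. Qed.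

Lemma G_K x : G x -> K x. Proof. exact: subset_closure. Qed.

Lemma K_sphere x : K x -> sphere R x.
Proof.
move=> Kx; rewrite (closure_id (sphere R)).1; last exact: closed_sphere.
by apply: (closure_subset _ Kx) => y; exact: G_sphere.
Qed.

Lemma K_compact : compact K.
Proof.
apply: bounded_closed_compact; last exact: closed_closure.
have [M [Mr HM]] := @bounded_sphere R; exists M; split => // x Mx y /K_sphere; exact: HM.
Qed.

Lemma bd_compact : compact bd.
Proof.
have -> : bd = K `&` ~` O.
  apply/seteqP; split => x [Kx nx]; split => //.
    by move=> Ox; apply: nx; rewrite GE; split => //; exact: K_sphere.
  by rewrite GE => -[].
by apply: compact_closedI; [exact: K_compact|exact: open_closedC].
Qed.

Lemma near_G x : G x -> \forall y \near x, G (sphere_proj y).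
Proof.
move=> Gx; have oC := open_cone oO GE.
have Cx : cone G x.
  by split; [exact: sphere_neq0 (G_sphere Gx)|rewrite proj_id//; exact: G_sphere].
by apply: filterS (open_nbhs_nbhs (conj oC Cx)) => y [].
Qed.

Definition pole (c : V3) := ~ K c /\ sphere R c.

Lemma pole_den c x : pole c -> K x -> 0 < den (- c) x.
Proof.
move=> [nc Sc] Kx; have Sx := K_sphere Kx; rewrite /den sphere_enorm// dotvNr subr_gt0.
by apply: sphere_dot_lt1 => //; apply/eqP => E; apply: nc; rewrite -E.
Qed.

Lemma pole_unit c : pole c -> dotv (- c) (- c) = 1.
Proof. by move=> [_ Sc]; rewrite dotvNl dotvNr opprK dotv_sphere. Qed.

Lemma ctn_phi (a x : V3) : dom a x -> ctn (phi a) x.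
Proof.
move=> Dx; rewrite /phi; apply: ctnM; first by apply: ctn_enorm; ctac.
by apply: ctnV; [rewrite gt_eqF|exact: ctn_den].
Qed.

(** On the sphere [phi (- c)] is [1 / (1 - x.c)], which increases with [x.c]. So the difference
    vanishes at [y], is positive at points farther from [c] than [y], and has negative Laplacian: a
    barrier at [y] when [c] is the centre of a touching exterior cap. *)
Definition pole_barrier (c y x : V3) : R := phi (- c) y - phi (- c) x.

Lemma pole_barrier_within c y : pole c -> {within K, continuous (pole_barrier c y)}.
Proof.
move=> pc; apply: within_ctn => x Kx; have h1 := ctn_phi (pole_den pc Kx).
by rewrite /pole_barrier; ctac.
Qed.

Lemma pole_barrier_gt0 c y x : pole c -> K x -> K y -> dotv x c < dotv y c -> 0 < pole_barrier c y x.
Proof.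
move=> pc Kx Ky xy; have Dx := pole_den pc Kx; have Dy := pole_den pc Ky.
rewrite /pole_barrier /phi !sphere_enorm; [|exact: K_sphere|exact: K_sphere].
rewrite !mul1r subr_gt0 ltf_pV2//.
by rewrite /den !sphere_enorm ?dotvNr; [lra|exact: K_sphere|exact: K_sphere].
Qed.

Lemma pole_barrier_proj c y x : dom (- c) x -> pole_barrier c y (sphere_proj x) = pole_barrier c y x.
Proof.
move=> Dx; have r0 := dom_enorm Dx; have D0 : 0 < den (- c) x by [].
rewrite /pole_barrier; congr (_ - _); rewrite /phi den_proj// /sphere_proj enormZ gtr0_norm ?invr_gt0//.
by field; rewrite !gt_eqF.
Qed.

Lemma pole_barrier_lap c y : pole c -> has_lap (dom (- c)) (pole_barrier c y) (fun x => - (2 / den (- c) x ^+ 2)).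
Proof.
move=> pc; have := has_lapB (has_lap_cst (dom (- c)) (phi (- c) y)) (has_lap_phi (pole_unit pc)).
by apply: has_lap_eqL => x _; rewrite sub0r.
Qed.

Lemma pole_barrier_lap_ge c x : pole c -> K x -> 1 / 2 <= 2 / den (- c) x ^+ 2.
Proof.
move=> pc Kx; have D0 := pole_den pc Kx.
have D2 : den (- c) x <= 2.
  rewrite /den sphere_enorm; last exact: K_sphere.
  have := dotv_le x (- c); rewrite /enorm (pole_unit pc) -/(enorm x) sphere_enorm; last exact: K_sphere.
  by rewrite sqrtr1; lra.
by rewrite ler_pdivlMr ?exprn_gt0//; nra.
Qed.

Lemma bounds : exists2 M, 0 <= M & (forall x, bd x -> `|F x| <= M) /\ (forall x, K x -> `|H x| <= M).
Proof.
have [M1 M10 H1] := compact_fun_bounded bd_compact cF.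
have [M2 M20 H2] := compact_fun_bounded K_compact cH.
exists (M1 + M2); first by rewrite addr_ge0.
by split => x Hx; [apply: le_trans (H1 x Hx) _; rewrite lerDl|apply: le_trans (H2 x Hx) _; rewrite lerDr].
Qed.

(* [A] also makes [F y +- (e + A w)] strict super- and subsolutions *)
Definition barrier y e c (A : R) := [/\ pole c, 0 <= A, forall x, K x -> 0 <= pole_barrier c y x,
  forall x, K x -> `|H x| < A / 2 & forall x, bd x -> `|F x - F y| <= e + A * pole_barrier c y x].

Lemma barrier_ex y e : bd y -> 0 < e -> exists c A, barrier y e c A.
Proof.
move=> by_ e0; have [c [Sc nc Hc]] := barr by_; have [Ky nGy] := by_.
have pc : pole c by [].
have wge0 x : K x -> 0 <= pole_barrier c y x.
  move=> Kx; have [->|xy] := eqVneq x y; first by rewrite /pole_barrier subrr.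
  by apply: ltW; apply: pole_barrier_gt0 => //; exact: Hc.
have [M M0 [FM HM]] := bounds.
have /withinP/(_ y by_ e e0)[d d0 Hd] := cF.
pose B := bd `&` [set x | d <= `|x - y|].
have cB : compact B.
  apply: compact_closedI; first exact: bd_compact.
  apply: (@closed_comp _ _ (fun x : V3 => `|x - y|) [set r | d <= r]) => [x _|]; last exact: closed_ge.
  by ctac.
have [m m0 Hm] : exists2 m, 0 < m & forall x, B x -> m <= pole_barrier c y x.
  have [B0|nB] := pselect (B !=set0); last first.
    by exists 1 => // x Bx; case: nB; exists x.
  have cw : {within B, continuous (pole_barrier c y)} by apply: within_sub (@pole_barrier_within c y pc) => x [[]].
  have [l + lmin] := compact_EVT_min B0 cB cw; rewrite inE => -[[Kl _] dl].
  exists (pole_barrier c y l); last by move=> x Bx; apply: lmin; rewrite inE.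
  apply: pole_barrier_gt0 => //; apply: Hc => //; apply/eqP => E; move: dl; rewrite /= E subrr normr0.
  by rewrite leNgt d0.
(* The summand [2 * M / m] settles boundary points at distance at least [d] from [y], where the
   barrier is at least [m]; the summand [2 * M + 1] gives [|H| <= M < A / 2]. *)
have A0 : 0 <= 2 * M / m + 2 * M + 1 by rewrite !addr_ge0 ?divr_ge0 ?mulr_ge0// ltW.
exists c, (2 * M / m + 2 * M + 1); split => //.
- move=> x /HM; have : 0 <= 2 * M / m by rewrite divr_ge0 ?mulr_ge0// ltW.
  by lra.
- move=> x bx; have [Kx _] := bx; have w0 := wge0 x Kx.
  have [xd|dx] := ltP `|x - y| d.
    by apply: le_trans (Hd x bx xd) _; rewrite lerDl mulr_ge0.
  have mw := Hm x (conj bx dx).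
  have : 2 * M <= (2 * M / m + 2 * M + 1) * pole_barrier c y x.
    apply: (@le_trans _ _ (2 * M / m * m)); first by rewrite divfK// gt_eqF.
    apply: (@le_trans _ _ (2 * M / m * pole_barrier c y x)).
      by rewrite ler_wpM2l// divr_ge0 ?mulr_ge0// ltW.
    by rewrite ler_wpM2r//; lra.
  have := FM x bx; have := FM y by_; have := ler_normB (F x) (F y); lra.
Qed.

Definition perron_class (v : V3 -> R) := [/\ {within K, continuous v}, subsol G H v & forall x, bd x -> v x <= F x].

Lemma perron_class_upper v y e c A : perron_class v -> barrier y e c A -> forall x, K x -> v x <= F y + e + A * pole_barrier c y x.
Proof.
move=> [cv sv vF] [pc A0 w0 HA FA] x Kx.
have := @sph_comparison R K G (dom (- c)) v H (fun x => A * pole_barrier c y x)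
  (fun x => A * (- (2 / den (- c) x ^+ 2))) (F y + e) K_compact.
move=> /(_ G_K K_sphere _ sv (@open_dom _ (- c))) main.
rewrite [_ + A * _]addrC; apply: main => //.
- move=> z Gz; apply: filterS (near_G Gz) => t; exact: G_K.
- by move=> z /G_K; exact: pole_den.
- by move=> z Dz; rewrite pole_barrier_proj.
- exact: has_lapZ (pole_barrier_lap y pc).
- move=> z /G_K Kz; have := HA z Kz; rewrite ltr_norml => /andP[h1 _].
  by have := ler_wpM2l A0 (pole_barrier_lap_ge pc Kz); rewrite mulrN; lra.
- by apply: withinM (@pole_barrier_within c y pc); apply: within_ctn => z _; exact: ctnC.
- move=> z Kz nG; have bz : bd z by [].
  by have := FA z bz; have := vF z bz; rewrite ler_norml; lra.
Qed.

Lemma perron_class_lower y e c A : barrier y e c A -> perron_class (fun x => F y - e - A * pole_barrier c y x).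
Proof.
move=> [pc A0 w0 HA FA]; split.
- apply: withinB; first by apply: within_ctn => z _; exact: ctnC.
  by apply: withinM (@pole_barrier_within c y pc); apply: within_ctn => z _; exact: ctnC.
- apply: (lap_subsol (@open_dom _ (- c)) (L := fun x => 0 - A * (- (2 / den (- c) x ^+ 2)))).
  + by move=> z /G_K; exact: pole_den.
  + have := has_lapB (has_lap_cst (dom (- c)) (F y - e)) (has_lapZ A (pole_barrier_lap y pc)).
    by apply: has_lap_eq; [exact: open_dom|move=> z Dz /=; rewrite pole_barrier_proj].
  + move=> z /G_K Kz; have := HA z Kz; rewrite ltr_norml => /andP[_ h1].
    by have := ler_wpM2l A0 (pole_barrier_lap_ge pc Kz); rewrite mulrN; lra.
- by move=> z bz; have := FA z bz; rewrite ler_norml; lra.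
Qed.

Lemma perron_class_max v w : perron_class v -> perron_class w -> perron_class (fun x => Num.max (v x) (w x)).
Proof.
move=> [cv sv vF] [cw sw wF]; split; last by move=> x bx; rewrite ge_max vF//= wF.
  apply/withinP => x Kx e e0.
  have /withinP/(_ x Kx e e0)[d1 d10 H1] := cv; have /withinP/(_ x Kx e e0)[d2 d20 H2] := cw.
  exists (Num.min d1 d2); first by rewrite lt_min d10.
  move=> y Ky; rewrite lt_min => /andP[y1 y2]; have := H1 y Ky y1; have := H2 y Ky y2.
  by have [h1|h1] := leP (v y) (w y); have [h2|h2] := leP (v x) (w x); rewrite !ler_norml; lra.
exact: subsol_max.
Qed.

Lemma perron_class_bounded : exists2 M, 0 <= M & forall v x, perron_class v -> K x -> v x <= M.
Proof.
have [y by_] := bd0; have [c [A B]] := barrier_ex by_ ltr01.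
have [pc A0 _ _ _] := B.
have [M M0 HM] := compact_fun_bounded K_compact (@pole_barrier_within c y pc).
exists (`|F y| + 1 + A * M); first by rewrite !addr_ge0// mulr_ge0.
move=> v x Sv Kx; apply: le_trans (@perron_class_upper _ _ _ _ _ Sv B x Kx) _.
have := ler_wpM2l A0 (le_trans (ler_norm _) (HM x Kx)); have := ler_norm (F y); lra.
Qed.

Lemma perron_class_ex : exists v, perron_class v.
Proof. by have [y by_] := bd0; have [c [A /perron_class_lower B]] := barrier_ex by_ ltr01; eexists; exact: B. Qed.

Definition perron x := sup [set v x | v in perron_class].

Lemma perron_ub v x : perron_class v -> K x -> v x <= perron x.
Proof.
move=> Sv Kx; apply: ub_le_sup; last by exists v.
by have [M _ HM] := perron_class_bounded; exists M => _ [w Sw <-]; exact: HM.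
Qed.

Lemma perron_le x M : (forall v, perron_class v -> v x <= M) -> perron x <= M.
Proof.
move=> HM; apply: ge_sup; first by have [v Sv] := perron_class_ex; exists (v x), v.
by move=> _ [v Sv <-]; exact: HM.
Qed.

(** The lower barrier is itself a member of [perron_class], and the upper barrier dominates all
    members. *)
Lemma perron_barrier y e c A x : barrier y e c A -> K x ->
  `|perron x - F y| <= e + A * pole_barrier c y x.
Proof.
move=> B Kx; have h1 := perron_ub (perron_class_lower B) Kx.
have h2 : perron x <= F y + e + A * pole_barrier c y x.
  by apply: perron_le => v Sv; exact: (@perron_class_upper _ _ _ _ _ Sv B x Kx).
by rewrite ler_norml; lra.
Qed.

Lemma perron_bd y : bd y -> perron y = F y.
Proof.
move=> by_; apply/eqP; rewrite -subr_eq0 -normr_le0; apply/ler_addgt0Pr => e e0; rewrite add0r.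
have [c [A B]] := barrier_ex by_ e0; have [Ky _] := by_.
by have := perron_barrier B Ky; rewrite /pole_barrier subrr mulr0 addr0.
Qed.

Lemma perron_cont_bd y : bd y -> forall e : R, 0 < e -> exists2 d : R, 0 < d &
  forall x, K x -> `|x - y| < d -> `|perron x - perron y| <= e.
Proof.
move=> by_ e e0; have e20 : 0 < e / 2 by rewrite divr_gt0.
have [c [A B]] := barrier_ex by_ e20; have [Ky _] := by_; have [pc A0 _ _ _] := B.
have cw : {within K, continuous (fun x => A * pole_barrier c y x)}.
  by apply: withinM (@pole_barrier_within c y pc); apply: within_ctn => z _; exact: ctnC.
have /withinP/(_ y Ky _ e20)[d d0 Hd] := cw.
exists d => // x Kx xy; rewrite (perron_bd by_); apply: le_trans (perron_barrier B Kx) _.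
by have := Hd x Kx xy; rewrite {2}/pole_barrier subrr mulr0 subr0 ler_norml; lra.
Qed.

(* The lifts of the subsolutions on a lens are uniformly Lipschitz near its centre and directed. *)
Lemma perron_local x0 : G x0 -> exists N : set V3, [/\ open N, N x0, N `<=` cone G &
  wsol N (perron \o @sphere_proj R) h].
Proof.
move=> Gx0; have a1 := dotv_sphere (G_sphere Gx0).
have [b1 [b2 [rr [[b11 b22 ab1 ab2 b12] rr0 sG K0G I0]]]] := local_lens oO GE Gx0.
have basis y := orthonormal_basis y a1 b11 b22 ab1 ab2 b12.
set K0 := lensK x0 b1 b2 0 0 rr in K0G; set O0 := lensO x0 b1 b2 0 0 rr.
have oO0 : open O0 by exact: open_lensO.
have O0x : O0 x0 by exact: lensI_O.
have O0K x : O0 x -> K0 (sphere_proj x) by move=> /lensO_proj[].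
have O0C : O0 `<=` cone G.
  move=> x Ox; split; last by apply: K0G; exact: O0K.
  by have [Dx _ _] := Ox; rewrite -enorm_gt0; exact: dom_enorm Dx.
have lH0 : loclip O0 h by move=> x /O0C; exact: lH.
have cHG : {within G, continuous H} by apply: within_sub cH; exact: G_K.
have lift_ex v : perron_class v -> exists w, [/\ perron_class w, forall x, v x <= w x,
    forall x, O0 x -> ctn (w \o @sphere_proj R) x & has_lap O0 (w \o @sphere_proj R) h].
  move=> [cv sv vF]; have cvG : {within G, continuous v} by apply: within_sub cv; exact: G_K.
  have [U [cU Uv C2 UL]] := lens_solver a1 b11 b22 ab1 ab2 b12 basis rr0 cvG cHG sG lH0.
  have UH : has_lap O0 (U \o @sphere_proj R) h by apply: has_lap_eqL (C2on_has_lap C2) => x; exact: UL.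
  have LH x : lensI x0 b1 b2 0 0 rr x -> h x = H x.
    move=> [[Sx _ _] _]; rewrite /h (proj_id Sx) sphere_enorm// expr1n divr1 //.
  have E x : O0 x -> (U \o @sphere_proj R) x = (lift x0 b1 b2 rr v U \o @sphere_proj R) x.
    by move=> /O0K Kx /=; rewrite lift_in.
  exists (lift x0 b1 b2 rr v U); split.
  - split.
    + exact: (@lift_cont _ x0 b1 b2 a1 b11 b22 ab1 ab2 b12 rr rr0 K K_sphere v U cv cU Uv).
    + exact: (@lift_subsol _ x0 b1 b2 a1 b11 b22 ab1 ab2 b12 rr rr0 G K G_K K_sphere K0G H v U cv sv cU Uv h UH LH).
    + by move=> x bx; rewrite lift_out; [exact: vF|move=> /K0G; case: bx].
  - exact: (@le_lift _ x0 b1 b2 a1 b11 b22 ab1 ab2 b12 rr rr0 G K G_K K0G H v U cv sv cU Uv h UH LH).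
  - move=> x Ox; apply/ctnP => e e0; have [/ctnP/(_ e e0)[d1 d10 H1] _] := C2 x Ox.
    have [d2 d20 H2] := open_box_sub oO0 Ox.
    exists (Num.min d1 d2); first by rewrite lt_min d10.
    move=> y; rewrite lt_min => /andP[y1 y2]; rewrite -!E//; first exact: H1.
    by apply: H2; exact: ltW.
  - exact: has_lap_eq oO0 E UH.
have [v0 Sv0] := perron_class_ex; have [M M0 HM] := perron_class_bounded.
have [M1 M10 HM1] : exists2 M1, 0 <= M1 & forall x, K x -> `|v0 x| <= M1.
  by apply: compact_fun_bounded K_compact _; case: Sv0.
(* Taking the maximum with the fixed [v0] before lifting bounds the lifts from below as well, so the
   interior gradient estimate holds with one constant for all of them. *)
have lift0 v : perron_class v -> exists w, [/\ perron_class w, forall x, v x <= w x, forall x, K x -> `|w x| <= M + M1,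
    forall x, O0 x -> ctn (w \o @sphere_proj R) x & has_lap O0 (w \o @sphere_proj R) h].
  move=> Sv; have [w [Sw vw cw wh]] := lift_ex _ (perron_class_max Sv Sv0).
  exists w; split => // [x|x Kx]; first by apply: le_trans (vw x); rewrite le_max lexx.
  have := HM1 x Kx; have := HM w x Sw Kx; have := vw x; rewrite ge_max => /andP[_].
  by rewrite !ler_norml; lra.
have [d1 d10 H1] := open_box_sub oO0 O0x.
have /ctnP/(_ _ ltr01)[d2 d20 H2] := loclip_ctn lH0 O0x.
pose d := Num.min (d1 / 2) (d2 / 4).
have d0 : 0 < d by rewrite lt_min !divr_gt0.
have dd1 : 2 * d <= d1.
  have : d <= d1 / 2 by rewrite ge_min lexx.
  by lra.
have dd2 : 2 * d < d2.
  have : d <= d2 / 4 by rewrite ge_min lexx orbT.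
  by lra.
have dO y : `|y - x0| <= 2 * d -> O0 y by move=> yd; apply: H1; exact: le_trans yd dd1.
have hF y : `|y - x0| <= 2 * d -> `|h y| <= `|h x0| + 1.
  move=> yd; have := H2 y (le_lt_trans yd dd2); have := lerB_dist (h y) (h x0); lra.
have MM : 0 <= M + M1 by rewrite addr_ge0.
pose C1 := 6 * (M + M1) / d + d * (`|h x0| + 1) / 4.
have C10 : 0 <= C1 by rewrite addr_ge0// divr_ge0// ?mulr_ge0 ?addr_ge0// ltW.
pose C := 3 * C1; have C0 : 0 <= C by rewrite mulr_ge0.
(* Two points of the box of radius [d / 3] differ by at most [2 d / 3 < d], the step allowed in
   [wsol_lip]. *)
have d3 : d / 3 <= d by move: d0; lra.
have lipw w : (forall x, K x -> `|w x| <= M + M1) -> (forall x, O0 x -> ctn (w \o @sphere_proj R) x) ->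
    has_lap O0 (w \o @sphere_proj R) h -> forall y z, `|y - x0| <= d / 3 -> `|z - x0| <= d / 3 ->
    `|w (sphere_proj y) - w (sphere_proj z)| <= C * `|y - z|.
  move=> wM cw wh; apply: (@lip_box _ (w \o @sphere_proj R)) => // y i s yd sd.
  have s2 : `|s| < d.
    rewrite -(norm_Zee s i) (_ : s *: ee i = (y + s *: ee i - x0) - (y - x0)); last first.
      by apply/rowP => k; rewrite !mxE; ring.
    by apply: le_lt_trans (ler_normB _ _) _; move: yd sd d0; lra.
  rewrite mulrC.
  apply: (@wsol_lip _ O0 (w \o @sphere_proj R) h x0 i d (M + M1) (`|h x0| + 1) s y) => //.
  - exact: has_lap_wsol.
  - by move=> z /dO/O0K/K0G/G_K/wM.
  - exact: le_trans yd d3.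
pose u := perron \o @sphere_proj R.
have Kbox y : `|y - x0| <= d / 3 -> K (sphere_proj y).
  by move=> yd; apply/G_K/K0G/O0K/dO; move: yd d0; lra.
have lipu y z : `|y - x0| <= d / 3 -> `|z - x0| <= d / 3 -> u y <= u z + C * `|y - z|.
  move=> yd zd; apply: perron_le => v Sv; have [w [Sw vw wM cw wh]] := lift0 v Sv.
  have := lipw w wM cw wh y z yd zd; have := perron_ub Sw (Kbox z zd).
  by have := vw (sphere_proj y); rewrite /u /= ler_norml; lra.
exists [set y : V3 | `|y - x0| < d / 3]; split.
- exact: open_box.
- by rewrite /= subrr normr0 divr_gt0.
- by move=> y /= yd; apply: O0C; apply: dO; move: yd d0; lra.
move=> e e0; pose B := [set y : V3 | `|y - x0| <= d / 3].
have e30 : 0 < e / 3 by rewrite divr_gt0.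
(* The upward sections of the directed family generate a filter. Compactness along it turns the
   pointwise approximation of the supremum into a single member that is [e]-close on the whole
   box. *)
pose FF := filter_from perron_class (fun v => [set w | perron_class w /\ forall x, v x <= w x]).
have fFF : Filter FF.
  apply: filter_from_filter; first by exists v0.
  move=> v w Sv Sw; exists (fun x => Num.max (v x) (w x)); first exact: perron_class_max.
  by move=> t [St mt]; split; split => // x; apply: le_trans (mt x); rewrite le_max lexx ?orbT.
have cB : compact B := @compact_box _ x0 (d / 3).
have := cB; move=> /compact_near_coveringP/(_ _ FF (fun w y => B y -> u y - e <= w (sphere_proj y)) fFF).
move=> /(_ _) Hcov; have {Hcov} : \forall w \near FF, B `<=` (fun y => B y -> u y - e <= w (sphere_proj y)).
  apply: Hcov => y By.
  have [_ [v Sv <-] vy] : exists2 t, [set v (sphere_proj y) | v in perron_class] t & u y - e / 3 < t.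
    apply: sup_adherent => //; split; first by exists (v0 (sphere_proj y)), v0.
    by exists M => _ [w Sw <-]; apply: HM => //; exact: Kbox.
  have [w [Sw vw wM cw wh]] := lift0 v Sv.
  pose dl := e / (3 * (C + 1)); have dl0 : 0 < dl by rewrite divr_gt0// mulr_gt0// ltr_wpDl.
  have Cdl : C * dl <= e / 3.
    rewrite /dl mulrA ler_pdivrMr ?mulr_gt0 ?ltr_wpDl//.
    by move: e0 C0; nra.
  exists (ball y dl, [set t | perron_class t /\ forall x, w x <= t x]); first split => /=.
  - exact: nbhsx_ballx.
  - by exists w.
  move=> [z t] /= [yz [St wt]] Bz.
  have zy : `|y - z| <= dl by move: yz; rewrite -ball_normE /= => /ltW.
  have := lipw w wM cw wh y z By Bz; have := lipu z y Bz By; rewrite [`|z - y|]distrC.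
  have := ler_wpM2l C0 zy; have := wt (sphere_proj z); have := vw (sphere_proj y).
  rewrite ler_norml; move: vy Cdl.
  move: (C * `|y - z|) (C * dl) => p q; lra.
move=> [v Sv Hv]; have [w [Sw vw wM cw wh]] := lift0 v Sv.
have {}Hv y : B y -> u y - e <= w (sphere_proj y) by move=> By; exact: (Hv w (conj Sw vw) y By By).
exists (w \o @sphere_proj R), h; split.
- by apply: has_lap_sub wh => y /= yd; apply: dO; move: yd d0; lra.
- by move=> y /= yd; apply: cw; apply: dO; move: yd d0; lra.
- move=> y /= /ltW yd; have := Hv y yd; have := perron_ub Sw (Kbox y yd); rewrite /u /= ler_norml; lra.
- by move=> y _; rewrite subrr normr0 ltW.
Qed.

Theorem perron_solution : exists N : set V3,
  [/\ open N, G `<=` N, C2on N (perron \o @sphere_proj R) &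
    forall x, G x -> lapl (perron \o @sphere_proj R) x = H x].
Proof.
pose P x := [set N : set V3 | [/\ open N, N x, N `<=` cone G &
  wsol N (perron \o @sphere_proj R) h]].
have NP x : G x -> P x (xget set0 (P x)) by move=> /perron_local; exact: xgetPex.
exists (\bigcup_(x in G) xget set0 (P x)); split.
- by apply: bigcup_open => x /NP[].
- by move=> x Gx; exists x => //; have [] := NP x Gx.
- move=> y [x Gx Ny]; have [oN Nx NG W] := NP x Gx.
  by have [C2 _] := wsol_regular oN W (fun y N1y => lH (NG y N1y)); exact: C2.
- move=> x Gx; have [oN Nx NG W] := NP x Gx.
  have [_ /(_ x Nx)->] := wsol_regular oN W (fun y N1y => lH (NG y N1y)).
  by rewrite /h proj_id ?sphere_enorm ?expr1n ?divr1//; exact: G_sphere.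
Qed.

Lemma perron_cont : {within K, continuous perron}.
Proof.
apply/withinP => x Kx e e0; have [Gx|nG] := pselect (G x); last first.
  by have [d d0 Hd] := perron_cont_bd (conj Kx nG) e0; exists d.
have [N [oN GN C2 _]] := perron_solution.
have [/ctnP/(_ _ e0)[d d0 Hd] _] := C2 x (GN _ Gx).
exists d => // y Ky yx; have := Hd y yx => /=.
by rewrite !proj_id//; exact: K_sphere.
Qed.

End Perron.

(** * Surface derivatives and uniqueness *)

Section Conversion.
Context {R : realType}.
Local Notation V3 := 'rV[R]_3.
Local Notation ext u := (u \o @sphere_proj R).

(** Continuous partial derivatives give all directional ones, by a path with three legs parallel to
    the axes. It is applied to the radial direction in [euler]. *)
Lemma dir_derive (f : V3 -> R) x v : (forall i, \forall y \near x, derivable f y (ee i)) ->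
  (forall i, ctn ('D_(ee i) f) x) -> is_derive x v f (\sum_i v 0 i * 'D_(ee i) f x).
Proof.
move=> df cf; pose i2 : 'I_3 := ord_max.
pose D i := 'D_(ee i) f x.
rewrite (_ : \sum_i _ = v 0 0 * D 0 + v 0 1 * D 1 + v 0 i2 * D i2); last exact: sum3.
set l : R := _ + _.
have key : forall e : R, 0 < e -> exists2 d : R, 0 < d & forall t : R, `|t| < d ->
    `|f (x + t *: v) - f x - t * l| <= 3 * (e * `|v|) * `|t|.
  move=> e e0.
  have Hi (i : 'I_3) : exists2 d : R, 0 < d & forall y, `|y - x| <= d ->
      derivable f y (ee i) /\ `|'D_(ee i) f y - D i| <= e.
    have [d1 d10 H1] := near_box (df i); have [d2 d20 H2] := (ctnP _ _).1 (cf i) _ e0.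
    exists (Num.min d1 (d2 / 2)); first by rewrite lt_min d10 divr_gt0.
    move=> y; rewrite le_min => /andP[y1 y2]; split; first exact: H1.
    by apply: H2; lra.
  have [d0 d00 H0] := Hi 0; have [d1 d10 H1] := Hi 1; have [d2 d20 H2] := Hi i2.
  have [d dd Hd] : exists2 d : R, 0 < d & d <= d0 /\ d <= d1 /\ d <= d2.
    exists (Num.min d0 (Num.min d1 d2)); first by rewrite !lt_min d00 d10 d20.
    by rewrite !ge_min !lexx !orbT.
  have v0 : 0 < `|v| + 1 by rewrite ltr_wpDl.
  exists (d / (`|v| + 1)); first by rewrite divr_gt0.
  move=> t; rewrite ltr_pdivlMr// => td.
  have tv : `|t| * `|v| <= d by have := normr_ge0 t; lra.
  pose w1 : V3 := x + (t * v 0 0) *: ee 0.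
  pose w2 : V3 := w1 + (t * v 0 1) *: ee 1.
  have cc : forall k : 'I_3, [\/ k = 0, k = 1 | k = i2].
    by move=> [[|[|[|//]]]] p; [apply: Or31|apply: Or32|apply: Or33]; apply/val_inj.
  have w3E : x + t *: v = w2 + (t * v 0 i2) *: ee i2.
    by apply/rowP => k; rewrite !coordD mxE [(t *: v) _ _]mxE; case: (cc k) => -> /=; ring.
  have q k : `|t * v 0 k| <= d.
    by rewrite normrM (le_trans _ tv)// ler_wpM2l// coord_norm.
  have n0 : `|x - x| <= d by rewrite subrr normr0 ltW.
  have n1 : `|w1 - x| <= d.
    apply: norm_coord_le => [|k]; first exact: ltW.
    rewrite mxE [(- x) 0 k]mxE coordD addrC addKr.
    by case: (k == 0); rewrite ?mulr1 ?mulr0 ?normr0 ?q//; exact: ltW.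
  have n2 : `|w2 - x| <= d.
    apply: norm_coord_le => [|k]; first exact: ltW.
    rewrite mxE [(- x) 0 k]mxE !coordD.
    have -> (r1 r2 r3 : R) : r1 + r2 + r3 - r1 = r2 + r3 by ring.
    by case: (cc k) => -> /=; rewrite ?mulr1 ?mulr0 ?addr0 ?add0r ?normr0 ?q//; exact: ltW.
  have n3 : `|w2 + (t * v 0 i2) *: ee i2 - x| <= d.
    by rewrite -w3E addrC addKr normrZ.
  have b i di y : d <= di -> (forall y, `|y - x| <= di ->
      derivable f y (ee i) /\ `|'D_(ee i) f y - D i| <= e) -> `|y - x| <= d ->
      `|y + (t * v 0 i) *: ee i - x| <= d ->
      `|f (y + (t * v 0 i) *: ee i) - f y - D i * (t * v 0 i)| <= e * `|v| * `|t|.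
    move=> di1 Hdi y1 y2.
    have h := @deriv_box _ f x d (D i) e i y (t * v 0 i) (fun z Hz => (Hdi z (le_trans Hz di1)).1)
      (fun z Hz => (Hdi z (le_trans Hz di1)).2) y1 y2.
    apply: (le_trans h); rewrite -mulrA; apply: ler_wpM2l; first exact: ltW.
    by rewrite normrM mulrC; apply: ler_wpM2r => //; exact: coord_norm.
  have k1 := b 0 d0 x Hd.1 H0 n0 n1.
  have k2 := b 1 d1 w1 Hd.2.1 H1 n1 n2.
  have k3 := b i2 d2 w2 Hd.2.2 H2 n2 n3.
  rewrite -/w1 in k1; rewrite -/w2 in k2.
  rewrite w3E /l; set F3 := f _ in k3 *.
  have tri (a b0 c q0 : R) : `|a| <= q0 -> `|b0| <= q0 -> `|c| <= q0 -> `|a + b0 + c| <= 3 * q0.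
    by have := ler_normD (a + b0) c; have := ler_normD a b0; lra.
  have -> : F3 - f x - t * (v 0 0 * D 0 + v 0 1 * D 1 + v 0 i2 * D i2) =
    (f w1 - f x - D 0 * (t * v 0 0)) + (f w2 - f w1 - D 1 * (t * v 0 1)) +
    (F3 - f w2 - D i2 * (t * v 0 i2)).
    by move: (F3) (f w2) (f w1) (f x) (D 0) (D 1) (D i2) => *; ring.
  by rewrite -[3 * _ * _]mulrA; exact: tri.
suff C : h^-1 *: ((f \o shift x) (h *: v) - f x) @[h --> 0^'] --> l.
  by split; [apply/cvg_ex; exists l|exact: (cvg_lim (@Rhausdorff _) C)].
apply/cvgrPdist_le => e e0; have v0 : 0 < `|v| + 1 by rewrite ltr_wpDl.
have t30 : 0 < 3 :> R by [].
have [d d0 Hd] := key (e / (3 * (`|v| + 1))) (divr_gt0 e0 (mulr_gt0 t30 v0)).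
rewrite near_withinE near_simpl; apply/nbhs_ballP; exists d => //= t.
rewrite /ball/= sub0r normrN => td t0.
have h := Hd t td; rewrite [t *: v + x]addrC.
have tp : 0 < `|t| by rewrite normr_gt0.
rewrite -(ler_pM2l tp) -normrM mulrBr /GRing.scale/= mulrA mulfV// mul1r distrC.
rewrite (le_trans h)// mulrC ler_wpM2l//.
rewrite (_ : 3 * _ = e * (`|v| / (`|v| + 1))); last by field; rewrite gt_eqF.
by rewrite ger_pMr// ler_pdivrMr// mul1r lerDl ler01.
Qed.

(** A function of degree 0 has derivatives of degree -1: rescaling the line through [x] leads back
    to the sphere. *)
Lemma ext_derive (u : V3 -> R) x v : x != 0 -> derivable (ext u) (sphere_proj x) v ->
  is_derive x v (ext u) ((enorm x)^-1 * 'D_v (ext u) (sphere_proj x)).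
Proof.
move=> x0 /derivableP/is_derive_line0 D; apply/is_derive_line0.
have r0 : 0 < enorm x by rewrite enorm_gt0.
have E : (fun s : R => ext u (x + s *: v)) =
    fun s => ext u (sphere_proj x + ((enorm x)^-1 * s) *: v).
  apply/funext => s /=; rewrite -[in RHS](projZ _ r0) scalerDr {2}/sphere_proj !scalerA.
  by rewrite mulrA mulfV ?gt_eqF// mul1r !scale1r.
rewrite E mulrC.
apply: (@is_derive1_comp _ (fun s => ext u (sphere_proj x + s *: v)) (fun s => (enorm x)^-1 * s)).
  by rewrite mulr0.
by eapply is_derive_eq; [dtac|rewrite /=; ring].
Qed.

Lemma ext_radial (u : V3 -> R) x : 'D_x (ext u) x = 0.
Proof.
suff [] : is_derive x x (ext u) 0 by [].
apply/is_derive_line0.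
apply: (near_eq_is_derive (f := fun=> u (sphere_proj x))).
near=> s => /=; rewrite -{2}[x]scale1r -scalerDl projZ//.
have : `|s| < 1 by near: s; apply/nbhs_ballP; exists 1 => //= s; rewrite /ball/= sub0r normrN.
by rewrite ltr_norml; lra.
Unshelve. all: by end_near. Qed.

Lemma within_ext (G : set V3) (f : V3 -> R) x : open (cone G) -> cone G x -> {within G, continuous f} ->
  ctn (ext f) x.
Proof.
move=> oC [x0 Gx] /withinP cf; apply/ctnP => e e0; have [d d0 Hd] := cf _ Gx e e0.
have nG : \forall y \near x, G (sphere_proj y).
  by apply: filterS (open_nbhs_nbhs (conj oC (conj x0 Gx))) => y [].
have nB : \forall y \near x, `|sphere_proj y - sphere_proj x| < d.
  apply: (near_proj (P := [set y | `|y - sphere_proj x| < d])) => //.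
  by apply/nbhs_ballP; exists d => //= y; rewrite -ball_normE /= distrC.
have [d' d'0 H'] := near_box (filterI nG nB).
by exists d' => // y /ltW/H'[Gy yd]; exact: Hd.
Qed.

Lemma ctn_near_eq (f g : V3 -> R) x : (\forall y \near x, g y = f y) -> ctn g x -> ctn f x.
Proof.
move=> E /ctnP cg; apply/ctnP => e e0; have [d d0 Hd] := cg e e0; have [d' d'0 H'] := near_box E.
have xx : `|x - x| <= d' by rewrite subrr normr0 ltW.
exists (Num.min d d'); first by rewrite lt_min d0.
by move=> y; rewrite lt_min => /andP[h1 /ltW h2]; rewrite -(H' _ h2) -(H' _ xx); exact: Hd.
Qed.

Section OnCone.
Context (G : set V3) (GS : G `<=` sphere R) (oC : open (cone G)).

Lemma cone_id x : G x -> cone G x.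
Proof. by move=> Gx; split; [exact: sphere_neq0 (GS Gx)|rewrite proj_id//; exact: GS]. Qed.

Lemma near_cone x : cone G x -> \forall y \near x, cone G y.
Proof. by move=> Cx; exact: open_nbhs_nbhs. Qed.

Lemma surf_gradE (u : V3 -> R) i : (fun x => surf_grad u x 0 i) = 'D_(ee i) (ext u).
Proof. by apply/funext => x; rewrite mxE. Qed.

Section C1.
Context (u : V3 -> R).
Context (du : forall i x, G x -> derivable (ext u) x (ee i)).

Lemma cone_derive i x : cone G x ->
  is_derive x (ee i) (ext u) ((enorm x)^-1 * 'D_(ee i) (ext u) (sphere_proj x)).
Proof. by move=> [x0 Gx]; apply: ext_derive => //; exact: du. Qed.

Context (cu : forall i, {within G, continuous 'D_(ee i) (ext u)}).

Lemma cone_derive_ctn i x : cone G x -> ctn ('D_(ee i) (ext u)) x.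
Proof.
move=> Cx; pose g (y : V3) := (enorm y)^-1 * ext ('D_(ee i) (ext u)) y.
suff cg : ctn g x.
  have E : \forall y \near x, g y = 'D_(ee i) (ext u) y.
    by apply: filterS (near_cone Cx) => y /(cone_derive i)[_ ->].
  exact: ctn_near_eq E cg.
have x0 : enorm x != 0 by rewrite gt_eqF// enorm_gt0; case: Cx.
apply: ctnM; first by apply: ctnV => //; apply: ctn_enorm; exact: ctnid.
exact: (@within_ext G _ x oC Cx (@cu i)).
Qed.

(** [beltrami] differentiates the gradient components extended with degree 0, whereas the gradient
    of the ray-constant extension has degree -1. On the sphere the two second order operators differ
    exactly by this radial sum. *)
Lemma euler x : cone G x -> \sum_i x 0 i * 'D_(ee i) (ext u) x = 0.
Proof.
move=> Cx; rewrite -[RHS](ext_radial u x).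
have [] : is_derive x x (ext u) (\sum_i x 0 i * 'D_(ee i) (ext u) x); last by [].
apply: dir_derive => i; last exact: cone_derive_ctn.
by apply: filterS (near_cone Cx) => y /(cone_derive i)[].
Qed.

End C1.
Lemma sphere_C1P (u : V3 -> R) : sphere_C 1 G u ->
  (forall i x, G x -> derivable (ext u) x (ee i)) /\
  (forall i, {within G, continuous 'D_(ee i) (ext u)}).
Proof.
move=> [_ H]; split=> i; first by have [] := H i.
by have [_ /=] := H i; rewrite surf_gradE.
Qed.

Lemma sphere_C2_has_lap (u : V3 -> R) : sphere_C 2 G u ->
  exists2 L, has_lap (cone G) (ext u) L & forall x, G x -> L x = beltrami u x.
Proof.
move=> [cu Hu].
have du i x : G x -> derivable (ext u) x (ee i) by have [+ _] := Hu i; exact.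
have C1 i : sphere_C 1 G ('D_(ee i) (ext u)) by have [_] := Hu i; rewrite surf_gradE.
have cdu i : {within G, continuous 'D_(ee i) (ext u)} by have [] := C1 i.
pose s i := 'D_(ee i) (ext u).
have ds i x : G x -> derivable (ext (s i)) x (ee i) by have [+ _] := sphere_C1P (C1 i); exact.
pose h i (x : V3) := (enorm x)^-1 * ((enorm x)^-1 * 'D_(ee i) (ext (s i)) (sphere_proj x))
  + ext (s i) x * - ((x 0 i / enorm x) / enorm x ^+ 2).
exists (fun x => \sum_i h i x).
  exists (fun i (y : V3) => (enorm y)^-1 * ext (s i) y), h => x Cx; split=> // i.
  split; first by case: Cx => x0 Gx; apply: ext_derive => //; exact: du.
  have [x0 Gx] := Cx; have r0 : enorm x != 0 by rewrite gt_eqF// enorm_gt0.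
  apply: dvM; first by apply: dvV => //; exact: dv_enorm.
  by apply: ext_derive => //; exact: ds.
move=> x Gx; have Sx := GS Gx.
have -> : beltrami u x = \sum_i 'D_(ee i) (ext (s i)) x.
  by rewrite /beltrami /surf_div; apply: eq_bigr => i _; rewrite surf_gradE mxE.
apply/eqP; rewrite -subr_eq0 -sumrB; apply/eqP.
transitivity (- \sum_i x 0 i * 'D_(ee i) (ext u) x); last first.
  by rewrite (euler du cdu) ?oppr0//; exact: cone_id.
rewrite -sumrN; apply: eq_bigr => i _.
rewrite /h /= (proj_id Sx) (sphere_enorm Sx) expr1n invr1 !mul1r !mulr1 /s.
ring.
Qed.

Lemma C2on_sphere_C2 (N : set V3) (u : V3 -> R) : open N -> G `<=` N -> C2on N (ext u) ->
  sphere_C 2 G u /\ forall x, G x -> beltrami u x = lapl (ext u) x.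
Proof.
move=> oN GN Hu.
have du i x : G x -> derivable (ext u) x (ee i).
  by move=> /GN/Hu[_ /(_ i)[]].
have cw (f : V3 -> R) : (forall x, G x -> ctn f x) -> {within G, continuous f} by exact: within_ctn.
have cdu i : {within G, continuous 'D_(ee i) (ext u)}.
  by apply: cw => x /GN/Hu[_ /(_ i)[]].
pose s i := 'D_(ee i) (ext u).
(* The degree 0 extension of the degree -1 function [s i] is [|y| s_i y], so the product rule adds
   the term [x_j s_i]. *)
have sD i j x : G x -> is_derive x (ee j) (ext (s i)) ('D_(ee j) (s i) x + x 0 j * s i x).
  move=> Gx; have Cx := cone_id Gx.
  have E : \forall y \near x, enorm y * s i y = ext (s i) y.
    apply: filterS (near_cone Cx) => y Cy.
    have [_ De] := cone_derive du i Cy; rewrite [s i y]De mulrA mulfV ?mul1r// gt_eqF// enorm_gt0.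
    by case: Cy.
  apply: (near_eq_is_derive E).
  have Sx := GS Gx.
  have -> : 'D_(ee j) (s i) x + x 0 j * s i x = enorm x * 'D_(ee j) (s i) x + s i x * (x 0 j / enorm x).
    by rewrite sphere_enorm//; field.
  apply: dvM; first by apply: dv_enorm; rewrite sphere_enorm ?oner_neq0.
  by apply: derivableP; have [_ /(_ i)[_ _ /(_ j)[]]] := Hu _ (GN _ Gx).
split.
  split.
    apply/withinP => x Gx e e0; have [/ctnP/(_ e e0)[d d0 Hd] _] := Hu _ (GN _ Gx).
    by exists d => // y Gy yx; have /= := Hd y yx; rewrite !proj_id//; exact: GS.
  move=> i; split; first exact: du.
  rewrite surf_gradE; split; first exact: cdu.
  move=> j; split; first by move=> x Gx; have [] := sD i j x Gx.
  rewrite /= surf_gradE; apply: (withinP _ _).2 => x Gx.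
  have : ctn (fun y : V3 => 'D_(ee j) (s i) y + y 0 j * s i y) x.
    have [_ /(_ i)[_ c1 /(_ j)[_ c2]]] := Hu _ (GN _ Gx).
    by apply: ctnD => //; apply: ctnM => //; ctac.
  move=> /ctnP c e e0; have [d d0 Hd] := c e e0; exists d => // y Gy yx.
  have [_ ->] := sD i j x Gx; have [_ ->] := sD i j y Gy; exact: Hd.
move=> x Gx; rewrite /beltrami /surf_div.
transitivity (\sum_i ('D_(ee i) (s i) x + x 0 i * s i x)).
  by apply: eq_bigr => i _; rewrite surf_gradE mxE; have [_ ->] := sD i i x Gx.
by rewrite big_split /= (euler du cdu) ?addr0//; exact: cone_id.
Qed.

Lemma partials_loclip (O : set V3) (f : V3 -> R) : open O ->
  (forall i x, O x -> derivable f x (ee i)) -> (forall i x, O x -> ctn ('D_(ee i) f) x) ->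
  loclip O f.
Proof.
move=> oO df cf x Ox.
have [d0 d00 H0] := open_box_sub oO Ox.
have Hi i : exists2 d : R, 0 < d & forall y, `|y - x| < d -> `|'D_(ee i) f y - 'D_(ee i) f x| <= 1.
  by have /ctnP := cf i x Ox; apply.
have [d dd Hd] : exists2 d : R, 0 < d & forall y, `|y - x| <= d -> O y /\
    forall i, `|'D_(ee i) f y - 'D_(ee i) f x| <= 1.
  pose i2 : 'I_3 := ord_max.
  have cc : forall k : 'I_3, [\/ k = 0, k = 1 | k = i2].
    by move=> [[|[|[|//]]]] p; [apply: Or31|apply: Or32|apply: Or33]; apply/val_inj.
  have [a a0 Ha] := Hi 0; have [b b0 Hb] := Hi 1; have [c c0 Hc] := Hi i2.
  exists (Num.min d0 (Num.min a (Num.min b c)) / 2); first by rewrite divr_gt0// !lt_min d00 a0 b0.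
  set m := Num.min _ _ => y ym.
  have m0 : 0 < m by rewrite !lt_min d00 a0 b0.
  have : m <= m by []; rewrite {2}/m !le_min => /and4P[m1 m2 m3 m4].
  split; first by apply: H0; lra.
  by move=> k; case: (cc k) => ->; [apply: Ha|apply: Hb|apply: Hc]; lra.
pose C := (\sum_i `|'D_(ee i) f x|) + 1.
have C0 : 0 <= C by rewrite addr_ge0// sumr_ge0.
exists d => //; exists (3 * C); first by rewrite mulr_ge0.
apply: lip_box => // y i s yd sd.
have := @deriv_box _ f x d ('D_(ee i) f x) 1 i y s (fun z Hz => df i z (Hd z Hz).1)
  (fun z Hz => (Hd z Hz).2 i) yd sd.
rewrite mul1r => h.
have : `|f (y + s *: ee i) - f y| <= `|f (y + s *: ee i) - f y - 'D_(ee i) f x * s| + `|'D_(ee i) f x * s|.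
  by rewrite -{1}[_ - f y](subrK ('D_(ee i) f x * s)) ler_normD.
move=> /le_trans; apply; rewrite /C mulrDl mul1r addrC lerD//.
rewrite normrM ler_wpM2r// (bigD1 i)//= lerDl sumr_ge0//.
Qed.

(** Here the differentiability of [H] enters the existence proof. *)
Lemma C1_loclip (H : V3 -> R) : sphere_C 1 G H ->
  loclip (cone G) (fun x => H (sphere_proj x) / enorm x ^+ 2).
Proof.
move=> /[dup] -[cHG _] /sphere_C1P[dH cH].
have rn x : cone G x -> enorm x ^+ 2 != 0.
  by move=> [x0 _]; rewrite expf_neq0// gt_eqF// enorm_gt0.
have D i x : cone G x -> is_derive x (ee i) (fun x => H (sphere_proj x) / enorm x ^+ 2)
   (H (sphere_proj x) * - ((2 * x 0 i) / (enorm x ^+ 2) ^+ 2)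
     + (enorm x ^+ 2)^-1 * 'D_(ee i) (ext H) x).
  move=> Cx; have := rn x Cx; rewrite expf_eq0 /= => r0.
  have D1 : is_derive x (ee i) (ext H) ('D_(ee i) (ext H) x).
    by apply: derivableP; have [] := cone_derive dH i Cx.
  have D2 : is_derive x (ee i) (fun y => enorm y ^+ 2) (2 * x 0 i).
    have -> : 2 * x 0 i = 2%:R * enorm x ^+ 1 * (x 0 i / enorm x) by field.
    by apply: dvX; exact: dv_enorm.
  have D3 : is_derive x (ee i) (fun y => (enorm y ^+ 2)^-1) (- (2 * x 0 i / (enorm x ^+ 2) ^+ 2)).
    by apply: (dvV _ D2); exact: rn.
  by have := dvM D1 D3.
apply: partials_loclip => // i x Cx; first by have [] := D i x Cx.
have E : \forall y \near x, H (sphere_proj y) * - ((2 * y 0 i) / (enorm y ^+ 2) ^+ 2)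
     + (enorm y ^+ 2)^-1 * 'D_(ee i) (ext H) y = 'D_(ee i) (fun x => H (sphere_proj x) / enorm x ^+ 2) y.
  by apply: filterS (near_cone Cx) => y Cy; have [_ ->] := D i y Cy.
apply: (ctn_near_eq E).
have ce : ctn (fun y : V3 => enorm y) x by apply: ctn_enorm; exact: ctnid.
have r2 := rn x Cx.
have r4 : (enorm x ^+ 2) ^+ 2 != 0 by rewrite expf_neq0.
have cHx : ctn (fun y : V3 => H (sphere_proj y)) x.
  exact: (@within_ext G H x oC Cx cHG).
have cD := @cone_derive_ctn H dH (@cH) i x Cx.
by ctac.
Qed.

(** Adding a small multiple [d] of a function with negative Laplacian turns [U2] into a strict
    competitor. Any exterior point [c] serves as its pole; its sign is not controlled, so its bound
    [B] is paid twice. *)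
Lemma sphere_dirichlet_unique (O : set V3) (H U1 U2 : V3 -> R) c : open O -> G = sphere R `&` O ->
  sphere R c -> ~ closure G c ->
  {within closure G, continuous U1} -> {within closure G, continuous U2} ->
  sphere_C 2 G U1 -> sphere_C 2 G U2 ->
  (forall x, G x -> beltrami U1 x = H x) -> (forall x, G x -> beltrami U2 x = H x) ->
  (forall x, closure G x -> ~ G x -> U1 x = U2 x) ->
  forall x, closure G x -> U1 x <= U2 x.
Proof.
move=> oO GE Sc nKc c1 c2 C1 C2 H1 H2 bdE x Kx.
have [L1 hL1 L1E] := sphere_C2_has_lap C1; have [L2 hL2 L2E] := sphere_C2_has_lap C2.
have pc : pole G c by split.
pose f := pole_barrier c x.
have domK y : closure G y -> dom (- c) y by move=> Ky; exact: (pole_den GE pc Ky).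
have cf : {within closure G, continuous f} by exact: (@pole_barrier_within _ _ _ GE).
have [B B0 fB] := compact_fun_bounded (K_compact GE) cf.
apply/ler_addgt0Pr => e e0.
have [d d0 dB] : exists2 d : R, 0 < d & 2 * (d * B) <= e.
  have B1 : 0 < 2 * (B + 1) by rewrite mulr_gt0// ltr_wpDl.
  exists (e / (2 * (B + 1))); first by rewrite divr_gt0.
  rewrite (_ : 2 * _ = e * (B / (B + 1))); last by field; rewrite gt_eqF// ltr_wpDl.
  by rewrite ger_pMr// ler_pdivrMr ?mul1r ?lerDl ?ler01// ltr_wpDl.
pose ph y := ext U2 y + d * f y.
have phK y : closure G y -> ph y = U2 y + d * f y.
  by move=> Ky; rewrite /ph /= proj_id//; exact: (K_sphere GE).
have dfB y : closure G y -> `|d * f y| <= d * B.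
  by move=> Ky; rewrite normrM gtr0_norm// ler_wpM2l ?fB// ltW.
have lph : has_lap (cone G `&` dom (- c)) ph (fun y => L2 y + d * - (2 / den (- c) y ^+ 2)).
  apply: has_lapD; first by apply: has_lap_sub hL2 => y [].
  by apply: has_lapZ; apply: (has_lap_sub _ (pole_barrier_lap x pc)) => y [].
suff : U1 x <= ph x + d * B.
  by rewrite (phK x Kx); have := dfB x Kx; rewrite ler_norml => /andP[]; lra.
apply: (sph_comparison (K_compact GE) (@subset_closure _ G) _ _ _ _ _ _ lph (H := H) _ c1) => //.
- by move=> y; exact: (K_sphere GE).
- move=> y Gy; apply: filterS (near_G oO GE Gy) => z; exact: subset_closure.
- by apply: (lap_subsol oC _ hL1) => [y|y Gy]; [exact: cone_id|rewrite L1E// H1].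
- by apply: openI => //; exact: open_dom.
- by move=> y Gy; split; [exact: cone_id|apply: domK; exact: subset_closure].
- by move=> y [_ Dy]; rewrite /ph /= proj_proj /f pole_barrier_proj.
- move=> y Gy; rewrite L2E// H2// gtrDl mulrN oppr_lt0 mulr_gt0//.
  by rewrite divr_gt0// exprn_gt0//; apply: domK; exact: subset_closure.
- have cfd : {within closure G, continuous (fun y => U2 y + d * f y)}.
    apply: withinD => //; apply: withinM => //; apply: within_ctn => y _; exact: ctnC.
  apply/withinP => y Ky e' e'0; have [d' d'0 Hd] := (withinP _ _).1 cfd y Ky e' e'0.
  by exists d' => // z Kz zy; rewrite !phK//; exact: Hd.
- move=> y Ky nGy; rewrite phK// bdE//.
  by have := dfB y Ky; rewrite ler_norml => /andP[]; lra.
Qed.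

End OnCone.

End Conversion.

(** * Geometry of closed curves on the sphere *)

Section VectorCalculus.
Context {R : realType}.
Local Notation V3 := 'rV[R]_3.

Lemma dv_crd (f : R -> V3) (t : R) df i : is_derive t 1 f df -> is_derive t 1 (fun s => f s 0 i) (df 0 i).
Proof.
move=> [D <-]; split; first by have /derivable_mxP := D; apply.
by rewrite derive_mx// mxE.
Qed.

Lemma dv_dot (f k : R -> V3) (t : R) df dk : is_derive t 1 f df -> is_derive t 1 k dk ->
  is_derive t 1 (fun s => dotv (f s) (k s)) (dotv df (k t) + dotv (f t) dk).
Proof.
move=> Df Dk; have F i := dv_crd i Df; have Kk i := dv_crd i Dk.
have E : (fun s => dotv (f s) (k s)) = fun s => f s 0 0 * k s 0 0 + f s 0 1 * k s 0 1
    + f s 0 ord_max * k s 0 ord_max by apply/funext => s; rewrite dotvE.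
rewrite E; have := dvD (dvD (dvM (F 0) (Kk 0)) (dvM (F 1) (Kk 1))) (dvM (F ord_max) (Kk ord_max)).
by move=> D; apply: (is_derive_eq D); rewrite !dotvE; ring.
Qed.

Lemma dv_dotC (f : R -> V3) (n : V3) (t : R) df : is_derive t 1 f df ->
  is_derive t 1 (fun s => dotv (f s) n) (dotv df n).
Proof.
move=> D; have := dv_dot D (@is_derive_cst _ _ _ n t (1 : R)) => {}D.
by apply: (is_derive_eq D); rewrite !dotvE !mxE /=; ring.
Qed.

Lemma ctn_coords {T : topologicalType} (f : T -> V3) t :
  (forall i, ctn (fun s => f s 0 i) t) -> ctn f t.
Proof.
move=> cf.
have -> : f = fun s => f s 0 0 *: ee 0 + f s 0 1 *: ee 1 + f s 0 ord_max *: ee ord_max.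
  apply/funext => s; apply/rowP => k; rewrite !coordD mxE !mxE eqxx /=.
  by case: (ord3_cases k) => -> /=; ring.
by apply: ctnD; [apply: ctnD|]; apply: ctnZ; [exact: cf|exact: ctnC|exact: cf|exact: ctnC|exact: cf|exact: ctnC].
Qed.

Lemma ctn_crossv {T : topologicalType} (f k : T -> V3) t : ctn f t -> ctn k t ->
  ctn (fun s => crossv (f s) (k s)) t.
Proof.
move=> cf ck; apply: ctn_coords => i.
have F j : ctn (fun s => f s 0 j) t.
  by apply: (@ctn_comp _ _ _ (fun y : V3 => y 0 j) _ _ cf); exact: coord_continuous.
have K j : ctn (fun s => k s 0 j) t.
  by apply: (@ctn_comp _ _ _ (fun y : V3 => y 0 j) _ _ ck); exact: coord_continuous.
have E (a b c d : 'I_3) : ctn (fun s => f s 0 a * k s 0 b - f s 0 c * k s 0 d) t.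
  by apply: ctnB; exact: ctnM.
have E' (j : 'I_3) (h : T -> R) : (forall s, crossv (f s) (k s) 0 j = h s) -> ctn h t ->
    ctn (fun s => crossv (f s) (k s) 0 j) t.
  by move=> /funext ->.
case: (ord3_cases i) => ->.
- exact: (E' _ _ (fun s => crossv0 (f s) (k s)) (E 1 ord_max ord_max 1)).
- exact: (E' _ _ (fun s => crossv1 (f s) (k s)) (E ord_max 0 0 ord_max)).
- exact: (E' _ _ (fun s => crossv2 (f s) (k s)) (E 0 1 1 0)).
Qed.

(** Two applications of the mean value inequality along the segment, hence [M] in place of the sharp
    [M / 2]. *)
Lemma taylor2 (f f1 f2 : R -> R) (t h M : R) : (forall s : R, is_derive s 1 f (f1 s)) ->
  (forall s : R, is_derive s 1 f1 (f2 s)) -> (forall s, `|f2 s| <= M) ->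
  `|f (t + h) - f t - h * f1 t| <= M * h ^+ 2.
Proof.
move=> df df1 f2M; have M0 : 0 <= M by apply: le_trans (f2M 0).
pose k (r : R) := f (t + r * h) - r * h * f1 t.
have lin (r : R) : is_derive r 1 (fun r => t + r * h) h.
  by eapply is_derive_eq; [dtac|rewrite /=; ring].
have dk (r : R) : is_derive r 1 k (h * (f1 (t + r * h) - f1 t)).
  have D1 := @is_derive1_comp _ f (fun r => t + r * h) r _ _ (df _) (lin r).
  have D2 : is_derive r 1 (fun r => r * h * f1 t) (h * f1 t).
    by eapply is_derive_eq; [dtac|rewrite /=; ring].
  by apply: (is_derive_eq (dvB D1 D2)); ring.
have d1 (r : R) : 0 <= r <= 1 -> `|f1 (t + r * h) - f1 t| <= M * `|h|.
  move=> /andP[r0 r1]; have := @is_derive_bound _ (fun u => f1 (t + u * h)) _ 0 r (M * `|h|) r0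
    (fun u _ => @is_derive1_comp _ f1 (fun r => t + r * h) u _ _ (df1 _) (lin u)).
  rewrite mul0r addr0 subr0 => /(_ _)/le_trans; apply; last first.
    by rewrite ler_piMr// mulr_ge0.
  by move=> u _; rewrite normrM ler_wpM2r.
have := @is_derive_bound _ k _ 0 1 (M * h ^+ 2) ler01 (fun r _ => dk r).
rewrite /k !mul1r !mul0r addr0 subr0 subr0 mulr1 => /(_ _).
rewrite (_ : f (t + h) - h * f1 t - f t = f (t + h) - f t - h * f1 t); last by ring.
apply=> r r01; rewrite normrM -[h ^+ 2]real_normK ?num_real// expr2 mulrCA ler_wpM2l//.
exact: d1.
Qed.

Lemma clopen_connected (G O A : set V3) : open O -> G = sphere R `&` O -> connected A ->
  A `<=` sphere R -> (forall x, A x -> closure G x -> G x) -> (exists2 x, A x & G x) -> A `<=` G.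
Proof.
move=> oO GE cA AS AC [x Ax Gx].
suff <- : A `&` G = A by move=> y [].
apply: cA; first by exists x.
  by exists O => //; rewrite GE; apply/seteqP; split=> y [Ay]; [move=> []|]; split=> //; split=> //; exact: AS.
exists (closure G); first exact: closed_closure.
by apply/seteqP; split=> y [Ay Gy]; split=> //; [exact: subset_closure|exact: AC].
Qed.

Lemma path_connected (p : R -> V3) (a b : R) : (forall s, a <= s <= b -> ctn p s) ->
  connected (p @` [set s | a <= s <= b]).
Proof.
move=> cp; apply: connected_continuous_connected.
  by have := @segment_connected R a b; rewrite set_itvE.
by apply/continuous_in_subspaceT => s; rewrite inE => /cp.
Qed.

End VectorCalculus.

Section Periodic.
Context {R : realType} {T : Type}.

Lemma periodicz (f : R -> T) : (forall t, f (t + 1) = f t) -> forall (n : int) t, f (t + n%:~R) = f t.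
Proof.
move=> fp; have P (n : nat) t : f (t + n%:R) = f t.
  by elim: n t => [|n IH] t; rewrite ?addr0// -natr1 addrA fp.
case=> n t; first exact: P.
by rewrite NegzE mulrNz -[in RHS](subrK n.+1%:R t) P.
Qed.

Lemma period_shift (t0 t : R) : exists n : int, t0 <= t + n%:~R < t0 + 1.
Proof.
exists (- Num.floor (t - t0)); rewrite mulrNz.
have /andP[h1 h2] := floor_itv (t - t0); rewrite intrD in h2.
by apply/andP; split; lra.
Qed.

End Periodic.

Section Curve.
Context {R : realType}.
Local Notation V3 := 'rV[R]_3.

Lemma periodic_min (f : R -> R) : (forall t, f (t + 1) = f t) -> (forall t, ctn f t) ->
  exists m, forall t, f m <= f t.
Proof.
move=> fp cf; have cw : {within `[0, 1], continuous f} by apply: continuous_subspaceT => x; exact: cf.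
have [c _ cmin] := EVT_min ler01 cw.
exists c => t; have [n] := period_shift 0 t; rewrite add0r => /andP[n0 n1].
by rewrite -(periodicz fp n t); apply: cmin; rewrite in_itv/= n0 ltW.
Qed.

Lemma periodic_max (f : R -> R) : (forall t, f (t + 1) = f t) -> (forall t, ctn f t) ->
  exists m, forall t, f t <= f m.
Proof.
move=> fp cf; have [||m mf] := @periodic_min (fun t => - f t).
- by move=> t; rewrite fp.
- by move=> t; apply: ctnN; exact: cf.
- by exists m => t; rewrite -lerN2.
Qed.

Context (g : R -> V3) (C : set V3) (HC : C2_simple_closed_param g C) (CS : C `<=` sphere R).
Let g1 := derive1 g.
Let g2 := derive1 g1.

Lemma curve_period t : g (t + 1) = g t. Proof. by have [_ [_ + _ _]] := HC; exact. Qed.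

Lemma derive1_period (f : R -> V3) t : (forall t, f (t + 1) = f t) -> derive1 f (t + 1) = derive1 f t.
Proof.
move=> fp; rewrite !derive1E /derive.
suff -> : (fun h : R => h^-1 *: ((f \o shift (t + 1)) (h *: 1) - f (t + 1))) =
  (fun h : R => h^-1 *: ((f \o shift t) (h *: 1) - f t)) by [].
by apply/funext => h /=; rewrite addrA !fp.
Qed.

Lemma curve_period1 t : g1 (t + 1) = g1 t. Proof. exact: derive1_period curve_period. Qed.
Lemma curve_period2 t : g2 (t + 1) = g2 t. Proof. exact: derive1_period curve_period1. Qed.

Lemma curve_range t : C (g t).
Proof. by have [_ [_ _ _ <-]] := HC; exists t. Qed.

Lemma curve_sphere t : sphere R (g t). Proof. exact: CS (curve_range t). Qed.

Lemma curve_ex x : C x -> exists t, g t = x.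
Proof. by have [_ [_ _ _ <-]] := HC; case=> t _ <-; exists t. Qed.

Lemma dv_curve (t : R) : is_derive t 1 g (g1 t).
Proof. by have [[+ _ _] _] := HC => /(_ t) d; rewrite /g1 derive1E; exact: derivableP. Qed.

Lemma dv_curve1 (t : R) : is_derive t 1 g1 (g2 t).
Proof. by have [[_ + _] _] := HC => /(_ t) d; rewrite /g2 derive1E; exact: derivableP. Qed.

Lemma is_derive_ctn (f : R -> V3) (t : R) df : is_derive t 1 f df -> ctn f t.
Proof. by move=> [+ _] => /derivable1_diffP/differentiable_continuous. Qed.

Lemma ctn_curve (t : R) : ctn g t. Proof. exact: is_derive_ctn (dv_curve t). Qed.
Lemma ctn_curve1 (t : R) : ctn g1 t. Proof. exact: is_derive_ctn (dv_curve1 t). Qed.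
Lemma ctn_curve2 (t : R) : ctn g2 t. Proof. by have [[_ _ +] _] := HC => /(_ t). Qed.

Lemma curve_unit t : dotv (g t) (g t) = 1. Proof. exact: dotv_sphere (curve_sphere t). Qed.

Lemma curve_tangent t : dotv (g t) (g1 t) = 0.
Proof.
have [_] := dv_dot (dv_curve t) (dv_curve t).
rewrite (_ : (fun s => _) = fun=> 1); last by apply/funext => s; exact: curve_unit.
have [_ ->] := @dvC R _ (1 : R) t (1 : R).
by rewrite (dotvC (g1 t)) => E; lra.
Qed.

Lemma curve_speed t : 0 < enorm (g1 t).
Proof. by rewrite enorm_gt0; have [_ [+ _ _ _]] := HC; exact. Qed.

Lemma curve_inj t h : 0 < h -> h < 1 -> g (t + h) <> g t.
Proof.
move=> h0 h1 E; have [n] := period_shift 0 t; rewrite add0r.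
set u := t + n%:~R => /andP[u0 u1].
have Eu : g (u + h) = g u.
  by rewrite /u (periodicz curve_period) -addrA (addrC _ h) addrA (periodicz curve_period).
have [_ [_ _ inj _]] := HC.
have [uh|uh] := ltP (u + h) 1.
  have : u + h = u by apply: inj; rewrite ?u0 ?u1 ?uh ?andbT//; lra.
  lra.
have : u + h - 1 = u.
  by apply: inj; rewrite ?u0 ?u1 ?andbT//; [lra|rewrite -curve_period subrK].
lra.
Qed.

(** The unit vector tangential to the sphere and perpendicular to the curve. Its sign follows the
    parametrization; which side it points to is settled by the sign [e] of [collar_sides]. *)
Definition conormal t := (enorm (g1 t))^-1 *: crossv (g t) (g1 t).
Definition tangent t := (enorm (g1 t))^-1 *: g1 t.
Local Notation nu := conormal.
Local Notation tau := tangent.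

Lemma curve_speed0 t : enorm (g1 t) != 0. Proof. by rewrite gt_eqF// curve_speed. Qed.

Lemma conormal_unit t : dotv (nu t) (nu t) = 1.
Proof.
rewrite dotvZl dotvZr lagrange curve_unit curve_tangent -enorm_sq.
by field; exact: curve_speed0.
Qed.

Lemma tangent_unit t : dotv (tau t) (tau t) = 1.
Proof. by rewrite dotvZl dotvZr -enorm_sq; field; exact: curve_speed0. Qed.

Lemma conormal_curve t : dotv (g t) (nu t) = 0.
Proof. by rewrite dotvZr dot_crossl mulr0. Qed.

Lemma conormal_curve1 t : dotv (g1 t) (nu t) = 0.
Proof. by rewrite dotvZr dot_crossr mulr0. Qed.

Lemma tangent_curve t : dotv (g t) (tau t) = 0.
Proof. by rewrite dotvZr curve_tangent mulr0. Qed.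

Lemma tangent_curve1 t : dotv (g1 t) (tau t) = enorm (g1 t).
Proof. by rewrite dotvZr -enorm_sq; field; exact: curve_speed0. Qed.

Lemma conormal_tangent t : dotv (tau t) (nu t) = 0.
Proof. by rewrite dotvZl conormal_curve1 mulr0. Qed.

Lemma curve_frame x t : x = dotv x (g t) *: g t + dotv x (tau t) *: tau t + dotv x (nu t) *: nu t.
Proof.
exact: orthonormal_basis (curve_unit t) (tangent_unit t) (conormal_unit t) (tangent_curve t)
  (conormal_curve t) (conormal_tangent t).
Qed.

Lemma ctn_conormal t : ctn nu t.
Proof.
apply: ctnZ; last by apply: ctn_crossv; [exact: ctn_curve|exact: ctn_curve1].
by apply: ctnV; [exact: curve_speed0|apply: ctn_enorm; exact: ctn_curve1].
Qed.

Lemma dotv_abs (x y : V3) : `|dotv x y| <= enorm x * enorm y.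
Proof. by rewrite ler_norml dotv_le dotv_ge. Qed.

Lemma enorm_unit (n : V3) : dotv n n = 1 -> enorm n = 1.
Proof. by rewrite /enorm => ->; rewrite sqrtr1. Qed.

Lemma curve_chord s t (n : V3) : dotv n n = 1 -> dotv (g s - g t) n ^+ 2 <= 2 * (1 - dotv (g s) (g t)).
Proof.
move=> n1; have := dotv_abs (g s - g t) n; rewrite (enorm_unit n1) mulr1 => h.
have <- : enorm (g s - g t) ^+ 2 = 2 * (1 - dotv (g s) (g t)) by rewrite enorm_dist !curve_unit; ring.
by rewrite -[leLHS]real_normK ?num_real// ler_sqr ?nnegrE ?enorm_ge0.
Qed.

Lemma curve_taylor (n : V3) M t h : dotv n n = 1 -> (forall s, enorm (g2 s) <= M) ->
  `|dotv (g (t + h) - g t) n - h * dotv (g1 t) n| <= M * h ^+ 2.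
Proof.
move=> n1 HM; rewrite dotvBl.
apply: (@taylor2 R (fun s => dotv (g s) n) (fun s => dotv (g1 s) n) (fun s => dotv (g2 s) n)).
- by move=> s; exact: dv_dotC (dv_curve s).
- by move=> s; exact: dv_dotC (dv_curve1 s).
- by move=> s; apply: le_trans (dotv_abs _ _) _; rewrite (enorm_unit n1) mulr1.
Qed.

Lemma curve_dot_lt1 s t : g s != g t -> dotv (g s) (g t) < 1.
Proof. by move=> st; apply: sphere_dot_lt1 => //; exact: curve_sphere. Qed.

(** Injectivity on a period makes [1 - g(t + h).g(t)], half the squared chord, positive for [h] away
    from 0 and 1, and compactness makes this uniform. *)
Lemma curve_far d : 0 < d -> exists2 e : R, 0 < e & forall t h, d <= h -> h <= 1 - d ->
  e <= 1 - dotv (g (t + h)) (g t).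
Proof.
move=> d0; have [dd|dd] := leP d (1 - d); last by exists 1 => // t h h1 h2; lra.
pose f (p : R * R) := 1 - dotv (g (p.1 + p.2)) (g p.1).
have cf (p : R * R) : ctn f p.
  apply: ctnB; first exact: ctnC.
  have c1 : ctn (@fst R R) p by exact: cvg_fst.
  have c2 : ctn (@snd R R) p by exact: cvg_snd.
  apply: ctn_dotv; last by apply: (ctn_comp c1); exact: ctn_curve.
  by apply: (@ctn_comp _ _ _ g _ _ (ctnD c1 c2)); exact: ctn_curve.
pose A : set (R * R) := `[0, 1]%classic `*` `[d, 1 - d]%classic.
have cA : compact A by apply: compact_setX; exact: segment_compact.
have A0 : A !=set0 by exists (0, d); split => /=; rewrite in_itv/= ?lexx ?ler01.
have cw : {within A, continuous f} by apply: continuous_subspaceT => p; exact: cf.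
have [[a b] ab fmin] := compact_EVT_min A0 cA cw.
move: ab; rewrite inE => -[/=]; rewrite !in_itv/= => _ /andP[b1 b2].
exists (f (a, b)).
  rewrite /f /= subr_gt0; apply: curve_dot_lt1; apply/eqP; apply: curve_inj; lra.
move=> t h h1 h2; have [n] := period_shift 0 t; rewrite add0r => /andP[n0 n1].
have := fmin (t + n%:~R, h); rewrite inE => /(_ _) H.
have : f (a, b) <= f (t + n%:~R, h).
  by apply: H; split; rewrite /= in_itv/= ?n0 ?h1 ?h2//= ltW.
by rewrite {2}/f /= -addrA (addrC _ h) addrA !(periodicz curve_period).
Qed.

(** The curve leaves its tangent great circle at most quadratically. For nearby parameters Taylor's
    formula bounds the left side by [M h^2], while the chord gives [m^2 h^2 <= 8 (1 - g(s).g(t))];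
    for the others [curve_far] suffices. The constant [K] limits the caps that can touch the curve,
    see [pt_cap]. *)
Lemma curve_quad : exists2 K : R, 0 < K &
  forall s t, `|dotv (g s) (nu t)| <= K * (1 - dotv (g s) (g t)).
Proof.
have [M HM] : exists M, forall t, enorm (g2 t) <= M.
  have [tM HM] := @periodic_max (fun t => enorm (g2 t)) (fun t => congr1 _ (curve_period2 t))
    (fun t => ctn_enorm (@ctn_curve2 t)).
  by exists (enorm (g2 tM)).
have [m m0 Hm] : exists2 m, 0 < m & forall t, m <= enorm (g1 t).
  have [tm Hm] := @periodic_min (fun t => enorm (g1 t)) (fun t => congr1 _ (curve_period1 t))
    (fun t => ctn_enorm (@ctn_curve1 t)).
  by exists (enorm (g1 tm)) => //; exact: curve_speed.
have M0 : 0 <= M by apply: le_trans (HM 0); exact: enorm_ge0.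
(* For [|h| <= d] the second order term is at most [m |h| / 2], so the tangential displacement keeps
   at least half of [m |h|]. *)
pose d := m / (2 * (M + 1)).
have d0 : 0 < d by rewrite divr_gt0// mulr_gt0// ltr_wpDl.
have [e e0 He] := curve_far d0.
have g01 s t : 0 <= 1 - dotv (g s) (g t).
  rewrite subr_ge0; have := dotv_le (g s) (g t).
  by rewrite !(enorm_unit (curve_unit _)) mulr1.
pose K := 8 * M / m ^+ 2 + e^-1.
have K1 : 0 <= 8 * M / m ^+ 2 by apply: divr_ge0; [exact: mulr_ge0|exact: sqr_ge0].
have e1 : 0 < e^-1 by rewrite invr_gt0.
exists K; first by rewrite /K; lra.
have near t h : `|h| <= d -> `|dotv (g (t + h)) (nu t)| <= K * (1 - dotv (g (t + h)) (g t)).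
  move=> hd; have hM : M * `|h| <= m / 2.
    apply: (@le_trans _ _ (M * d)); first by rewrite ler_wpM2l.
    have -> : M * d = m / 2 * (M / (M + 1)) by rewrite /d; field; rewrite gt_eqF// ltr_wpDl.
    by rewrite ler_piMr ?divr_ge0 ?ltW// ltr_pdivrMr ?mul1r ?ltrDl// ltr_wpDl.
  have k1 := @curve_taylor (nu t) M t h (conormal_unit t) HM.
  rewrite conormal_curve1 mulr0 subr0 dotvBl conormal_curve subr0 in k1.
  apply: (le_trans k1).
  have k2 := @curve_taylor (tau t) M t h (tangent_unit t) HM.
  have k3 := curve_chord (t + h) t (tangent_unit t).
  rewrite tangent_curve1 in k2; move: k2 k3; set c := dotv (_ - _) _ => k2 k3.
  have k4 : m / 2 * `|h| <= `|c|.
    have : `|h * enorm (g1 t)| <= `|c| + M * h ^+ 2.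
      rewrite -[h * _](subKr c) (le_trans (ler_normB _ _))// lerD2l//.
    rewrite normrM (ger0_norm (enorm_ge0 _)) -[h ^+ 2]real_normK ?num_real// => k5.
    have : `|h| * m <= `|h| * enorm (g1 t) by rewrite ler_wpM2l.
    have : M * `|h| ^+ 2 <= m / 2 * `|h| by rewrite expr2 mulrA ler_wpM2r.
    lra.
  have k5 : (m / 2) ^+ 2 * h ^+ 2 <= c ^+ 2.
    rewrite -[c ^+ 2]real_normK ?num_real// -[h ^+ 2]real_normK ?num_real// -exprMn.
    by rewrite ler_sqr// nnegrE mulr_ge0// divr_ge0// ltW.
  have k6 : m ^+ 2 * h ^+ 2 <= 8 * (1 - dotv (g (t + h)) (g t)).
    by move: k5; rewrite exprMn exprVn; lra.
  apply: (@le_trans _ _ (8 * M / m ^+ 2 * (1 - dotv (g (t + h)) (g t)))); last first.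
    by rewrite ler_wpM2r// /K; lra.
  rewrite (_ : 8 * M / m ^+ 2 * _ = M / m ^+ 2 * (8 * (1 - dotv (g (t + h)) (g t)))); last first.
    by field; rewrite gt_eqF.
  apply: (@le_trans _ _ (M / m ^+ 2 * (m ^+ 2 * h ^+ 2))).
    by rewrite le_eqVlt; apply/orP; left; apply/eqP; field; rewrite gt_eqF.
  by apply: ler_wpM2l => //; apply: divr_ge0 => //; exact: sqr_ge0.
move=> s t; have [n /andP[n0 n1]] := period_shift t s.
pose h := s + n%:~R - t.
have -> : g s = g (t + h) by rewrite /h addrC subrK (periodicz curve_period).
have [hd|hd] := leP h d.
  by apply: near; rewrite ger0_norm// /h; lra.
have [h1d|h1d] := leP h (1 - d).
  have k := He t h (ltW hd) h1d; apply: (@le_trans _ _ 1).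
    have := dotv_abs (g (t + h)) (nu t).
    by rewrite (enorm_unit (curve_unit _)) (enorm_unit (conormal_unit _)) mulr1.
  apply: (@le_trans _ _ (e^-1 * (1 - dotv (g (t + h)) (g t)))).
    by rewrite mulrC ler_pdivlMr// mul1r.
  by rewrite ler_wpM2r// /K; lra.
have -> : g (t + h) = g (t + (h - 1)) by rewrite -(curve_period (t + (h - 1))) -addrA subrK.
by apply: near; rewrite ler_norml; apply/andP; rewrite /h in h1d *; split; lra.
Qed.

End Curve.

(** * The collar of a boundary curve *)

Lemma sphere_boundaryE (R : realType) (G O : set 'rV[R]_3) : open O -> G = sphere R `&` O ->
  sphere_boundary G = closure G `\` G.
Proof.
move=> oO GE; rewrite /sphere_boundary; have -> : sphere R `\` G = sphere R `&` ~` O.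
  by rewrite GE; apply/seteqP; split=> x [Sx nO]; split=> //; [move=> Ox; apply: nO|case].
have <- : sphere R `&` ~` O = closure (sphere R `&` ~` O).
  apply/closure_id; apply: closedI; [exact: closed_sphere|exact: open_closedC].
apply/seteqP; split=> x [Kx].
  by move=> [Sx nO]; split=> //; rewrite GE => -[].
by move=> nG; split=> //; split; [exact: (K_sphere GE)|move=> Ox; apply: nG; rewrite GE; split=> //; exact: (K_sphere GE)].
Qed.

Section Collar.
Context {R : realType}.
Local Notation V3 := 'rV[R]_3.

Lemma sqrt1D_gt0 (b : R) : 0 < Num.sqrt (1 + b ^+ 2).
Proof. by rewrite sqrtr_gt0 ltr_wpDr ?sqr_ge0. Qed.

Lemma sqrt1D_sq (b : R) : Num.sqrt (1 + b ^+ 2) ^+ 2 = 1 + b ^+ 2.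
Proof. by rewrite sqr_sqrtr// addr_ge0 ?sqr_ge0. Qed.

Lemma sqrt1D_inv_lt1 (b : R) : b != 0 -> (Num.sqrt (1 + b ^+ 2))^-1 < 1.
Proof.
move=> b0; have r0 := sqrt1D_gt0 b.
rewrite invf_lt1// -ltr_sqr ?nnegrE ?(ltW r0)// expr1n sqrt1D_sq ltrDl.
by rewrite lt_def sqr_ge0 sqrf_eq0 b0.
Qed.

Definition nrm (y n : V3) (b : R) : V3 := (Num.sqrt (1 + b ^+ 2))^-1 *: (y + b *: n).

Lemma nrm_sphere y n b : dotv y y = 1 -> dotv n n = 1 -> dotv y n = 0 -> sphere R (nrm y n b).
Proof.
move=> y1 n1 yn; have r0 := sqrt1D_gt0 b.
rewrite /sphere /= /enorm /nrm dotvZl dotvZr dotvDl !dotvDr !dotvZl !dotvZr y1 n1 (dotvC n y) yn.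
rewrite (_ : _ * _ = 1) ?sqrtr1//.
rewrite (_ : 1 + b * 0 + _ = Num.sqrt (1 + b ^+ 2) ^+ 2); last by rewrite sqrt1D_sq; ring.
by field; rewrite gt_eqF.
Qed.

Context (g : R -> V3) (C : set V3) (HC : C2_simple_closed_param g C) (CS : C `<=` sphere R).
Local Notation nu := (conormal g).
(** Normal coordinates near the curve, with [b] of either sign; the normalisation is that of
    [interior_limit]. *)
Definition pt t b := nrm (g t) (nu t) b.
Context (K : R) (K0 : 0 < K) (HK : forall s t, `|dotv (g s) (nu t)| <= K * (1 - dotv (g s) (g t))).

Let gu t := curve_unit HC CS t.
Let nuu t := conormal_unit HC CS t.
Let gnu t := conormal_curve g t.

Lemma pt_sphere t b : sphere R (pt t b). Proof. exact: nrm_sphere. Qed.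

Lemma pt_dot t b : dotv (g t) (pt t b) = (Num.sqrt (1 + b ^+ 2))^-1.
Proof. by rewrite /pt /nrm dotvZr dotvDr dotvZr gu gnu mulr0 addr0 mulr1. Qed.

(** The cap with centre [pt t b] and [g t] on its rim meets the curve only there: by the quadratic
    bound, the term [b * nu] changes the inner product by less than [1 - x.g(t)]. *)
Lemma pt_cap t b x : `|b| * K < 1 -> C x -> x != g t -> dotv x (pt t b) < dotv (g t) (pt t b).
Proof.
move=> bK /(curve_ex HC)[s <-{x}] st; rewrite pt_dot /pt /nrm dotvZr -[ltRHS]mulr1.
rewrite ltr_pM2l ?invr_gt0 ?sqrt1D_gt0// dotvDr dotvZr.
have k1 := curve_dot_lt1 HC CS st; have k2 := HK s t.
have : b * dotv (g s) (nu t) <= `|b| * K * (1 - dotv (g s) (g t)).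
  by rewrite (le_trans (ler_norm _))// normrM -mulrA ler_wpM2l.
have : `|b| * K * (1 - dotv (g s) (g t)) < 1 - dotv (g s) (g t).
  by rewrite gtr_pMl// subr_gt0.
lra.
Qed.

(** Otherwise [pt_cap], applied to the centre itself, would give [1 < dotv (g t) (pt t b)]. *)
Lemma pt_notin t b : b != 0 -> `|b| * K < 1 -> ~ C (pt t b).
Proof.
move=> b0 bK Cp; have r0 := sqrt1D_gt0 b.
have p1 : dotv (pt t b) (pt t b) = 1 by exact: dotv_sphere (pt_sphere t b).
have r1 : (Num.sqrt (1 + b ^+ 2))^-1 < 1.
  exact: sqrt1D_inv_lt1.
have ne : pt t b != g t.
  by apply/eqP => E; move: p1; rewrite {1}E pt_dot => E1; rewrite E1 ltxx in r1.
by have := pt_cap bK Cp ne; rewrite p1 pt_dot => /(lt_trans r1); rewrite ltxx.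
Qed.

Context (G O : set V3) (oO : open O) (GE : G = sphere R `&` O) (CE : C = closure G `\` G).

Lemma clopen_path (p : R -> V3) : (forall s : R, 0 <= s <= 1 -> ctn p s) ->
  (forall s : R, 0 <= s <= 1 -> sphere R (p s) /\ ~ C (p s)) -> G (p 0) -> G (p 1).
Proof.
move=> cp pSC G0; apply: (clopen_connected oO GE (path_connected cp)).
- by move=> _ [s s01 <-]; have [] := pSC s s01.
- move=> _ [s s01 <-] Kp; apply: contrapT => nG; have [_] := pSC s s01; apply.
  by rewrite CE.
- by exists (p 0) => //; exists 0 => //=; rewrite lexx ler01.
- by exists 1 => //=; rewrite lexx ler01.
Qed.

Lemma ctn_affine (a b s : R) : ctn (fun s : R => a + s * (b - a)) s.
Proof. by ctac. Qed.

(** Interpolating both coordinates linearly keeps the sign of [b] and the collar condition, so the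
    path avoids the curve, and [G] is relatively open and closed off the curve. *)
Lemma pt_side t t' a b : 0 < a * b -> `|a| * K < 1 -> `|b| * K < 1 -> G (pt t a) -> G (pt t' b).
Proof.
move=> ab aK bK Ga; pose T s := t + s * (t' - t); pose A s := a + s * (b - a).
have -> : pt t' b = pt (T 1) (A 1) by rewrite /T /A !mul1r ![_ + (_ - _)]addrC !subrK.
apply: (@clopen_path (fun s => pt (T s) (A s))).
- move=> s _; have cA : ctn A s by exact: ctn_affine.
  have cT : ctn T s by exact: ctn_affine.
  have cg : ctn (fun s => g (T s)) s by apply: (ctn_comp cT); exact: (ctn_curve HC).
  have cn : ctn (fun s => nu (T s)) s by apply: (ctn_comp cT); exact: (ctn_conormal HC).
  apply: ctnZ; last by apply: ctnD => //; exact: ctnZ.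
  apply: ctnV; first by rewrite gt_eqF// sqrt1D_gt0.
  by apply: (@ctn_comp _ _ _ (@Num.sqrt R) (fun s => 1 + A s ^+ 2)); [ctac|exact: sqrt_continuous].
- move=> s /andP[s0 s1]; split; first exact: pt_sphere.
  have As : A s = (1 - s) * a + s * b by rewrite /A; ring.
  have As0 : A s != 0.
    apply/eqP => E; have : A s * b = 0 by rewrite E mul0r.
    have : 0 < A s * b; last by move=> + E'; rewrite E' ltxx.
    rewrite As mulrDl -mulrA -mulrA; have b2 : 0 < b * b.
      by rewrite lt_def -expr2 sqr_ge0 andbT sqrf_eq0; apply/eqP => b0; rewrite b0 mulr0 ltxx in ab.
    have [s00|s00] := eqVneq s 0; first by rewrite s00 subr0 mul1r mul0r addr0.
    apply: ltr_wpDl; first by rewrite mulr_ge0 ?subr_ge0// ltW.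
    by rewrite mulr_gt0// lt_def s00.
  apply: pt_notin => //; apply: (@le_lt_trans _ _ ((1 - s) * (`|a| * K) + s * (`|b| * K))).
    rewrite As !mulrA -mulrDl; apply: ler_wpM2r; first exact: ltW.
    apply: le_trans (ler_normD _ _) _.
    by rewrite !normrM (ger0_norm s0) ger0_norm// subr_ge0.
  have [s00|s00] := eqVneq s 0; first by rewrite s00 subr0 mul1r mul0r addr0.
  have sp : 0 < s by rewrite lt_def s00.
  have : s * (`|b| * K) < s * 1 by rewrite ltr_pM2l.
  have : (1 - s) * (`|a| * K) <= (1 - s) * 1 by rewrite ler_wpM2l ?subr_ge0// ltW.
  by lra.
- by rewrite /T /A !mul0r !addr0.
Qed.

(* A point of [G] near the curve lies on the normal through the curve point closest to it. *)
Lemma pt_one_side b0 : 0 < b0 -> exists t b, [/\ b != 0, `|b| < b0 & G (pt t b)].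
Proof.
(* By [pt_dot] the inner product with [g t] determines [|b|]; [a0] is the threshold that corresponds
   to [|b| < b0]. *)
move=> b00; pose a0 := (Num.sqrt (1 + b0 ^+ 2))^-1.
have a00 : 0 < a0 by rewrite invr_gt0 sqrt1D_gt0.
have C0 := curve_range HC 0.
have Kg : closure G (g 0) by move: C0; rewrite CE => -[].
have [x [Gx xg]] : exists x, G x /\ a0 < dotv (g 0) x.
  have cd : ctn (fun x => dotv (g 0) x) (g 0) by apply: ctn_dotv; [exact: ctnC|exact: ctnid].
  have N : nbhs (g 0) [set x | a0 < dotv (g 0) x].
    apply: (cd [set r | a0 < r]); apply: open_nbhs_nbhs; split; first exact: open_gt.
    by rewrite /= gu; apply: sqrt1D_inv_lt1; rewrite gt_eqF.
  by have [x [Gx xN]] := Kg _ N; exists x.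
have Sx : sphere R x by move: Gx; rewrite GE => -[].
have [t tmax] : exists m : R, forall t, dotv (g t) x <= dotv (g m) x.
  apply: (@periodic_max R (fun t => dotv (g t) x)) => t; first by rewrite (curve_period HC).
  by apply: ctn_dotv; [exact: (ctn_curve HC)|exact: ctnC].
have xt : dotv x (tangent g t) = 0.
  have [D1 D2] := dv_dotC x (dv_curve HC t).
  have [_] : is_derive t 1 (fun t => dotv (g t) x) 0.
    apply: (@derive1_at_max _ _ (t - 1) (t + 1)); first by lra.
    - by move=> u _; have [] := dv_dotC x (dv_curve HC u).
    - by rewrite in_itv/=; apply/andP; split; lra.
    - by move=> u _; exact: tmax.
  by rewrite D2 dotvC => E; rewrite dotvZr E mulr0.
pose a := dotv x (g t); pose n := dotv x (nu t).
have xE : x = a *: g t + n *: nu t by rewrite {1}(curve_frame HC CS x t) xt scale0r addr0.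
have aa0 : a0 < a by rewrite /a dotvC; exact: lt_le_trans xg (tmax 0).
have ap : 0 < a by exact: lt_trans aa0.
have an : a ^+ 2 + n ^+ 2 = 1.
  rewrite -(dotv_sphere Sx); have : dotv x x = dotv x (a *: g t + n *: nu t) by rewrite -xE.
  by rewrite dotvDr !dotvZr => ->; rewrite /a /n /conormal !dotvZr; ring.
pose b := n / a.
have sb : Num.sqrt (1 + b ^+ 2) = a^-1.
  rewrite (_ : 1 + b ^+ 2 = (a^-1) ^+ 2); first by rewrite sqrtr_sqr gtr0_norm// invr_gt0.
  apply: (mulfI (x := a ^+ 2)); first by rewrite expf_neq0// gt_eqF.
  rewrite -exprMn mulfV ?gt_eqF// expr1n -[RHS]an /b.
  by field; rewrite gt_eqF.
have xb : pt t b = x.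
  by rewrite /pt /nrm sb invrK scalerDr scalerA /b mulrCA divff ?gt_eqF// mulr1 -xE.
exists t, b; split; last by rewrite xb.
  apply/eqP => b0E; have := curve_range HC t; rewrite CE => -[_]; apply.
  suff <- : x = g t by [].
  by rewrite -xb b0E /pt /nrm expr0n /= addr0 sqrtr1 invr1 scale1r scale0r addr0.
have -> : `|b| < b0 = (b ^+ 2 < b0 ^+ 2).
  by rewrite -[b ^+ 2]real_normK ?num_real// ltr_sqr ?nnegrE// ltW.
have h : a^-1 < Num.sqrt (1 + b0 ^+ 2) by rewrite -[ltRHS]invrK ltf_pV2 ?posrE.
have : (a^-1) ^+ 2 < Num.sqrt (1 + b0 ^+ 2) ^+ 2.
  by rewrite ltr_pXn2r// nnegrE; apply: ltW; rewrite ?invr_gt0// sqrt1D_gt0.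
by rewrite -sb !sqrt1D_sq ltrD2l.
Qed.

(* Otherwise the spherical segment from [x] to the exterior point [pt t b] would stay in the
   cap that touches the curve only at [g t]. *)
Lemma pt_barrier t b : b != 0 -> `|b| * K < 1 -> ~ closure G (pt t b) ->
  forall x, closure G x -> x != g t -> dotv x (pt t b) < dotv (g t) (pt t b).
Proof.
move=> b0 bK nKc x Kx xt; have [Cx|nCx] := pselect (C x); first exact: pt_cap.
have Gx : G x by apply: contrapT => nG; apply: nCx; rewrite CE.
rewrite ltNge; apply/negP => cx; apply: nKc; apply: subset_closure.
set c := pt t b in cx *; set m := dotv (g t) c in cx.
have m0 : 0 < m by rewrite /m pt_dot invr_gt0 sqrt1D_gt0.
have m1 : m < 1 by rewrite /m pt_dot sqrt1D_inv_lt1.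
have Sx := K_sphere GE Kx; have Sc : sphere R c by exact: pt_sphere.
pose q (s : R) := x + s *: (c - x).
have qc s : dotv (q s) c = dotv x c + s * (1 - dotv x c).
  by rewrite dotvDl dotvZl dotvBl (dotv_sphere Sc).
have xc1 : dotv x c <= 1.
  by have := dotv_le x c; rewrite (sphere_enorm Sx) (sphere_enorm Sc) mulr1.
have qm s : 0 <= s <= 1 -> m + s * (1 - m) <= dotv (q s) c.
  move=> /andP[s0 s1]; rewrite qc -subr_ge0.
  have -> : dotv x c + s * (1 - dotv x c) - (m + s * (1 - m)) = (1 - s) * (dotv x c - m) by ring.
  by rewrite mulr_ge0 ?subr_ge0.
have qm0 s : 0 <= s <= 1 -> 0 < dotv (q s) c.
  move=> s01; apply: lt_le_trans (qm s s01); have /andP[s0 _] := s01.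
  by rewrite ltr_pwDl// mulr_ge0// subr_ge0 ltW.
have q0 s : 0 <= s <= 1 -> q s != 0.
  by move=> /qm0; apply: contraTneq => ->; rewrite dotvE !mxE !mul0r !addr0 ltxx.
have q1 s : 0 <= s <= 1 -> enorm (q s) <= 1.
  move=> /andP[s0 s1]; have -> : q s = (1 - s) *: x + s *: c.
    by rewrite /q scalerBr scalerBl scale1r addrAC addrA.
  apply: le_trans (enormD _ _) _; rewrite (enormZ _ x) (enormZ _ c) (sphere_enorm Sx) (sphere_enorm Sc) !ger0_norm//.
    by rewrite !mulr1 subrK.
  by rewrite subr_ge0.
have pm s : 0 <= s <= 1 -> m + s * (1 - m) <= dotv (sphere_proj (q s)) c.
  move=> s01; apply: (le_trans (qm s s01)); rewrite /sphere_proj dotvZl mulrC.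
  by rewrite ler_pMr ?qm0// invf_ge1 ?q1// enorm_gt0 q0.
have -> : c = sphere_proj (q 1) by rewrite /q scale1r addrC subrK proj_id.
apply: (@clopen_path (fun s => sphere_proj (q s))).
- move=> s s01; apply: (@ctn_comp _ _ _ (@sphere_proj R) q); last exact: ctn_proj (q0 s s01).
  by apply: ctnD; [exact: ctnC|apply: ctnZ; [exact: ctnid|exact: ctnC]].
- move=> s s01; split; first exact: proj_sphere (q0 s s01).
  move=> Cq; have := pm s s01; have [E|ne] := eqVneq (sphere_proj (q s)) (g t).
    rewrite E -/m gerDl pmulr_lle0 ?subr_gt0// => s0.
    have {}s0 : s = 0 by apply/eqP; rewrite eq_le s0; have /andP[] := s01.
    by move/eqP: xt; apply; rewrite -E s0 /q scale0r addr0 proj_id.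
  have := pt_cap bK Cq ne; rewrite -/c -/m => h1 h2.
  have /andP[s0 _] := s01; have : 0 <= s * (1 - m) by rewrite mulr_ge0// subr_ge0 ltW.
  by move: h1 h2; lra.
- by rewrite /q scale0r addr0 proj_id.
Qed.

End Collar.

(** * Separation by the winding number *)

Section Primitive.
Context {R : realType}.

Lemma primitive_ex (f : R -> R) (a : R) : (forall t, ctn f t) ->
  exists F : R -> R, forall t : R, a < t -> is_derive t 1 F (f t).
Proof.
move=> cf; pose F (x : R) := (\int[@lebesgue_measure R]_(t in [set` `[a, x]]) (f t))%R.
exists F => t at_.
have fi : (@lebesgue_measure R).-integrable `[a, t + 1] (EFin \o f).
  apply: continuous_compact_integrable; first exact: segment_compact.
  by apply: continuous_subspaceT => x; exact: cf.
have t1 : t < t + 1 by rewrite ltrDl.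
have [D1 D2] := continuous_FTC1_closed t1 fi at_ (cf t).
by split; [exact: D1|rewrite -[RHS]D2; exact/esym/derive1E].
Qed.

Lemma is_derive_ge (F f : R -> R) (a b k : R) : a <= b ->
  (forall t : R, a <= t <= b -> is_derive t 1 F (f t)) -> (forall t, a <= t <= b -> k <= f t) ->
  k * (b - a) <= F b - F a.
Proof.
move=> ab df fk.
have [||c] := @MVT_segment R F f a b ab.
- by move=> x; rewrite in_itv/= => /andP[/ltW x1 /ltW x2]; apply: df; rewrite x1 x2.
- apply: derivable_within_continuous => x; rewrite in_itv/= => xab.
  by have [] := df _ xab.
by rewrite in_itv/= => cab ->; rewrite ler_wpM2r ?subr_ge0// fk.
Qed.

(* The integral of [f] over [[t0, t0 + 1]] (a junk value if [f] has no primitive) *)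
Definition pint (t0 : R) (f : R -> R) : R :=
  let F := xget (fun=> 0) [set F : R -> R | forall t : R, t0 - 1 < t -> is_derive t 1 F (f t)] in
  F (t0 + 1) - F t0.

Lemma pint_ex t0 (f : R -> R) : (forall t, ctn f t) -> exists2 F : R -> R,
  (forall t : R, t0 <= t <= t0 + 1 -> is_derive t 1 F (f t)) & pint t0 f = F (t0 + 1) - F t0.
Proof.
move=> cf; rewrite /pint; set P := [set F : R -> R | _].
have PF : P (xget (fun=> 0) P) by have := primitive_ex (t0 - 1) cf; exact: xgetPex.
by exists (xget (fun=> 0) P) => // t /andP[t1 _]; apply: PF; lra.
Qed.

End Primitive.

Section Kernel.
Context {R : realType}.
Local Notation V3 := 'rV[R]_3.

(** The linear dependence of four vectors of space, paired with [z]. In [dv_flux] it is used with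
    [z = g t] and with [z = x]. *)
Lemma quad4 (x e y w z : V3) : dotv x z * dotv e (crossv y w) - dotv e z * dotv x (crossv y w)
  + dotv y z * dotv x (crossv e w) - dotv w z * dotv x (crossv e y) = 0.
Proof. by rewrite !dotvE !crossE; ring. Qed.

Lemma triple_rot (x y z : V3) : dotv x (crossv y z) = dotv z (crossv x y).
Proof. by rewrite !dotvE !crossE; ring. Qed.

Context (g : R -> V3) (C : set V3) (HC : C2_simple_closed_param g C) (CS : C `<=` sphere R).
Local Notation g1 := (derive1 g).

(* Up to normalisation [ker x] is the rate at which the great circle arc from [x] to [g t] turns
   about [x]; it is constant along rays in [x]. *)
Definition kden (x : V3) t := enorm x - dotv x (g t).
Definition binormal t := crossv (g t) (g1 t).
Definition ker x t := dotv x (binormal t) / kden x t.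
Definition ker' i (x : V3) t := (binormal t 0 i * kden x t
  - dotv x (binormal t) * (x 0 i / enorm x - g t 0 i)) / kden x t ^+ 2.
Definition flux i (x : V3) t := dotv (g t) (crossv x (ee i)) / (enorm x * kden x t).

(** [x] is nonzero and lies on no ray through a curve point. For a unit [x] at angle [theta] from
    [g t], [ker] is [1 + cos theta] times the turning rate; this factor removes the singularity at
    the antipode of [x], so the curve is the only excluded set. *)
Definition admissible x := forall t, 0 < kden x t.

Lemma admissible_enorm x : admissible x -> 0 < enorm x.
Proof.
move=> /(_ 0) D; rewrite enorm_gt0; apply/eqP => x0.
by move: D; rewrite x0 /kden dotvE /enorm dotvE !mxE !mul0r !addr0 sqrtr0 subrr ltxx.
Qed.

Lemma ctn_binormal t : ctn binormal t.
Proof. by apply: ctn_crossv; [exact: (ctn_curve HC)|exact: (ctn_curve1 HC)]. Qed.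

Lemma ctn_kden {T : topologicalType} (X : T -> V3) (S : T -> R) p :
  ctn X p -> ctn S p -> ctn (fun p => kden (X p) (S p)) p.
Proof.
move=> cX cS; apply: ctnB; first exact: ctn_enorm.
by apply: ctn_dotv => //; apply: (ctn_comp cS); exact: (ctn_curve HC).
Qed.

Lemma ctn_ker x t : admissible x -> ctn (ker x) t.
Proof.
move=> ax; apply: ctnM; first by apply: ctn_dotv; [exact: ctnC|exact: ctn_binormal].
by apply: ctnV; [rewrite gt_eqF|apply: (@ctn_kden _ (fun=> x) id); [exact: ctnC|exact: ctnid]].
Qed.

Lemma dv_ker i x t : admissible x -> is_derive x (ee i) (ker^~ t) (ker' i x t).
Proof.
move=> ax; have x0 : enorm x != 0 by rewrite gt_eqF// admissible_enorm.
have D0 : kden x t != 0 by rewrite gt_eqF.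
have D1 : is_derive x (ee i) (kden^~ t) (x 0 i / enorm x - g t 0 i).
  exact: (dvB (dv_enorm i x0) (dv_dotv x i (g t))).
have D2 := dvM (dv_dotv x i (binormal t)) (@dvV _ _ (kden^~ t) x (ee i) _ D0 D1).
by apply: (is_derive_eq D2); rewrite /ker'; field; rewrite x0 D0.
Qed.

(* The derivative of the kernel with respect to the point is an exact derivative along the curve. *)
Lemma dv_flux i x (t : R) : admissible x -> is_derive t 1 (flux i x) (ker' i x t).
Proof.
move=> ax; have x0 : enorm x != 0 by rewrite gt_eqF// admissible_enorm.
have D0 : kden x t != 0 by rewrite gt_eqF.
have D1 := dv_dotC (crossv x (ee i)) (dv_curve HC t).
have D2 : is_derive t 1 (kden x) (- dotv x (g1 t)).
  have E : kden x = fun s => enorm x - dotv (g s) x by apply/funext => s; rewrite /kden dotvC.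
  rewrite E; apply: (is_derive_eq (dvB (dvC _ _ _) (dv_dotC x (dv_curve HC t)))).
  by rewrite sub0r dotvC.
have D3 : is_derive t 1 (fun s => enorm x * kden x s) (enorm x * - dotv x (g1 t)).
  by apply: (is_derive_eq (dvM (dvC _ _ _) D2)); rewrite mulr0 addr0.
have rD0 : enorm x * kden x t != 0 by rewrite mulf_neq0.
apply: (is_derive_eq (dvM D1 (@dvV _ _ (fun s => enorm x * kden x s) t 1 _ rD0 D3))).
have I1 := quad4 x (ee i) (g t) (g1 t) (g t).
have I2 := quad4 x (ee i) (g t) (g1 t) x.
have dg t' : dotv (g1 t') (g t') = 0 by rewrite dotvC; exact: (curve_tangent HC CS t').
rewrite (curve_unit HC CS t) dg mul0r subr0 mul1r in I1.
rewrite -enorm_sq in I2.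
rewrite /ker' -!(triple_rot x (ee i)).
have -> : binormal t 0 i = dotv (ee i) (crossv (g t) (g1 t)) by rewrite dotvC dotv_ee.
have -> : x 0 i = dotv (ee i) x by rewrite dotvC dotv_ee.
have -> : g t 0 i = dotv (ee i) (g t) by rewrite dotvC dotv_ee.
rewrite (dotvC (g1 t) x) (dotvC (g t) x) in I2.
move: I1 I2 D0 x0; rewrite /kden /binormal.
move: (dotv x (g t)) (dotv (ee i) (crossv (g t) (g1 t))) (dotv (ee i) (g t))
  (dotv x (crossv (g t) (g1 t))) (dotv x (crossv (ee i) (g1 t))) (dotv (ee i) x)
  (dotv x (g1 t)) (dotv x (crossv (ee i) (g t))) (enorm x) => p A q B E u w Z r I1 I2 D0 x0.
apply/eqP; rewrite -subr_eq0; apply/eqP.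
have -> : Z * - (r * - w / (r * (r - p)) ^+ 2) + (r * (r - p))^-1 * E
  - (A * (r - p) - B * (u / r - q)) / (r - p) ^+ 2 =
  (r * (p * A - q * B + E) - (r ^+ 2 * A - u * B + p * E - w * Z)) / (r * (r - p) ^+ 2).
  by field; rewrite x0 D0.
by rewrite I1 I2 mulr0 subr0 mul0r.
Qed.

Lemma flux_period i x t : flux i x (t + 1) = flux i x t.
Proof. by rewrite /flux /kden (curve_period HC). Qed.

Lemma kden_lip x z t : `|kden z t - kden x t| <= 2 * enorm (z - x).
Proof.
rewrite /kden (_ : _ - _ - _ = (enorm z - enorm x) - dotv (z - x) (g t)); last by rewrite dotvBl; ring.
apply: le_trans (ler_normB _ _) _.
have := dotv_abs (z - x) (g t); rewrite (enorm_unit (curve_unit HC CS t)) mulr1.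
suff : `|enorm z - enorm x| <= enorm (z - x) by lra.
have h1 := enormD (z - x) x; have h2 := enormD (x - z) z.
rewrite !subrK in h1 h2; have : enorm (x - z) = enorm (z - x) by rewrite -enormN opprB.
by move=> E; rewrite ler_norml; apply/andP; split; lra.
Qed.

Lemma admissible_box x : admissible x ->
  exists2 d : R, 0 < d & forall z, `|z - x| <= d -> admissible z.
Proof.
move=> ax; have [m Hm] : exists m : R, forall t, kden x m <= kden x t.
  apply: (@periodic_min R (kden x)) => t; first by rewrite /kden (curve_period HC).
  by apply: (@ctn_kden _ (fun=> x) id); [exact: ctnC|exact: ctnid].
(* [kden] has Lipschitz constant 2 for the Euclidean norm, hence 6 for the sup norm, so half of the
   minimum survives. *)
exists (kden x m / 12); first by rewrite divr_gt0.
move=> z zx t; have := kden_lip x z t; have := enorm_le_norm (z - x); have := Hm t.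
by have := ax m; rewrite ler_norml => + + + /andP[]; lra.
Qed.

Lemma ctn_ker' i (p : V3 * R) : admissible p.1 -> ctn (fun p => ker' i p.1 p.2) p.
Proof.
move=> ap.
have c1 : ctn (@fst V3 R) p by exact: cvg_fst.
have c2 : ctn (@snd V3 R) p by exact: cvg_snd.
have ck : ctn (fun p : V3 * R => kden p.1 p.2) p by exact: ctn_kden.
have cb : ctn (fun p : V3 * R => binormal p.2) p by apply: (ctn_comp c2); exact: ctn_binormal.
have cg : ctn (fun p : V3 * R => g p.2) p by apply: (ctn_comp c2); exact: (ctn_curve HC).
have ce : ctn (fun p : V3 * R => enorm p.1) p by exact: ctn_enorm.
have cd : ctn (fun p : V3 * R => dotv p.1 (binormal p.2)) p by exact: ctn_dotv.
have crd (h : V3 * R -> V3) : ctn h p -> ctn (fun p => h p 0 i) p.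
  by move=> ch; apply: (@ctn_comp _ _ _ (fun y : V3 => y 0 i) _ _ ch); exact: coord_continuous.
have x0 : enorm p.1 != 0 by rewrite gt_eqF// admissible_enorm.
have k0 : kden p.1 p.2 != 0 by rewrite gt_eqF.
have cb' := crd _ cb; have cg' := crd _ cg; have c1' := crd _ c1.
apply: ctnM; last by apply: ctnV; [rewrite expf_neq0|exact: ctnX].
apply: ctnB; first exact: ctnM.
by apply: ctnM => //; apply: ctnB => //; apply: ctnM => //; exact: ctnV.
Qed.

Definition winding t0 x := pint t0 (ker x).

(** Differentiation under the integral gives the integral of [ker' i x] over a period, which
    vanishes because [flux i x] is a periodic primitive of it. *)
Lemma winding_partial t0 x i : admissible x -> is_derive x (ee i) (winding t0) 0.
Proof.
move=> ax; have [d d0 Hd] := admissible_box ax.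
suff key : forall e : R, 0 < e -> exists2 d : R, 0 < d & forall u : R, `|u| < d ->
    `|winding t0 (x + u *: ee i) - winding t0 x| <= e * `|u|.
  suff Cv : h^-1 *: ((winding t0 \o shift x) (h *: ee i) - winding t0 x) @[h --> 0^'] --> (0 : R).
    by split; [apply/cvg_ex; exists 0|exact: (cvg_lim (@Rhausdorff _) Cv)].
  apply/cvgrPdist_le => e e0; have [d' d'0 H'] := key e e0.
  rewrite near_withinE near_simpl; apply/nbhs_ballP; exists d' => //= u.
  rewrite /ball/= sub0r normrN => ud u0; rewrite sub0r normrN [u *: ee i + x]addrC.
  have up : 0 < `|u| by rewrite normr_gt0.
  by rewrite /GRing.scale/= normrM normfV mulrC ler_pdivrMr// H'.
move=> e e0.
pose B := [set y : V3 | `|y - x| <= d] `*` `[t0, t0 + 1]%classic.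
have cB : compact B by apply: compact_setX; [exact: compact_box|exact: segment_compact].
have cw : {within B, continuous (fun p : V3 * R => ker' i p.1 p.2)}.
  apply/continuous_in_subspaceT => p; rewrite inE => -[/= p1 _].
  by apply: ctn_ker'; exact: Hd.
have [d1 d10 H1] := heine_cantor cB cw e0.
exists (Num.min d (d1 / 2)); first by rewrite lt_min d0 divr_gt0.
move=> u; rewrite lt_min => /andP[ud u1].
have au : admissible (x + u *: ee i).
  by apply: Hd; rewrite addrC addKr norm_Zee ltW.
have [F dF FE] := pint_ex t0 (fun t => @ctn_ker x t ax).
have [F' dF' FE'] := pint_ex t0 (fun t => @ctn_ker _ t au).
rewrite /winding FE FE'.
(* By periodicity the subtracted [flux] does not change the increment over the period, while it
   reduces the derivative to a remainder of size [e * |u|]. *)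
pose k (t : R) := F' t - F t - u * flux i x t.
have -> : F' (t0 + 1) - F' t0 - (F (t0 + 1) - F t0) = k (t0 + 1) - k t0.
  by rewrite /k flux_period; ring.
have := @is_derive_bound _ k (fun t => ker (x + u *: ee i) t - ker x t - u * ker' i x t) t0 (t0 + 1) (e * `|u|).
rewrite lerDl ler01 => /(_ isT).
rewrite (_ : t0 + 1 - t0 = 1) ?mulr1; last by ring.
apply=> t tt.
  apply: (dvB (dvB (dF' t tt) (dF t tt))).
  by apply: (is_derive_eq (dvM (dvC u _ _) (dv_flux i t ax))); rewrite mulr0 addr0.
have xB y : `|y - x| <= `|u| -> B (y, t).
  by move=> yx; split => /=; [apply: le_trans yx (ltW ud)|rewrite in_itv].
rewrite [u * _]mulrC.
apply: (@deriv_box _ (ker^~ t) x `|u|).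
- by move=> y yx; have [|] := @dv_ker i y t; first by apply: Hd; exact: le_trans yx (ltW ud).
- move=> y yx; have [|_ ->] := @dv_ker i y t; first by apply: Hd; exact: le_trans yx (ltW ud).
  apply: (H1 (y, t) (x, t) (xB _ yx)); first by apply: xB; rewrite subrr normr0.
  split => /=; last exact: ballxx.
  by rewrite -ball_normE /=; apply: le_lt_trans yx _; lra.
- by rewrite subrr normr0.
- by rewrite addrC addKr norm_Zee.
Qed.

Lemma winding_locally t0 x : admissible x ->
  exists2 d : R, 0 < d & forall y, `|y - x| <= d -> admissible y /\ winding t0 y = winding t0 x.
Proof.
move=> ax; have [d d0 Hd] := admissible_box ax; exists d => // y yd; split; first exact: Hd.
apply/eqP; rewrite -subr_eq0 -normr_le0 -[leRHS](mul0r `|y - x|) -{1}[0](mulr0 3).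
apply: (@lip_box _ _ x d 0) => //; last by rewrite subrr normr0 ltW.
move=> z i s zd zsd; have := @deriv_box _ (winding t0) x d 0 0 i z s.
rewrite !mul0r subr0; apply=> // w wd.
  by have [] := winding_partial t0 i (Hd w wd).
by have [_ ->] := winding_partial t0 i (Hd w wd); rewrite subrr normr0.
Qed.

Lemma winding_const t0 (A : set V3) x y : connected A -> A `<=` admissible -> A x -> A y ->
  winding t0 x = winding t0 y.
Proof.
move=> cA Aa Ax Ay.
pose P (c : bool) := [set z | admissible z /\ (winding t0 z == winding t0 y) = c].
have oP c : open (P c).
  rewrite openE => z [az wz]; have [d d0 Hd] := winding_locally t0 az.
  by apply/nbhs_ballP; exists d => //= w; rewrite -ball_normE /= distrC => /ltW/Hd[aw ww]; split; rewrite ?ww.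
suff E : A `&` P true = A by move: Ax; rewrite -E => -[_ [_ /eqP]].
apply: cA; first by exists y; split=> //; split; [exact: Aa|rewrite eqxx].
  by exists (P true).
exists (~` P false); first exact: open_closedC.
apply/seteqP; split=> z [Az]; first by move=> [_ wz]; split=> // -[_]; rewrite wz.
move=> nP; split=> //; split; first exact: Aa.
by apply: contra_notT nP => /negbTE wz; split=> //; exact: Aa.
Qed.

Lemma kerZ k x : 0 < k -> ker (k *: x) = ker x.
Proof.
move=> k0; apply/funext => t; rewrite /ker /kden enormZ gtr0_norm// !dotvZl -mulrBr.
by rewrite invfM mulrACA mulfV ?mul1r// gt_eqF.
Qed.

Context (K : R) (K0 : 0 < K)
  (HK : forall s t, `|dotv (g s) (conormal g t)| <= K * (1 - dotv (g s) (g t))).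

Section Jump.
Context (t0 : R).
Let y := g t0.
Let N := conormal g t0.
Let L := enorm (g1 t0).
Let a t := dotv y (binormal t).
Let b t := dotv N (binormal t).
Let q t := dotv N (g t).

(** At [t0] the expression equals [L], since [a t0 = 0] and [b t0 = L]; continuity does the rest. *)
Lemma jump_near : exists2 d : R, 0 < d & forall h, `|h| < d -> L / 2 <= b (t0 + h) - K * `|a (t0 + h)|.
Proof.
pose f t := b t - K * `|a t|.
have ct (v : V3) t : ctn (fun t => dotv v (binormal t)) t.
  by apply: ctn_dotv; [exact: ctnC|exact: ctn_binormal].
have cf : ctn f t0.
  by apply: ctnB; [exact: ct|apply: ctnM; [exact: ctnC|apply: ctn_norm; exact: ct]].
have L0 : 0 < L by exact: (curve_speed HC).
have f0 : f t0 = L.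
  rewrite /f /a /y /binormal dot_crossl normr0 mulr0 subr0 /b /N /conormal dotvZl lagrange.
  rewrite (curve_unit HC CS) (curve_tangent HC CS) -enorm_sq -/L expr0n subr0 mul1r expr2 mulrA.
  by rewrite mulVf ?mul1r// gt_eqF.
have : \forall t \near t0, L / 2 < f t.
  apply: (cf [set r | L / 2 < r]); apply: open_nbhs_nbhs; split; first exact: open_gt.
  by rewrite /= f0; lra.
move=> /nbhs_ballP[d /= d0 Hd]; exists d => // h hd; apply: ltW; apply: Hd.
by rewrite /ball/= opprD addrA subrr sub0r normrN.
Qed.

Section Fixed.
Context (b0 : R) (b00 : 0 < b0) (bK : b0 * K <= 1 / 2).
Let r := Num.sqrt (1 + b0 ^+ 2).
Let p t := r - dotv y (g t).

Lemma chord_ge0 t : 0 <= 1 - dotv y (g t).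
Proof.
rewrite subr_ge0; have := dotv_le y (g t).
by rewrite !(enorm_unit (curve_unit HC CS _)) mulr1.
Qed.

Lemma jump_r : 1 < r.
Proof. by have := sqrt1D_inv_lt1 (lt0r_neq0 b00); rewrite invf_lt1// sqrt1D_gt0. Qed.

Lemma jump_p t : 1 - dotv y (g t) < p t. Proof. by have := jump_r; rewrite /p; lra. Qed.

Lemma jump_p0 t : 0 < p t. Proof. exact: le_lt_trans (chord_ge0 t) (jump_p t). Qed.

Lemma jump_q t : `|q t| <= K * p t.
Proof.
rewrite /q dotvC (le_trans (HK t t0))// ler_pM2l//; apply: ltW.
by have := jump_p t; rewrite (dotvC y).
Qed.

Lemma jump_bq t : `|b0 * q t| <= p t / 2.
Proof.
rewrite normrM gtr0_norm//; apply: (@le_trans _ _ (b0 * (K * p t))).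
  by rewrite ler_pM2l// jump_q.
by rewrite mulrA mulrC ler_pM2l ?jump_p0//; move: bK; rewrite mul1r.
Qed.

Lemma jump_enorm e : e ^+ 2 = 1 -> enorm (y + (e * b0) *: N) = r.
Proof.
move=> e1; have uy : dotv y y = 1 by exact: (curve_unit HC CS t0).
have uN : dotv N N = 1 by exact: (conormal_unit HC CS t0).
have yN : dotv y N = 0 by exact: (conormal_curve g t0).
clearbody y N; rewrite /enorm dotvDl !dotvDr !dotvZl !dotvZr uy uN (dotvC N) yN /r; congr Num.sqrt.
by transitivity (1 + e ^+ 2 * b0 ^+ 2); [ring|rewrite e1 mul1r].
Qed.

Lemma jump_kden e t : e ^+ 2 = 1 -> kden (y + (e * b0) *: N) t = p t - e * (b0 * q t).
Proof.
move=> e1; rewrite /kden jump_enorm// dotvDl (dotvZl _ N) /p /q; ring.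
Qed.

Lemma jump_den e t : e ^+ 2 = 1 -> p t / 2 <= p t - e * (b0 * q t).
Proof.
move=> e1; have := jump_bq t; rewrite ler_norml => /andP[h1 h2].
have : (e - 1) * (e + 1) = 0 by move: e1; rewrite -subr_sqr_1 => ->; rewrite subrr.
by move=> /eqP; rewrite mulf_eq0 => /orP[] /eqP E; [have -> : e = 1 by lra|have -> : e = -1 by lra]; lra.
Qed.

Lemma jump_admissible e : e ^+ 2 = 1 -> admissible (y + (e * b0) *: N).
Proof.
move=> e1 t; rewrite jump_kden//; have := jump_den t e1; have := jump_p0 t; lra.
Qed.

Let jump t := ker (y + (1 * b0) *: N) t - ker (y + ((-1) * b0) *: N) t.
Let num t := a t * q t + b t * p t.
Let dn t := p t ^+ 2 - (b0 * q t) ^+ 2.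

Lemma jump_dn t : p t ^+ 2 / 2 <= dn t /\ dn t <= p t ^+ 2.
Proof.
split; last by rewrite /dn gerBl sqr_ge0.
have : (b0 * q t) ^+ 2 <= (p t / 2) ^+ 2.
  rewrite -[(b0 * q t) ^+ 2]real_normK ?num_real// ler_sqr ?nnegrE ?jump_bq//.
  by rewrite divr_ge0// ltW// jump_p0.
by rewrite expr_div_n /dn; have := sqr_ge0 (p t); lra.
Qed.

(** The difference of [(a + b0 b) / (p - b0 q)] and [(a - b0 b) / (p + b0 q)] over a common
    denominator. *)
Lemma jumpE t : jump t = 2 * b0 * num t / dn t.
Proof.
have e1 : (1 : R) ^+ 2 = 1 by rewrite expr1n.
have e2 : (-1 : R) ^+ 2 = 1 by rewrite sqrrN expr1n.
have p0 := jump_p0 t; have d1 := jump_den t e1; have d2 := jump_den t e2.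
have [d3 _] := jump_dn t; have p2 : 0 < p t ^+ 2 by rewrite exprn_gt0.
rewrite /jump /ker !jump_kden// !dotvDl !(dotvZl _ N) -/(a t) -/(b t).
rewrite /num /dn; rewrite /dn in d3.
move: d1 d2 d3 p0 p2; move: (p t) (q t) (a t) (b t) => P Q A B d1 d2 d3 p0 p2.
have n1 : P - b0 * Q != 0 by rewrite gt_eqF//; lra.
have n2 : P + b0 * Q != 0 by rewrite gt_eqF//; lra.
have n3 : P ^+ 2 - (b0 * Q) ^+ 2 != 0 by rewrite gt_eqF//; lra.
rewrite !mul1r !mulN1r opprK mulNr.
by field; rewrite ?n1 ?n2 ?n3//.
Qed.

(** By [curve_quad], [|q| <= K p], so the hypothesis lets [b p] absorb [a q] and [num >= L p / 2];
    the denominator is at most [p^2]. *)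
Lemma jump_lb t : L / 2 <= b t - K * `|a t| -> b0 * L / p t <= jump t.
Proof.
move=> bt; rewrite jumpE; have p0 := jump_p0 t; have [d1 d2] := jump_dn t.
have L0 : 0 < L by exact: (curve_speed HC).
have p2 : 0 < p t ^+ 2 by rewrite exprn_gt0.
have dn0 : 0 < dn t by lra.
have n1 : L / 2 * p t <= num t.
  have h : - (`|a t| * (K * p t)) <= a t * q t.
    rewrite lerNl -mulNr; apply: le_trans (ler_norm _) _; rewrite normrM normrN.
    by apply: ler_wpM2l => //; exact: jump_q.
  have h2 : L / 2 * p t <= (b t - K * `|a t|) * p t by rewrite ler_pM2r.
  apply: (le_trans h2); have -> : num t = (b t - K * `|a t|) * p t + (a t * q t + `|a t| * (K * p t)).
    by rewrite /num; ring.
  by rewrite lerDl; move: h; rewrite -subr_ge0 opprK.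
rewrite ler_pdivlMr//; apply: (@le_trans _ _ (b0 * L / p t * p t ^+ 2)).
  by rewrite ler_wpM2l// divr_ge0 ?mulr_ge0// ltW.
rewrite (_ : _ * p t ^+ 2 = 2 * b0 * (L / 2 * p t)); last by field; rewrite gt_eqF.
by rewrite ler_pM2l// mulr_gt0.
Qed.

(** Away from the curve point [p >= e]; the numerator is at most [M (K + 1) p] and the denominator
    at least [p^2 / 2], so only the factor [b0] remains small. *)
Lemma jump_far M e t : 0 <= M -> enorm (binormal t) <= M -> 0 < e -> e <= 1 - dotv y (g t) ->
  - (4 * M * (K + 1) / e * b0) <= jump t.
Proof.
move=> M0 HM e0 He; rewrite jumpE; have p0 := jump_p0 t; have [d1 d2] := jump_dn t.
have p2 : 0 < p t ^+ 2 by rewrite exprn_gt0.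
have dn0 : 0 < dn t by lra.
have pe : e <= p t by apply: (le_trans He); exact: ltW (jump_p t).
have aM : `|a t| <= M.
  by apply: le_trans (dotv_abs _ _) _; rewrite (enorm_unit (curve_unit HC CS _)) mul1r.
have bM : `|b t| <= M.
  by apply: le_trans (dotv_abs _ _) _; rewrite (enorm_unit (conormal_unit HC CS _)) mul1r.
have nM : `|num t| <= M * (K + 1) * p t.
  apply: le_trans (ler_normD _ _) _; rewrite !normrM (gtr0_norm p0).
  have h1 : `|a t| * `|q t| <= M * (K * p t) by rewrite ler_pM// jump_q.
  have h2 : `|b t| * p t <= M * p t by rewrite ler_pM2r.
  lra.
have : `|2 * b0 * num t / dn t| <= 4 * M * (K + 1) / e * b0; last by rewrite ler_norml => /andP[].
rewrite normrM normfV (gtr0_norm dn0) ler_pdivrMr// normrM gtr0_norm ?mulr_gt0//.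
apply: (@le_trans _ _ (2 * b0 * (M * (K + 1) * p t))); first by rewrite ler_pM2l ?mulr_gt0.
apply: (@le_trans _ _ (4 * M * (K + 1) / e * b0 * (p t ^+ 2 / 2))); last first.
  rewrite ler_wpM2l// mulr_ge0 ?(ltW b00)// divr_ge0 ?(ltW e0)// !mulr_ge0// addr_ge0//.
  exact: ltW.
rewrite (_ : 4 * M * (K + 1) / e * b0 * (p t ^+ 2 / 2) = 2 * b0 * (M * (K + 1) * p t) * (p t / e)); last first.
  by field; rewrite gt_eqF.
rewrite ler_peMr//; last by rewrite ler_pdivlMr// mul1r.
by rewrite !mulr_ge0 ?(ltW b00) ?(ltW p0)// addr_ge0// ltW.
Qed.

Lemma jump_p_le M h : (forall s, enorm (derive1 g1 s) <= M) -> p (t0 + h) <= b0 ^+ 2 + M * h ^+ 2.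
Proof.
move=> HM; have := curve_taylor HC t0 h (curve_unit HC CS t0) HM.
rewrite (dotvC (g1 t0)) (curve_tangent HC CS) mulr0 subr0 dotvBl (curve_unit HC CS) -/y (dotvC _ y).
rewrite ler_norml => /andP[h1 _]; rewrite /p.
have : r <= 1 + b0 ^+ 2.
  rewrite -ler_sqr ?nnegrE ?(ltW (sqrt1D_gt0 _)) ?addr_ge0 ?sqr_ge0//.
  rewrite sqrt1D_sq expr2 ler_peMr// ?lerDl ?sqr_ge0// addr_ge0// sqr_ge0//.
lra.
Qed.

Lemma winding_diff : exists2 F : R -> R, (forall t : R, t0 <= t <= t0 + 1 -> is_derive t 1 F (jump t)) &
  winding t0 (pt g t0 b0) - winding t0 (pt g t0 (- b0)) = F (t0 + 1) - F t0.
Proof.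
have e1 : (1 : R) ^+ 2 = 1 by rewrite expr1n.
have e2 : (-1 : R) ^+ 2 = 1 by rewrite sqrrN expr1n.
have [F1 D1 E1] := pint_ex t0 (fun t => @ctn_ker _ t (jump_admissible e1)).
have [F2 D2 E2] := pint_ex t0 (fun t => @ctn_ker _ t (jump_admissible e2)).
exists (fun t => F1 t - F2 t); first by move=> t tt; exact: dvB (D1 t tt) (D2 t tt).
rewrite /winding /pt /nrm !kerZ ?invr_gt0 ?sqrt1D_gt0//.
rewrite mul1r in E1; rewrite mulN1r in E2; rewrite E1 E2; ring.
Qed.

End Fixed.

(* As [b0] tends to [0] the kernel difference is at least of order [1 / b0] on an interval of
   length [b0], nonnegative nearby and [O(b0)] on the rest of the period. *)
Lemma winding_jump c : 0 < c -> exists b0, [/\ 0 < b0, b0 < c &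
  winding t0 (pt g t0 b0) != winding t0 (pt g t0 (- b0))].
Proof.
move=> c0; have [d d0 Hd] := jump_near.
have bp t : binormal (t + 1) = binormal t.
  by rewrite /binormal (curve_period HC) (curve_period1 HC).
have L0 : 0 < L by exact: (curve_speed HC).
have [M1 HM1] : exists M, forall t, enorm (binormal t) <= M.
  have [|t|tM HM] := @periodic_max R (fun t => enorm (binormal t)); last by exists (enorm (binormal tM)).
    by move=> t; rewrite bp.
  by apply: ctn_enorm; exact: ctn_binormal.
have [M2 HM2] : exists M, forall t, enorm (derive1 g1 t) <= M.
  have [|t|tM HM] := @periodic_max R (fun t => enorm (derive1 g1 t)); last by exists (enorm (derive1 g1 tM)).
    by move=> t; rewrite (curve_period2 HC).
  by apply: ctn_enorm; exact: (ctn_curve2 HC).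
have M10 : 0 <= M1 by apply: le_trans (HM1 0); exact: enorm_ge0.
have M20 : 0 <= M2 by apply: le_trans (HM2 0); exact: enorm_ge0.
have d20 : 0 < d / 2 by rewrite divr_gt0.
have [e e0 He] := curve_far HC CS d20.
(* On [[t0, t0 + b0]], [jump_p_le] gives [p <= (1 + M2) b0^2], so the integrand is at least [A / b0]
   and contributes [A]. On the rest of the period the loss is at most [D * b0], which is chosen
   below [A]. *)
pose A := L / (1 + M2); pose D := 4 * M1 * (K + 1) / e.
have A0 : 0 < A by rewrite divr_gt0// ltr_pwDl.
have D0 : 0 <= D.
  by apply: divr_ge0; [rewrite !mulr_ge0// addr_ge0// ltW|exact: ltW].
have [b0 [[b00 b0c b0d b0K b0A] b01]] : exists b0 : R,
    [/\ 0 < b0, b0 < c, b0 < d, b0 * K <= 1 / 2 & D * b0 < A] /\ b0 <= 1.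
  pose m := Num.min (Num.min (c / 2) (d / 2)) (Num.min (Num.min 1 (1 / (2 * K))) (A / (2 * (D + 1)))).
  have D1 : 0 < 2 * (D + 1) by rewrite mulr_gt0// ltr_wpDl.
  have K2 : 0 < 2 * K by rewrite mulr_gt0.
  have m0 : 0 < m.
    by rewrite !lt_min ltr01 d20 (divr_gt0 c0)// (divr_gt0 ltr01 K2) (divr_gt0 A0 D1).
  have : m <= m by []; rewrite {2}/m !le_min => /andP[/andP[m1 m2] /andP[/andP[m3 m4] m5]].
  exists m; split=> //; split=> //; [lra|lra| |].
    by move: m4; rewrite ler_pdivlMr// => m4; lra.
  move: m5; rewrite ler_pdivlMr// => m5; have : 0 <= m * D by rewrite mulr_ge0// ltW.
  by lra.
exists b0; split=> //; apply/eqP => E.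
have [F dF FE] := winding_diff b00 b0K.
rewrite E subrr in FE.
pose J t := ker (y + (1 * b0) *: N) t - ker (y + ((-1) * b0) *: N) t.
have near h : `|h| < d -> L / 2 <= b (t0 + h) - K * `|a (t0 + h)| by exact: Hd.
have F1 : A / b0 * (t0 + b0 - t0) <= F (t0 + b0) - F t0.
  apply: (@is_derive_ge _ F J); first by rewrite lerDl ltW.
    by move=> t /andP[t1 t2]; apply: dF; apply/andP; split; lra.
  move=> t /andP[t1 t2]; have -> : t = t0 + (t - t0) by ring.
  have hb : `|t - t0| <= b0 by rewrite ler_norml; apply/andP; split; lra.
  apply: le_trans (jump_lb b00 b0K (near _ (le_lt_trans hb b0d))).
  have P0 := @jump_p0 b0 b00 (t0 + (t - t0)).
  have P1 := @jump_p_le b0 M2 (t - t0) HM2.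
  move: P0 P1; set P := _ - _ => P0 P1.
  have P2 : P <= (1 + M2) * b0 ^+ 2.
    apply: (le_trans P1); rewrite mulrDl mul1r lerD2l ler_wpM2l//.
    by rewrite -[leLHS]real_normK ?num_real// ler_sqr ?nnegrE ?(ltW b00).
  have M2p : 0 < 1 + M2 by rewrite ltr_pwDl.
  rewrite ler_pdivlMr// (_ : A / b0 * P = b0 * L * (P / ((1 + M2) * b0 ^+ 2))); last first.
    by rewrite /A; field; rewrite !gt_eqF.
  rewrite ler_piMr ?mulr_ge0 ?(ltW b00) ?(ltW L0)//.
  by rewrite ler_pdivrMr ?mul1r// mulr_gt0// exprn_gt0.
have F2 : - (D * b0) * (t0 + 1 - (t0 + b0)) <= F (t0 + 1) - F (t0 + b0).
  apply: (@is_derive_ge _ F J); first by rewrite lerD2l.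
    by move=> t /andP[t1 t2]; apply: dF; apply/andP; split; lra.
  have Dn : - (D * b0) <= 0 by rewrite oppr_le0 mulr_ge0// ltW.
  have nr t : L / 2 <= b t - K * `|a t| -> - (D * b0) <= J t.
    move=> H; apply: (le_trans Dn); apply: le_trans (jump_lb b00 b0K H).
    by apply: divr_ge0; [rewrite mulr_ge0// ltW|exact/ltW/(jump_p0 b00)].
  move=> t /andP[t1 t2]; have [h1|h1] := ltP (t - t0) d.
    have -> : t = t0 + (t - t0) by ring.
    by apply: nr; apply: near; rewrite ger0_norm; lra.
  have [h2|h2] := leP (t - t0) (1 - d / 2).
    apply: (jump_far b00 b0K M10 (HM1 t) e0).
    have -> : t = t0 + (t - t0) by ring.
    rewrite dotvC; apply: (He _ _ _ h2).
    by apply: le_trans h1; rewrite ler_piMr ?(ltW d0)// invf_le1 ?ler1n.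
  (* Near the end of the period the curve is back at [g t0]: [t - 1] is within [d] of [t0], and [a]
     and [b] have period 1. *)
  have n := near (t - t0 - 1); apply: nr.
  have -> : t = t0 + (t - t0 - 1) + 1 by ring.
  rewrite /b /a bp; apply: n; rewrite ltr_norml; apply/andP; split; lra.
have E1 : A / b0 * (t0 + b0 - t0) = A by field; rewrite gt_eqF.
rewrite E1 in F1.
have : 0 <= D * b0 * b0 by apply: mulr_ge0; [apply: mulr_ge0 => //|]; exact: ltW.
have -> : D * b0 * b0 = D * b0 - D * b0 * (t0 + 1 - (t0 + b0)) by ring.
lra.
Qed.

End Jump.
End Kernel.

(** * Sides of the boundary and the Dirichlet problem *)

Section Region.
Context {R : realType}.
Local Notation V3 := 'rV[R]_3.
Context (G O : set V3) (oO : open O) (GE : G = sphere R `&` O) (cG : connected G).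
Let bd := closure G `\` G.

Let bdS : bd `<=` sphere R. Proof. by move=> x [Kx _]; exact: (K_sphere GE). Qed.

(** One point of [G] near the curve fixes the sign [e], and [pt_side] spreads it along the whole
    curve. If the closure of [G] met the other side of the collar too, [G] would contain points on
    both sides, and [winding_const] would contradict [winding_jump]. *)
Lemma collar_sides (g : R -> V3) : C2_simple_closed_param g bd ->
  exists c e, [/\ 0 < c, e ^+ 2 = 1,
    forall t b, 0 < b -> b < c -> G (pt g t (e * b)),
    forall t b, 0 < b -> b < c -> ~ closure G (pt g t (- (e * b))) &
    forall t b, 0 < b -> b < c -> forall x, closure G x -> x != g t ->
      dotv x (pt g t (- (e * b))) < dotv (g t) (pt g t (- (e * b)))].
Proof.
move=> HC; have [K K0 HK] := curve_quad HC bdS.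
have bdE : bd = closure G `\` G by [].
pose c := 1 / K; have c0 : 0 < c by rewrite divr_gt0.
have [t1 [b1 [b10 b1c Gb1]]] := pt_one_side HC bdS GE bdE c0.
have cK b : `|b| < c -> `|b| * K < 1 by rewrite /c ltr_pdivlMr.
pose e := Num.sg b1.
have e2 : e ^+ 2 = 1 by rewrite /e sqr_sg b10.
have en b : 0 < b -> `|e * b| = b.
  by move=> b0; rewrite normrM normr_sg b10 mul1r gtr0_norm.
have G1 t b : 0 < b -> b < c -> G (pt g t (e * b)).
  move=> b0 bc; apply: (@pt_side _ _ _ HC bdS _ K0 HK _ _ oO GE bdE t1 t b1 (e * b) _ _ _ Gb1).
  - by rewrite mulrA (_ : b1 * e = `|b1|) ?mulr_gt0 ?normr_gt0// mulrC -normrEsg.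
  - exact: cK.
  - by apply: cK; rewrite en.
have G2 t b : 0 < b -> b < c -> ~ closure G (pt g t (- (e * b))).
  move=> b0 bc Kp; have eb0 : e * b != 0 by rewrite mulf_neq0 ?sgr_eq0// gt_eqF.
  have Gp : G (pt g t (- (e * b))).
    apply: contrapT => nG; apply: (pt_notin HC bdS HK (t := t) (b := - (e * b))).
    - by rewrite oppr_eq0.
    - by apply: cK; rewrite normrN en.
    - by split.
  (* Transport to the parameter 0, where [winding_jump] compares the two opposite points. *)
  have G2 b' : 0 < b' -> b' < c -> G (pt g 0 (- (e * b'))).
    move=> b'0 b'c; apply: (@pt_side _ _ _ HC bdS _ K0 HK _ _ oO GE bdE t 0 (- (e * b)) (- (e * b')) _ _ _ Gp).
    - by rewrite mulrNN mulrACA -expr2 e2 mul1r mulr_gt0.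
    - by apply: cK; rewrite normrN en.
    - by apply: cK; rewrite normrN en.
  have [b' [b'0 b'c /eqP]] := winding_jump HC bdS K0 HK 0 c0; apply.
  have adm : G `<=` admissible g.
    move=> x Gx s; have Sx : sphere R x by move: Gx; rewrite GE => -[].
    rewrite /kden (sphere_enorm Sx) subr_gt0; apply: sphere_dot_lt1 => //.
      exact: (curve_sphere HC bdS).
    by apply/eqP => E; have := curve_range HC s; rewrite -E => -[_].
  have H1 := G1 0 b' b'0 b'c; have H2 := G2 b' b'0 b'c.
  have : (e - 1) * (e + 1) = 0 by move: e2; rewrite -subr_sqr_1 => ->; rewrite subrr.
  move=> /eqP; rewrite mulf_eq0 => /orP[] /eqP E.
    have e1 : e = 1 by lra.
    by rewrite e1 !mul1r in H1 H2; exact: (winding_const HC bdS 0 cG adm H1 H2).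
  have e1 : e = -1 by lra.
  by rewrite e1 !mulN1r opprK in H1 H2; exact: (winding_const HC bdS 0 cG adm H2 H1).
exists c, e; split=> // t b b0 bc; apply: (pt_barrier HC bdS HK oO GE bdE _ _ (G2 t b b0 bc)).
  by rewrite oppr_eq0 mulf_neq0 ?sgr_eq0// gt_eqF.
by apply: cK; rewrite normrN en.
Qed.

Lemma outer_normal_ex (g : R -> V3) y : C2_simple_closed_param g bd -> sphere_boundary G = bd ->
  bd y -> exists n, is_outer_normal G y n.
Proof.
move=> HC sbE /(curve_ex HC)[t <-{y}]; have [c [e [c0 e2 _ H2 _]]] := collar_sides HC.
have un := conormal_unit HC bdS t.
exists (- e *: conormal g t); split.
- by rewrite enormZ (enorm_unit un) mulr1 normrN -sqrtr_sqr e2 sqrtr1.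
- by rewrite dotvZl dotvC conormal_curve mulr0.
- exists g, t; split; rewrite ?sbE//.
  by rewrite dotvZl dotvC conormal_curve1 mulr0.
- near=> b; have -> : (Num.sqrt (1 + b ^+ 2))^-1 *: (g t + b *: (- e *: conormal g t)) = pt g t (- (e * b)).
    rewrite /pt /nrm sqrrN exprMn e2 mul1r; congr (_ *: (_ + _)).
    by rewrite scalerA mulrN mulrC.
  apply: H2; first by near: b; exact: nbhs_right_gt.
  by near: b; exact: nbhs_right_lt.
Unshelve. all: by end_near. Qed.

(** The parametrization certifying [n] may be a different one, so the sides are determined anew for
    it: [n] is plus or minus its conormal, and the exterior condition forces the sign opposite to
    the side of [G]. *)
Lemma outer_normal_in y n : sphere_boundary G = bd -> is_outer_normal G y n ->
  \forall b \near 0^'+, G ((Num.sqrt (1 + b ^+ 2))^-1 *: (y - b *: n)).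
Proof.
move=> sbE [n1 ny [g [t []]]]; rewrite sbE => HC gty ng1 nout.
have [c [e [c0 e2 H1 _ _]]] := collar_sides HC.
have un := conormal_unit HC bdS t.
pose s := dotv n (conormal g t).
have nE : n = s *: conormal g t.
  have := curve_frame HC bdS n t; rewrite gty ny scale0r add0r.
  by rewrite /tangent dotvZr ng1 mulr0 scale0r add0r.
have s2 : s ^+ 2 = 1.
  have : dotv n n = 1 by rewrite -enorm_sq n1 expr1n.
  by rewrite nE dotvZl dotvZr un mulr1 expr2.
have ptE b : (Num.sqrt (1 + b ^+ 2))^-1 *: (y + b *: n) = pt g t (s * b).
  by rewrite /pt /nrm exprMn s2 mul1r gty {1}nE scalerA [b * s]mulrC.
have ptE' b : (Num.sqrt (1 + b ^+ 2))^-1 *: (y - b *: n) = pt g t (- s * b).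
  by rewrite mulNr -mulrN -ptE sqrrN scaleNr.
have se : s = - e.
  have : (s - e) * (s + e) = 0 by rewrite -subr_sqr s2 e2 subrr.
  move=> /eqP; rewrite mulf_eq0 => /orP[]; last by rewrite addr_eq0 => /eqP.
  rewrite subr_eq0 => /eqP E; exfalso.
  have [b [nb [b0 bc]]] := filter_ex (filterI nout (filterI (nbhs_right_gt (0 : R)) (nbhs_right_lt c0))).
  by apply: nb; rewrite ptE E; apply: subset_closure; exact: H1.
near=> b; rewrite ptE' se opprK; apply: H1; first by near: b; exact: nbhs_right_gt.
by near: b; exact: nbhs_right_lt.
Unshelve. all: by end_near. Qed.

(** The approach along the normal takes place inside [G], so for functions continuous up to the
    boundary the limit condition amounts to prescribed boundary values. This serves existence and
    uniqueness alike. *)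
Lemma interior_limit_cont (g : R -> V3) U y : C2_simple_closed_param g bd -> sphere_boundary G = bd ->
  bd y -> {within closure G, continuous U} -> interior_limit G U y (U y).
Proof.
move=> HC sbE bdy /withinP cU; rewrite /interior_limit.
have : is_outer_normal G y (outer_normal G y).
  exact: (xgetPex 0 (outer_normal_ex HC sbE bdy)).
set n := outer_normal G y => nn; have nG := outer_normal_in sbE nn.
pose p (b : R) := (Num.sqrt (1 + b ^+ 2))^-1 *: (y - b *: n).
have cp : ctn p 0.
  apply: ctnZ; last by ctac.
  apply: ctnV; first by rewrite gt_eqF// sqrt1D_gt0.
  by apply: (@ctn_comp _ _ _ (@Num.sqrt R) (fun s : R => 1 + s ^+ 2)); [ctac|exact: sqrt_continuous].
have p0 : p 0 = y by rewrite /p expr0n /= addr0 sqrtr1 invr1 scale1r scale0r subr0.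
apply/cvgrPdist_le => e e0; have [d d0 Hd] := cU y bdy.1 e e0.
have np : \forall b \near 0^'+, `|p b - y| < d.
  have : \forall b \near (0 : R), `|p b - y| < d.
    have : nbhs (p 0) [set z | `|z - y| < d].
      by rewrite p0; apply/nbhs_ballP; exists d => //= z; rewrite -ball_normE /= distrC.
    by move=> /cp.
  exact: cvg_at_right_filter.
near=> b; rewrite distrC; apply: Hd; last by near: b.
by apply: subset_closure; near: b.
Unshelve. all: by end_near. Qed.

End Region.

Theorem theorem2p3 (R : realType) (G : set 'rV[R]_3) (F H : 'rV[R]_3 -> R)
    (hG : regular_region G)
    (hF : {within sphere_boundary G, continuous F})
    (hH : sphere_C1_closure G H) :
  exists U : 'rV[R]_3 -> R,
    dirichlet_solution G F H U /\
    forall V : 'rV[R]_3 -> R, dirichlet_solution G F H V ->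
      forall xi, closure G xi -> V xi = U xi.
Proof.
case: hG => -[Q oO GE] _ _ cG [g]; have sbE := sphere_boundaryE oO GE.
rewrite sbE => HC; rewrite sbE in hF.
have GS : G `<=` sphere R by rewrite GE => x [].
have oC : open (cone G) := open_cone oO GE.
have bdS : closure G `\` G `<=` sphere R by move=> x [Kx _]; exact: (K_sphere GE).
have [c [e [c0 e2 _ H2 H3]]] := collar_sides oO GE cG HC.
have c20 : 0 < c / 2 by rewrite divr_gt0.
have c2c : c / 2 < c by rewrite ltr_pdivrMr// ltr_pMr// ltr1n.
(* The barrier pole is the centre of the exterior touching cap at normal coordinate [c / 2]; any
   value strictly between 0 and [c] would do. *)
have barr y : (closure G `\` G) y -> exists c, [/\ sphere R c, ~ closure G c &
    forall x, closure G x -> x != y -> dotv x c < dotv y c].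
  move=> /(curve_ex HC)[t <-]; exists (pt g t (- (e * (c / 2)))); split.
  - exact: (pt_sphere HC bdS).
  - exact: H2.
  - exact: H3.
have bd0 : exists y, (closure G `\` G) y by exists (g 0); exact: (curve_range HC).
have [cH C1H _] := hH.
have lH : loclip (cone G) (fun x => H (sphere_proj x) / enorm x ^+ 2) by exact: C1_loclip.
have [N [oN GN C2 lapU]] := perron_solution oO GE hF cH lH barr bd0.
have [sC2 belt] := C2on_sphere_C2 GS oC oN GN C2.
have cU := perron_cont oO GE hF cH lH barr bd0.
have Ubd := perron_bd oO GE hF cH barr bd0.
exists (perron G F H); split.
  split=> //; first by move=> x Gx; rewrite belt// lapU.
  move=> x; rewrite sbE => bdx; rewrite -(Ubd _ bdx).
  exact: (interior_limit_cont oO GE cG HC sbE bdx cU).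
move=> V [VC2 cV Vbelt Vlim].
(* The limit along the outer normal is evaluated twice, by continuity of [V] and by its boundary
   condition. *)
have Vbd x : closure G x -> ~ G x -> V x = perron G F H x.
  move=> Kx nG; have bdx : (closure G `\` G) x by split.
  rewrite (Ubd _ bdx).
  have l1 := interior_limit_cont oO GE cG HC sbE bdx cV.
  have l2 : interior_limit G V x (F x) by apply: Vlim; rewrite sbE.
  exact: (cvg_unique _ l1 l2).
have [y bdy] := bd0; have [p [Sp nKp _]] := barr y bdy.
move=> x Kx; apply/eqP; rewrite eq_le; apply/andP; split.
  apply: (sphere_dirichlet_unique GS oC oO GE Sp nKp cV cU VC2 sC2 Vbelt _ Vbd Kx).
  by move=> z Gz; rewrite belt// lapU.
apply: (sphere_dirichlet_unique GS oC oO GE Sp nKp cU cV sC2 VC2 _ Vbelt _ Kx).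
  by move=> z Gz; rewrite belt// lapU.
by move=> z Kz nGz; rewrite Vbd.
Qed.
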